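(* The numerical solutions $v_i$ are uniformly bounded in the $L^\infty$ norm: $$\begin{aligned}\|v_i\|_{L^\infty(S_i\times\Omega)}\le{}&\|P_iv_T\|_{L^\infty(\Omega)}+2\|P_ig\|_{L^\infty(\Omega)}\\&+T\sup_{(\alpha,\beta)}\Bigl[\bigl(\|\bar a_i^{(\alpha,\beta)}\|_{L^\infty(\Omega)}+\|\bar{\bar a}_i^{(\alpha,\beta)}\|_{L^\infty(\Omega)}\bigr)\|\Delta g\|_{L^\infty(\Omega)}\\&+\bigl(\|\bar b_i^{(\alpha,\beta)}\|_{L^\infty(\Omega)}+\|\bar{\bar b}_i^{(\alpha,\beta)}\|_{L^\infty(\Omega)}\bigr)\|P_ig\|_{W^{1,\infty}(\Omega)}\\&+\bigl(\|\bar c_i^{(\alpha,\beta)}\|_{L^\infty(\Omega)}+\|\bar{\bar c}_i^{(\alpha,\beta)}\|_{L^\infty(\Omega)}\bigr)\|P_ig\|_{L^\infty(\Omega)}+\|f_i^{(\alpha,\beta)}\|_{L^\infty(\Omega)}\Bigr].\end{aligned}$$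
   Context: **Problem data.** Let $d\ge 2$, $\Omega\subset\mathbb R^d$ a bounded Lipschitz domain, $T>0$, and $A,B$ compact metric spaces. For $(\alpha,\beta)\in A\times B$ let $a^{(\alpha,\beta)},c^{(\alpha,\beta)},f^{(\alpha,\beta)}\in C(\overline\Omega)$, $b^{(\alpha,\beta)}\in C(\overline\Omega,\mathbb R^d)$, $a^{(\alpha,\beta)}\ge 0$, with $(\alpha,\beta)\mapsto(a^{(\alpha,\beta)},b^{(\alpha,\beta)},c^{(\alpha,\beta)},f^{(\alpha,\beta)})$ continuous in the sup norms, the four families being equicontinuous. Let $v_T\in C(\overline\Omega)$, $g\in\{w\in W^{1,\infty}(\mathbb R^d):\Delta w\in L^\infty(\Omega)\}$, $v_T=g$ on $\partial\Omega$. **Finite elements.** For $i\in\mathbb N$ let $V_i$ be the space of continuous piecewise linear finite element functions on a mesh of $\Omega$ (the sequence being shape-regular) with nodes $y_i^\ell$ and hat functions $\phi_i^\ell$; $\hat\phi_i^\ell=\phi_i^\ell/\|\phi_i^\ell\|_{L^1(\Omega)}$. $V_i^0\subset V_i$ is the subspace vanishing on $\partial\Omega$, $N_i=\dim V_i^0$, and nodes are ordered so that $y_i^\ell\in\Omega$ iff $\ell\le N_i$. The mesh size $\Delta x_i\to0$; the uniform time step $h_i\to0$ with $T/h_i\in\mathbb N$; $s_i^k=kh_i$, $S_i=\{s_i^k:k=0,\dots,T/h_i\}$. Functions in $V_i$ are identified with their vectors of nodal values. $\langle\cdot,\cdot\rangle$ is the $L^2(\Omega)$ inner product. **Projections.**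 $P_i$ are linear mappings taking $H^1(\Omega)$ functions $w$ (time-dependent functions being projected at each time) into $V_i$ such that $\langle\nabla P_iw,\nabla\hat\phi_i^\ell\rangle=\langle\nabla w,\nabla\hat\phi_i^\ell\rangle$ for all $\hat\phi_i^\ell\in V_i^0$. It is assumed that there is $C\ge 0$ such that for every $w\in C^\infty(\mathbb R^d)$ and $i\in\mathbb N$: $\|P_iw\|_{W^{1,\infty}(\Omega)}\le C\|w\|_{W^{1,\infty}(\Omega)}$ and $\lim_{i\to\infty}\|P_iw-w\|_{W^{1,\infty}(\Omega)}=0$. $V_i^g\subset V_i$ is the set of functions which attain $P_ig$ on $\partial\Omega$. **Splitting.** Coefficients $\bar a_i^{(\alpha,\beta)},\bar{\bar a}_i^{(\alpha,\beta)}$ (scalar, with values at the nodes), $\bar b_i^{(\alpha,\beta)},\bar{\bar b}_i^{(\alpha,\beta)}$ ($\mathbb R^d$-valued), $\bar c_i^{(\alpha,\beta)},\bar{\bar c}_i^{(\alpha,\beta)},f_i^{(\alpha,\beta)}$ (scalar) depend continuously in $L^\infty$ on $(\alpha,\beta)\in A\times B$ for each $i$, and $$\lim_{i\to\infty}\sup_{(\alpha,\beta)}\Bigl(\sup_{1\le\ell\le N_i}\|a^{(\alpha,\beta)}-(\bar a_i^{(\alpha,\beta)}(y_i^\ell)+\bar{\bar a}_i^{(\alpha,\beta)}(y_i^\ell))\|_{L^\infty(\mathrm{supp}\,\hat\phi_i^\ell)}+\|b^{(\alpha,\beta)}-(\bar b_i^{(\alpha,\beta)}+\bar{\bar b}_i^{(\alpha,\beta)})\|_{L^\infty(\Omega,\mathbb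 R^d)}+\|c^{(\alpha,\beta)}-(\bar c_i^{(\alpha,\beta)}+\bar{\bar c}_i^{(\alpha,\beta)})\|_{L^\infty(\Omega)}+\|f^{(\alpha,\beta)}-f_i^{(\alpha,\beta)}\|_{L^\infty(\Omega)}\Bigr)=0.$$ Also $\bar c_i^{(\alpha,\beta)},\bar{\bar c}_i^{(\alpha,\beta)}\ge0$ and $\|\bar c_i^{(\alpha,\beta)}\|_{L^\infty}+\|\bar{\bar c}_i^{(\alpha,\beta)}\|_{L^\infty}\le\gamma$ for a constant $\gamma$ independent of $i,\alpha,\beta$. **Discrete operators.** For $\ell\le N_i$: $(\mathsf E_i^{(\alpha,\beta)}w)_\ell=\bar a_i^{(\alpha,\beta)}(y_i^\ell)\langle\nabla w,\nabla\hat\phi_i^\ell\rangle+\langle-\bar b_i^{(\alpha,\beta)}\cdot\nabla w+\bar c_i^{(\alpha,\beta)}w,\hat\phi_i^\ell\rangle$, $(\mathsf I_i^{(\alpha,\beta)}w)_\ell=\bar{\bar a}_i^{(\alpha,\beta)}(y_i^\ell)\langle\nabla w,\nabla\hat\phi_i^\ell\rangle+\langle-\bar{\bar b}_i^{(\alpha,\beta)}\cdot\nabla w+\bar{\bar c}_i^{(\alpha,\beta)}w,\hat\phi_i^\ell\rangle$, $(\mathsf F_i^{(\alpha,\beta)})_\ell=\langle f_i^{(\alpha,\beta)},\hat\phi_i^\ell\rangle$. For $\ell>N_i$: $(\mathsf E_i^{(\alpha,\beta)}w)_\ell=0$, $(\mathsf I_i^{(\alpha,\beta)}w)_\ell=w(y_i^\ell)$,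 $(\mathsf F_i^{(\alpha,\beta)})_\ell=(P_ig)_\ell$. **Monotonicity assumption.** For all $(\alpha,\beta)$ and $i$: $\mathsf E_i^{(\alpha,\beta)}$ restricted to $V_i$ (matrix in the nodal basis) has non-positive off-diagonal entries; $h_i$ is so small that all entries of $h_i\mathsf E_i^{(\alpha,\beta)}-\mathsf{Id}$ are non-positive; and $\mathsf I_i^{(\alpha,\beta)}$ has the local monotonicity property: if $v\in V_i$ has a non-positive local minimum at an interior node $y_i^\ell$ then $(\mathsf I_i^{(\alpha,\beta)}v)_\ell\le0$. **Scheme.** The numerical solution $v_i$ is given by $v_i(T,\cdot)=P_iv_T$ and, for $k=T/h_i-1,\dots,0$, by $v_i(s_i^k,\cdot)\in V_i^g$ solving $$-d_iv_i(s_i^k,\cdot)+\inf_{\beta\in B}\sup_{\alpha\in A}\bigl(\mathsf E_i^{(\alpha,\beta)}v_i(s_i^{k+1},\cdot)+\mathsf I_i^{(\alpha,\beta)}v_i(s_i^k,\cdot)-\mathsf F_i^{(\alpha,\beta)}\bigr)=0,$$ with inf and sup componentwise and $(d_iw(s_i^k,\cdot))_\ell=(w(s_i^{k+1},y_i^\ell)-w(s_i^k,y_i^\ell))/h_i$. *)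

(* Defs.v *)
From HB Require Import structures.
From mathcomp Require Import all_boot all_order all_algebra.
From mathcomp Require Import all_classical all_reals all_analysis.
Set Implicit Arguments.
Unset Strict Implicit.
Unset Printing Implicit Defensive.
Import Order.TTheory GRing.Theory Num.Theory.
Import numFieldNormedType.Exports.
Local Open Scope classical_set_scope.
Local Open Scope ring_scope.

Definition rV_display : measure_display -> measure_display.
Proof. exact. Qed.

(* Coordinate-generated sigma-algebra on R^n: since R carries its Borel
   sigma-algebra, these are the Borel sets of R^n. *)
Section rV_measurable.
Context {R : realType} (n : nat).

Let coords : 'I_n -> 'rV[R]_n -> R := fun i x => x ord0 i.

Let rV_set0 : g_sigma_preimage coords set0.
Proof. exact: sigma_algebra0. Qed.

Let rV_setC A : g_sigma_preimage coords A -> g_sigma_preimage coords (~` A).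
Proof. exact: sigma_algebraC. Qed.

Let rV_bigcup (F : _^nat) : (forall i, g_sigma_preimage coords (F i)) ->
  g_sigma_preimage coords (\bigcup_i (F i)).
Proof. exact: sigma_algebra_bigcup. Qed.

HB.instance Definition _ :=
  @isMeasurable.Build (rV_display default_measure_display)
    'rV[R]_n (g_sigma_preimage coords) rV_set0 rV_setC rV_bigcup.

End rV_measurable.

Section lebesgue_rV.
Context {R : realType}.

(* n-dimensional Lebesgue measure, by Cavalieri's principle in the first
   coordinate, i.e. the n-fold product of [lebesgue_measure]. *)
Fixpoint leb_fun (n : nat) : set 'rV[R]_n -> \bar R :=
  match n with
  | 0 => fun A => \d_(0 : 'rV[R]_0) A
  | m.+1 => fun A =>
      (\int[@lebesgue_measure R]_t
         leb_fun [set y : 'rV[R]_m | A (row_mx (t%:M : 'rV[R]_1) y)])%E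
  end.

Lemma measurable_coord n (i : 'I_n) :
  measurable_fun setT (fun x : 'rV[R]_n => x ord0 i).
Proof.
move=> _ Y mY; rewrite setTI; apply: sub_sigma_algebra.
rewrite -bigcup_seq/=; exists i; first by rewrite /= mem_index_enum.
by exists Y; rewrite ?setTI.
Qed.

Lemma measurable_fun_rV d (T : measurableType d) n (f : T -> 'rV[R]_n) :
  (forall i, measurable_fun setT (fun x => f x ord0 i)) ->
  measurable_fun setT f.
Proof.
move=> mf _ Y; rewrite setTI => mY.
have : g_sigma_preimage (fun (i : 'I_n) x => f x ord0 i) (f @^-1` Y).
  rewrite (g_sigma_preimage_comp (T := 'rV[R]_n)
    (fun (i : 'I_n) (x : 'rV[R]_n) => x ord0 i) f).
  by exists Y => //; rewrite setTI.
apply: smallest_sub; first exact: sigma_algebra_measurable.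
move=> A; rewrite -bigcup_seq/= => -[i _ [B mB <-]].
exact: mf.
Qed.

Definition cons_rV n (p : R * 'rV[R]_n) : 'rV[R]_n.+1 :=
  row_mx (p.1%:M : 'rV[R]_1) p.2.

Lemma cons_rV0 n p : @cons_rV n p ord0 ord0 = p.1.
Proof.
have -> : ord0 = lshift n (ord0 : 'I_1) by exact/val_inj.
by rewrite /cons_rV [LHS]row_mxEl mxE eqxx mulr1n.
Qed.

Lemma cons_rVS n p j : @cons_rV n p ord0 (lift ord0 j) = p.2 ord0 j.
Proof.
have -> : lift ord0 j = rshift 1 j by exact/val_inj.
by rewrite /cons_rV [LHS]row_mxEr.
Qed.

Lemma measurable_cons n : measurable_fun setT (@cons_rV n).
Proof.
apply: measurable_fun_rV => i; have [j ->|->] := unliftP ord0 i.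
  under eq_fun do rewrite cons_rVS.
  by apply: (measurableT_comp (measurable_coord j)); exact: measurable_snd.
by under eq_fun do rewrite cons_rV0; exact: measurable_fst.
Qed.

HB.instance Definition _ n :=
  isMeasurableFun.Build _ _ _ _ (@cons_rV n) (@measurable_cons n).

Let box n (k : nat) : set 'rV[R]_n := [set x | forall i, `|x ord0 i| <= k%:R].

Let measurable_box n k : measurable (@box n k).
Proof.
have -> : @box n k = \bigcap_(i in [set: 'I_n])
    ((fun x : 'rV[R]_n => x ord0 i) @^-1` `[- k%:R, k%:R]).
  by apply/seteqP; split=> x bx i; [move=> _|];
    move: (bx i); rewrite /= in_itv/= ler_norml => // /(_ I).
apply: fin_bigcap_measurable => // i _; rewrite -[X in measurable X]setTI.
exact: measurable_coord.
Qed.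

Let bigcup_box n : \bigcup_k @box n k = setT.
Proof.
rewrite -subTset => x _; exists (Num.bound `|x|) => // i.
apply: le_trans (ltW (archi_boundP (normr_ge0 x))).
rewrite [leRHS]/Num.norm/= mx_normrE.
exact: (le_bigmax _ (fun ij : 'I_1 * 'I_n => `|x ij.1 ij.2|) (ord0, i)).
Qed.

Lemma leb_ex n : exists m : {sigma_finite_measure set 'rV[R]_n -> \bar R},
  (forall A, @leb_fun n A = m A) /\ (forall k, (m (@box n k) < +oo)%E).
Proof.
elim: n => [|n [m [mE mfin]]].
  exists (\d_(0 : 'rV[R]_0)); split=> // k.
  by change ((((0 : 'rV[R]_0) \in @box 0 k)%:R : R)%:E < +oo)%E; exact: ltry.
pose mu : {measure set 'rV[R]_n.+1 -> \bar R} :=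
  measure_function_pushforward__canonical__measure_function_Measure
    (@lebesgue_measure R \x m)%E (@measurable_cons n).
have mub k : (mu (@box n.+1 k) < +oo)%E.
  have -> : mu (@box n.+1 k) =
      (@lebesgue_measure R \x m)%E (`[- k%:R, k%:R] `*` @box n k).
    congr product_measure1; apply/seteqP; split => -[t x] /= H.
      split; first by rewrite in_itv/= -ler_norml; have := H ord0;
        rewrite cons_rV0.
      by move=> i; have := H (lift ord0 i); rewrite cons_rVS.
    move=> i; have [j ->|->] := unliftP ord0 i.
      by rewrite cons_rVS; exact: H.2.
    by rewrite cons_rV0 ler_norml; have := H.1; rewrite in_itv.
  rewrite product_measure1E//; last exact: measurable_box.
  have Ifin : @lebesgue_measure R `[- k%:R, k%:R] \is a fin_num.
    by rewrite lebesgue_measure_itv/=; case: ifP.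
  exact: (lte_mul_pinfty (measure_ge0 _ _) Ifin (mfin k)).
have sf : sigma_finite setT mu.
  exists (@box n.+1) => [|k]; first by rewrite bigcup_box.
  by split; [exact: measurable_box|exact: mub].
pose sfm := @Measure_isSigmaFinite.Build _ _ _ mu sf.
pose mu' : {sigma_finite_measure set _ -> \bar R} :=
  HB.pack (mu : set _ -> \bar R) mu sfm.
exists mu'; split => // A.
rewrite /= /mu'/= /pushforward/= /product_measure1/=.
by apply: eq_integral => t _; rewrite mE /=; congr (m _);
  apply/seteqP; split=> y /=; rewrite /xsection /= inE.
Qed.

Definition leb n : set 'rV[R]_n -> \bar R := @leb_fun n.

Let leb0 n : @leb n set0 = 0%E.
Proof. by rewrite /leb; have [m [-> _]] := leb_ex n; rewrite measure0. Qed.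

Let leb_ge0 n A : (0 <= @leb n A)%E.
Proof. by rewrite /leb; have [m [-> _]] := leb_ex n; exact: measure_ge0. Qed.

Let leb_sigma_additive n : semi_sigma_additive (@leb n).
Proof.
have [m [mE _]] := leb_ex n.
have -> : @leb n = m by apply/funext.
exact: measure_semi_sigma_additive.
Qed.

HB.instance Definition _ n :=
  isMeasure.Build _ _ _ (@leb n) (@leb0 n) (@leb_ge0 n) (@leb_sigma_additive n).

Let leb_sigma_finite n : sigma_finite setT (@leb n).
Proof.
have [m [mE _]] := leb_ex n.
have -> : @leb n = m by apply/funext.
exact: sigma_finiteT.
Qed.

HB.instance Definition _ n :=
  @Measure_isSigmaFinite.Build _ _ _ (@leb n) (@leb_sigma_finite n).

End lebesgue_rV.
Arguments leb {R n}.

Section euclidean.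
Context {R : realType} {d : nat}.
Notation E := 'rV[R]_d.

(* The library norm on 'rV[R]_d is the max norm, hence the Euclidean one here. *)
Definition dotv (u v : E) : R := \sum_(j < d) u ord0 j * v ord0 j.
Definition enorm (u : E) : R := Num.sqrt (dotv u u).
Definition eball (x : E) (r : R) : set E := [set y | enorm (y - x) < r].
Definition ediam (S : set E) : R := sup [set enorm (x - y) | x in S & y in S].

Definition boundary (Om : set E) : set E := closure Om `\` interior Om.

(* Near each boundary point, [Om] is, in suitable Cartesian coordinates, the
   strict epigraph of a Lipschitz function: [e] is the last coordinate
   direction and [gam] is evaluated on the hyperplane orthogonal to [e]. *)
Definition lipschitz_boundary (Om : set E) : Prop :=
  forall z, boundary Om z ->
  exists (r L : R) (e : E) (gam : E -> R),
    [/\ 0 < r, enorm e = 1,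
        forall x y, dotv x e = 0 -> dotv y e = 0 ->
          `|gam x - gam y| <= L * enorm (x - y) &
        forall x, eball z r x ->
          (Om x <-> gam (x - dotv x e *: e) < dotv x e)].

Definition lipschitz_domain (Om : set E) : Prop :=
  [/\ Om !=set0, open Om, connected Om, bounded_set Om & lipschitz_boundary Om].

End euclidean.

Section function_spaces.
Context {R : realType} {d : nat}.
Notation E := 'rV[R]_d.
Implicit Types (Om D : set E) (w phi L : E -> R) (G F : E -> E).

Fixpoint Ck (k : nat) (w : E -> R) : Prop :=
  continuous w /\
  (if k is k'.+1 then
     forall j : 'I_d, (forall x, derivable w x 'e_j) /\ Ck k' ('D_('e_j) w)
   else True).

Definition smooth w : Prop := forall k, Ck k w.

Definition test_function Om phi : Prop :=
  smooth phi /\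
  exists K : set E, [/\ compact K, K `<=` Om & forall x, ~ K x -> phi x = 0].

Definition loc_integrable Om w : Prop :=
  forall K : set E, compact K -> K `<=` Om -> leb.-integrable K (EFin \o w).

Definition is_weak_grad Om w G : Prop :=
  loc_integrable Om w /\
  forall j : 'I_d, loc_integrable Om (fun x => G x ord0 j) /\
    forall phi, test_function Om phi ->
      \int[leb]_(x in Om) (w x * 'D_('e_j) phi x) =
      - \int[leb]_(x in Om) (G x ord0 j * phi x).

Definition is_weak_lap Om w L : Prop :=
  [/\ loc_integrable Om w, loc_integrable Om L &
    forall phi, test_function Om phi ->
      \int[leb]_(x in Om)
        (w x * (\sum_(j < d) 'D_('e_j) ('D_('e_j) phi) x)) =
      \int[leb]_(x in Om) (L x * phi x)].

(* Representatives, unique up to a null set of [Om]. *)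
Definition weak_grad Om w : E -> E :=
  xget (cst 0) [set G | is_weak_grad Om w G].
Definition weak_lap Om w : E -> R := xget (cst 0) [set L | is_weak_lap Om w L].

Definition supn D w : \bar R := ereal_sup [set `|w x|%:E | x in D].
Definition supnv D F : \bar R := supn D (enorm \o F).

Definition Linf D w : \bar R := 'N[leb]_+oo[EFin \o (w \_ D)].
Definition Linfv D F : \bar R := Linf D (enorm \o F).

Definition W1inf Om w : \bar R :=
  Order.max (Linf Om w) (Linfv Om (weak_grad Om w)).

Definition in_Linf D w : Prop := measurable_fun D w /\ (Linf D w < +oo)%E.
Definition in_Linfv D F : Prop := measurable_fun D F /\ (Linfv D F < +oo)%E.

Definition in_W1inf Om w : Prop :=
  in_Linf Om w /\ exists2 G, is_weak_grad Om w G & in_Linfv Om G.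

Definition in_L2 Om w : Prop :=
  measurable_fun Om w /\ leb.-integrable Om (fun x => (w x ^+ 2)%:E).

Definition in_H1 Om w : Prop :=
  in_L2 Om w /\
  exists2 G, is_weak_grad Om w G & forall j, in_L2 Om (fun x => G x ord0 j).

(* For a family of functions, given with a norm (possibly infinite). *)
Definition norm_continuous (P : topologicalType) (V : zmodType)
    (N : V -> \bar R) (F : P -> V) : Prop :=
  forall p, N (F q - F p) @[q --> p] --> 0%E.

End function_spaces.

Section finite_elements.
Context {R : realType} {d : nat}.
Notation E := 'rV[R]_d.

(* A cell is given by the set of indices of its vertices; the nodes in the
   domain are those of index < nint, see [is_mesh]. *)
Record mesh := Mesh {
  nnode : nat;
  nint : nat;
  node : 'I_nnode -> E;
  cells : {set {set 'I_nnode}} }.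

Definition simplex (M : mesh) (K : {set 'I_(nnode M)}) : set E :=
  [set x | exists lam : 'I_(nnode M) -> R,
    [/\ forall l, 0 <= lam l, forall l, l \notin K -> lam l = 0,
        \sum_l lam l = 1 & x = \sum_l lam l *: node l]].

Definition affinely_independent (M : mesh) (K : {set 'I_(nnode M)}) : Prop :=
  forall lam : 'I_(nnode M) -> R,
    (forall l, l \notin K -> lam l = 0) -> \sum_l lam l = 0 ->
    \sum_l lam l *: node l = 0 -> forall l, lam l = 0.

(* Only the values on [closure Om] of a member of [fe_space] matter. *)
Definition fe_space (Om : set E) (M : mesh) : set (E -> R) :=
  [set w | {within closure Om, continuous w} /\
    forall K, K \in cells M -> exists (p : E) (c : R),
      forall x, simplex K x -> w x = dotv p x + c].

Definition fe_space_bc (Om : set E) (M : mesh) (u : E -> R) : set (E -> R) :=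
  [set w | fe_space Om M w /\ forall x, boundary Om x -> w x = u x].

Definition fe_space0 (Om : set E) (M : mesh) : set (E -> R) :=
  fe_space_bc Om M (cst 0).

(* [V], a vector space of functions on [D], has dimension [n]. *)
Definition has_dim (D : set E) (V : set (E -> R)) (n : nat) : Prop :=
  exists b : 'I_n -> E -> R, (forall l, V (b l)) /\
    forall w, V w -> exists! c : 'rV[R]_n,
      forall x, D x -> w x = \sum_(l < n) c ord0 l * b l x.

(* Conforming simplicial mesh of [Om]. *)
Record is_mesh (Om : set E) (M : mesh) : Prop := IsMesh {
  node_inj : injective (@node M);
  node_cell : forall l : 'I_(nnode M), exists2 K, K \in cells M & l \in K;
  cell_card : forall K, K \in cells M -> #|K| = d.+1;
  cell_affine : forall K, K \in cells M -> affinely_independent K;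
  cell_conform : forall K K', K \in cells M -> K' \in cells M ->
    simplex K `&` simplex K' `<=` simplex (K :&: K');
  cell_cover : \bigcup_(K in [set K | K \in cells M]) simplex K = closure Om;
  node_order : forall l : 'I_(nnode M), Om (node l) <-> (l < nint M)%N;
  nint_dim : has_dim (closure Om) (fe_space0 Om M) (nint M) }.

Definition nodal_basis (Om : set E) (M : mesh)
    (phi : 'I_(nnode M) -> E -> R) : Prop :=
  forall l, fe_space Om M (phi l) /\ forall m, phi l (node m) = (l == m)%:R.

Definition mesh_size (M : mesh) : R :=
  \big[Order.max/0]_(K in cells M) ediam (simplex K).

Definition shape_regular (M : nat -> mesh) : Prop :=
  exists2 sig : R, 0 < sig & forall i K, K \in cells (M i) ->
    exists (x : E) (r : R),
      [/\ 0 < r, eball x r `<=` simplex K & ediam (simplex K) <= sig * r].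

(* Hat function normalised in L^1(Om). *)
Definition nhat (Om : set E) (phi : E -> R) : E -> R :=
  fun x => phi x / \int[leb]_(y in Om) `|phi y|.

Definition supp (Om : set E) (w : E -> R) : set E :=
  closure (Om `&` [set x | w x != 0]).

Record is_projection (Om : set E) (M : mesh) (phi : 'I_(nnode M) -> E -> R)
    (P : (E -> R) -> E -> R) : Prop := IsProjection {
  proj_fe : forall w, in_H1 Om w -> fe_space Om M (P w);
  proj_linear : forall (a : R) w1 w2, in_H1 Om w1 -> in_H1 Om w2 ->
    forall x, closure Om x -> P (a *: w1 + w2) x = a * P w1 x + P w2 x;
  proj_ae : forall w1 w2, in_H1 Om w1 -> in_H1 Om w2 ->
    (\forall x \ae leb, Om x -> w1 x = w2 x) ->
    forall x, closure Om x -> P w1 x = P w2 x;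
  proj_orth : forall w, in_H1 Om w ->
    forall l, fe_space0 Om M (nhat Om (phi l)) ->
    \int[leb]_(x in Om)
      dotv (weak_grad Om (P w) x) (weak_grad Om (nhat Om (phi l)) x) =
    \int[leb]_(x in Om)
      dotv (weak_grad Om w x) (weak_grad Om (nhat Om (phi l)) x) }.

Definition stable_projections (Om : set E) (P : nat -> (E -> R) -> E -> R) :=
  (exists2 C : R, 0 <= C & forall i w, smooth w ->
     (W1inf Om (P i w) <= C%:E * W1inf Om w)%E) /\
  (forall w, smooth w -> W1inf Om (P i w - w) @[i --> \oo] --> 0%E).

End finite_elements.
Arguments mesh : clear implicits.

Section scheme.
Context {R : realType} {d : nat} {A B : metricType R}.
Notation E := 'rV[R]_d.

Record coefficients := Coefficients {
  co_a : A * B -> E -> R;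
  co_b : A * B -> E -> E;
  co_c : A * B -> E -> R;
  co_f : A * B -> E -> R }.

Record admissible (Om : set E) (q : coefficients) : Prop := Admissible {
  adm_a_cont : forall p, {within closure Om, continuous (co_a q p)};
  adm_b_cont : forall p, {within closure Om, continuous (co_b q p)};
  adm_c_cont : forall p, {within closure Om, continuous (co_c q p)};
  adm_f_cont : forall p, {within closure Om, continuous (co_f q p)};
  adm_a_ge0 : forall p x, closure Om x -> 0 <= co_a q p x;
  adm_a_dep : norm_continuous (supn (closure Om)) (co_a q);
  adm_b_dep : norm_continuous (supnv (closure Om)) (co_b q);
  adm_c_dep : norm_continuous (supn (closure Om)) (co_c q);
  adm_f_dep : norm_continuous (supn (closure Om)) (co_f q);
  adm_a_equi : equicontinuous [set: A * B]
    (fun p => (co_a q p : subspace (closure Om) -> R));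
  adm_b_equi : equicontinuous [set: A * B]
    (fun p => (co_b q p : subspace (closure Om) -> E));
  adm_c_equi : equicontinuous [set: A * B]
    (fun p => (co_c q p : subspace (closure Om) -> R));
  adm_f_equi : equicontinuous [set: A * B]
    (fun p => (co_f q p : subspace (closure Om) -> R)) }.

(* Suffix E: explicit part (single bar); suffix I: implicit part (double bar). *)
Record splitting := Splitting {
  aE : A * B -> E -> R;
  aI : A * B -> E -> R;
  bE : A * B -> E -> E;
  bI : A * B -> E -> E;
  cE : A * B -> E -> R;
  cI : A * B -> E -> R;
  fS : A * B -> E -> R }.

(* The diffusion coefficients are evaluated at nodes, so they are functions
   rather than a.e.-classes and their uniform norm is the supremum over [Om];
   it is the L^infinity norm whenever they are continuous. *)
Record split_admissible (Om : set E) (s : splitting) : Prop := SplitAdmissible {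
  sp_aE : forall p, measurable_fun Om (aE s p) /\ (supn Om (aE s p) < +oo)%E;
  sp_aI : forall p, measurable_fun Om (aI s p) /\ (supn Om (aI s p) < +oo)%E;
  sp_bE : forall p, in_Linfv Om (bE s p);
  sp_bI : forall p, in_Linfv Om (bI s p);
  sp_cE : forall p, in_Linf Om (cE s p);
  sp_cI : forall p, in_Linf Om (cI s p);
  sp_f : forall p, in_Linf Om (fS s p);
  sp_aE_dep : norm_continuous (supn Om) (aE s);
  sp_aI_dep : norm_continuous (supn Om) (aI s);
  sp_bE_dep : norm_continuous (Linfv Om) (bE s);
  sp_bI_dep : norm_continuous (Linfv Om) (bI s);
  sp_cE_dep : norm_continuous (Linf Om) (cE s);
  sp_cI_dep : norm_continuous (Linf Om) (cI s);
  sp_f_dep : norm_continuous (Linf Om) (fS s);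
  sp_cE_ge0 : forall p, \forall x \ae leb, Om x -> 0 <= cE s p x;
  sp_cI_ge0 : forall p, \forall x \ae leb, Om x -> 0 <= cI s p x }.

Definition consistency_error (Om : set E) (M : mesh R d)
    (phi : 'I_(nnode M) -> E -> R) (q : coefficients) (s : splitting) :
  \bar R :=
  ereal_sup [set
    (\big[Order.max/0]_(l < nnode M | (l < nint M)%N)
       Linf (supp Om (nhat Om (phi l)))
         (fun x => (co_a q p x - (aE s p (node l) + aI s p (node l)))%R)
     + Linfv Om (co_b q p - (bE s p + bI s p)%R)%R
     + Linf Om (co_c q p - (cE s p + cI s p)%R)%R
     + Linf Om (co_f q p - fS s p)%R)%E | p in [set: A * B]].

Section discrete_operators.
Variables (Om : set E) (M : mesh R d) (phi : 'I_(nnode M) -> E -> R).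
Variables (s : splitting) (Pg : E -> R) (p : A * B).

Definition disc_op (a : E -> R) (b : E -> E) (c w : E -> R)
    (l : 'I_(nnode M)) : R :=
  a (node l) * \int[leb]_(x in Om)
     dotv (weak_grad Om w x) (weak_grad Om (nhat Om (phi l)) x) +
  \int[leb]_(x in Om)
     ((- dotv (b x) (weak_grad Om w x) + c x * w x) * nhat Om (phi l) x).

Definition opE (w : E -> R) (l : 'I_(nnode M)) : R :=
  if (l < nint M)%N then disc_op (aE s p) (bE s p) (cE s p) w l else 0.

Definition opI (w : E -> R) (l : 'I_(nnode M)) : R :=
  if (l < nint M)%N then disc_op (aI s p) (bI s p) (cI s p) w l else w (node l).

Definition rhsF (l : 'I_(nnode M)) : R :=
  if (l < nint M)%N then \int[leb]_(x in Om) (fS s p x * nhat Om (phi l) x)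
  else Pg (node l).

End discrete_operators.

(* The entry (l, m) of the matrix of [opE] in the nodal basis is
   [opE (phi m) l]. *)
Record monotone_scheme (Om : set E) (M : mesh R d)
    (phi : 'I_(nnode M) -> E -> R) (s : splitting) (h : R) : Prop :=
  MonotoneScheme {
  mono_offdiag : forall p l m, l != m -> opE Om phi s p (phi m) l <= 0;
  mono_step : forall p l m, h * opE Om phi s p (phi m) l - (l == m)%:R <= 0;
  mono_I : forall p (v : E -> R) (l : 'I_(nnode M)), fe_space Om M v ->
    (l < nint M)%N -> v (node l) <= 0 ->
    (\forall x \near node l, v (node l) <= v x) ->
    opI Om phi s p v l <= 0 }.

Definition time (h : R) (k : nat) : R := k%:R * h.

Definition dtime (M : mesh R d) (h : R) (v : R -> E -> R) (k : nat)
    (l : 'I_(nnode M)) : R :=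
  (v (time h k.+1) (node l) - v (time h k) (node l)) / h.

(* [v] solves the scheme with [n] time steps of length [h] = T / n. The
   membership of [P vT] in the finite element space expresses that [P] is
   defined at [vT], which need not be an H^1 function. *)
Record numerical_solution (Om : set E) (T : R) (M : mesh R d)
    (phi : 'I_(nnode M) -> E -> R) (s : splitting) (P : (E -> R) -> E -> R)
    (g vT : E -> R) (h : R) (n : nat) (v : R -> E -> R) : Prop :=
  NumericalSolution {
  sol_final_fe : fe_space Om M (P vT);
  sol_final : forall x, closure Om x -> v T x = P vT x;
  sol_bc : forall k, (k < n)%N -> fe_space_bc Om M (P g) (v (time h k));
  sol_eq : forall k, (k < n)%N -> forall l : 'I_(nnode M),
    ((- dtime h v k l)%:E +
     ereal_inf [set ereal_sup [set
       (opE Om phi s (al, be) (v (time h k.+1)) l +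
        opI Om phi s (al, be) (v (time h k)) l -
        rhsF Om phi s (P g) (al, be) l)%:E
       | al in [set: A]] | be in [set: B]] = 0)%E }.

End scheme.
Arguments coefficients {R} d A B.
Arguments splitting {R} d A B.

(* Main.v *)
Require Import Defs.
From mathcomp Require Import all_boot all_order all_algebra.
From mathcomp Require Import all_classical all_reals all_analysis.
From mathcomp Require Import measurable_realfun ess_sup_inf.
From mathcomp Require Import ring lra.
Set Implicit Arguments.
Unset Strict Implicit.
Unset Printing Implicit Defensive.
Import Order.TTheory GRing.Theory Num.Theory.
Import numFieldNormedType.Exports.
Local Open Scope classical_set_scope.
Local Open Scope ring_scope.

(** Subtract the projected boundary data. The difference w^k = v^k - P g is a
    finite element function that vanishes at the boundary nodes before the final
    time, and it solves the scheme whose right-hand side is minus the residual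
    r = E (P g) + I (P g) - F. At a node where w^k has a positive maximum,
    I w^k >= 0 for all controls, by local monotonicity applied to - w^k; and
    Id - h E is a matrix with nonnegative entries and row sums at most one, since
    the hat functions sum to 1 and E 1 is an integral of c >= 0
    ([explicit_step_bound]). Hence the maximum norm of w grows by at most
    h sup |r| in one step ([step_bound]), and by at most T sup |r| in all. This
    gives the factor 2 in front of the norm of P g: once to bound w at the final
    time and once to return from w to v.

    The residual is bounded by the bracket of the statement ([residual_le]). Its
    lower order terms are integrals against a hat function of mass at most one.
    In the diffusion terms the projection replaces P g by g, and Green's formula
    turns the integral of grad g . grad phi into that of - (Delta g) phi
    ([green_nhat]).

    Two facts behind this argument need proof because gradients and Laplacians
    are weak, and known only through representatives. First, the operators are
    linear on the finite element space. A finite element function has its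
    piecewise constant gradient as weak gradient ([fe_weak_grad]): difference
    quotients along a coordinate direction are bounded, and at almost every point
    they are computed within one cell, because the points at which a line leaves
    a simplex form a null set. Weak gradients are unique by the fundamental lemma
    of the calculus of variations ([fundamental_lemma]), so linearity holds
    almost everywhere, which is enough under the integral.

    Second, Green's formula must hold for a hat function that is neither smooth
    nor compactly supported in the domain, and a g whose weak derivatives are
    merely bounded. The hat function is first truncated at a small height, which
    gives it compact support ([fe_green]). The two sides are then compared
    through the correlations of the hat function with translates of the weak
    derivatives: their difference has vanishing mean against all small bumps
    centred at 0, and it is continuous at 0 since translations are continuous in
    L^1 ([green_lipschitz]). That interior hat functions vanish on the boundary
    follows from the dimension of the space with zero boundary values
    ([hat_boundary]). *)

(** * Lebesgue measure of boxes *)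

Section boxes.
Context {R : realType}.

Definition obox n (a b : 'I_n -> R) : set 'rV[R]_n :=
  [set x | forall i, a i < x ord0 i < b i].

Lemma measurable_obox n (a b : 'I_n -> R) : measurable (obox a b).
Proof.
have -> : obox a b = \bigcap_(i in [set: 'I_n])
    ((fun x : 'rV[R]_n => x ord0 i) @^-1` `]a i, b i[).
  apply/seteqP; split=> x bx i.
    by move=> _; rewrite /= in_itv/=; exact: bx.
  by have := bx i I; rewrite /= in_itv.
apply: fin_bigcap_measurable => // i _; rewrite -[X in measurable X]setTI.
exact: measurable_coord.
Qed.

(** Induction on the dimension: the section of a box over its first coordinate
    is a box of lower dimension or empty. *)
Lemma leb_obox n (a b : 'I_n -> R) :
  leb (obox a b) = (\prod_i Num.max 0 (b i - a i))%:E.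
Proof.
elim: n a b => [|n IH] a b.
  rewrite big_ord0 /leb/= diracE mem_set// => -[].
  by [].
rewrite big_ord_recl.
pose a' := fun i => a (lift ord0 i); pose b' := fun i => b (lift ord0 i).
have ge0 : 0 <= \prod_i Num.max 0 (b' i - a' i).
  by apply: prodr_ge0 => i _; rewrite le_max lexx.
rewrite [LHS](_ : _ = \int[@lebesgue_measure R]_t
    ((\prod_i Num.max 0 (b' i - a' i))%:E * (\1_(`]a ord0, b ord0[) t)%:E))%E.
  rewrite ge0_integralZl//; last first.
    by apply/measurable_EFinP; exact: measurable_indic.
  rewrite integral_indic// setIT.
  rewrite (_ : _ `]_, _[%classic = @lebesgue_measure R `]a ord0, b ord0[)//.
  rewrite lebesgue_measure_itv/= lte_fin.
  case: ltP => ab.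
    by rewrite -EFinD -EFinM max_r ?subr_ge0 ?ltW// mulrC.
  by rewrite mule0 max_l ?mul0r// subr_le0.
apply: eq_integral => t _.
have E : [set y | obox a b (row_mx (t%:M : 'rV[R]_1) y)] =
    if t \in `]a ord0, b ord0[ then obox a' b' else set0.
  rewrite in_itv/=; case: ifPn => tab.
    apply/seteqP; split => y /= yab i.
      by have := yab (lift ord0 i); rewrite (cons_rVS (t, y)).
    have [j ->|->] := unliftP ord0 i.
      by rewrite (cons_rVS (t, y)); exact: yab.
    by rewrite (cons_rV0 (t, y)).
  apply/seteqP; split => y //= /(_ ord0); rewrite (cons_rV0 (t, y)) /=.
  exact/negP.
rewrite -/leb_fun E indicE mem_setE.
case: ifPn => tab.
  by rewrite -/(leb (obox a' b')) IH mule1.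
by rewrite -/(leb set0) measure0 mule0.
Qed.

Definition oboxes n : set (set 'rV[R]_n) :=
  [set A | exists a b, A = obox a b].

Lemma obox_setI n (a b a' b' : 'I_n -> R) : obox a b `&` obox a' b' =
  obox (fun i => Num.max (a i) (a' i)) (fun i => Num.min (b i) (b' i)).
Proof.
apply/seteqP; split => [x [x1 x2] i|x x12].
  by rewrite gt_max lt_min; have /andP[-> ->] := x1 i; have /andP[-> ->] := x2 i.
by split=> i; have := x12 i; rewrite gt_max lt_min => /andP[/andP[? ?] /andP[? ?]];
  apply/andP.
Qed.

Lemma oboxI n : setI_closed (@oboxes n).
Proof.
by move=> _ _ [a [b ->]] [a' [b' ->]]; rewrite obox_setI; do 2 eexists; reflexivity.
Qed.

Definition cube n (k : nat) : set 'rV[R]_n :=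
  obox (fun=> - k%:R) (fun=> k%:R).

Lemma coord_le_norm n (x : 'rV[R]_n) i : `|x ord0 i| <= `|x|.
Proof.
rewrite [leRHS]/Num.norm/= mx_normrE.
exact: (le_bigmax _ (fun ij : 'I_1 * 'I_n => `|x ij.1 ij.2|) (ord0, i)).
Qed.

Lemma norm_leP n (x : 'rV[R]_n) r : 0 <= r ->
  (forall i, `|x ord0 i| <= r) -> `|x| <= r.
Proof.
move=> r0 xr; rewrite [leLHS]/Num.norm/= mx_normrE.
by apply/bigmax_leP; split => // -[i j] _ /=; rewrite ord1.
Qed.

Lemma cube_shift n k (x z : 'rV[R]_n) : `|z| <= 1 -> cube k (x + z) -> cube k.+1 x.
Proof.
move=> z1 xk i; have := xk i; rewrite -!ltr_norml => h.
rewrite -[x](addrK z) mxE; apply: le_lt_trans (ler_normD _ _) _.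
rewrite -natr1; apply: ltr_leD; first exact: h.
by apply: le_trans (coord_le_norm _ _) _; rewrite normrN.
Qed.

Lemma cube_cover n : \bigcup_k (@cube n k) = setT.
Proof.
rewrite -subTset => x _; exists (Num.bound `|x|).+1 => // i.
rewrite -ltr_norml; apply: le_lt_trans (coord_le_norm x i) _.
apply: lt_trans (archi_boundP (normr_ge0 x)) _.
by rewrite ltr_nat.
Qed.

(** The coordinates generate the same sigma-algebra as the boxes, which are
    stable under intersection; measures can therefore be compared on boxes. *)
Lemma measurable_oboxesE n : measurable = <<s @oboxes n >>.
Proof.
apply/seteqP; split => A; last first.
  apply: smallest_sub; first exact: sigma_algebra_measurable.
  by move=> _ [a [b ->]]; exact: measurable_obox.
apply: smallest_sub; first exact: smallest_sigma_algebra.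
move=> {}A; rewrite -bigcup_seq/= => -[i _ [B mB <-]].
have : measurable_fun (setT : set (g_sigma_algebraType (@oboxes n)))
    (fun x : 'rV[R]_n => x ord0 i).
  apply: (measurability _ (RGenOpens.measurableE R)).
  move=> _ [_ [a [b ->]] <-]; rewrite setTI.
  have -> : (fun x : 'rV[R]_n => x ord0 i) @^-1` `]a, b[ =
      \bigcup_k (obox (fun j => if j == i then a else - k%:R)
                     (fun j => if j == i then b else k%:R)).
    apply/seteqP; split => x /=; last first.
      by case=> k _ /(_ i); rewrite eqxx in_itv.
    rewrite in_itv/= => xab.
    have : setT x by []. rewrite -cube_cover => -[k _ xk].
    by exists k => // j; case: eqP => [->//|_]; exact: xk.
  apply: bigcupT_measurable => k; apply: sub_sigma_algebra.
  by eexists; eexists; reflexivity.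
by apply.
Qed.

Lemma leb_cube n k : (leb (@cube n k) < +oo)%E.
Proof. by rewrite leb_obox ltry. Qed.

Lemma measure_oboxes_eq n (m1 m2 : {measure set 'rV[R]_n -> \bar R}) :
  (forall k, (m1 (@cube n k) < +oo)%E) ->
  (forall a b, m1 (obox a b) = m2 (obox a b)) ->
  forall A, measurable A -> m1 A = m2 A.
Proof.
move=> fin eq A mA.
apply: (measure_unique (@oboxes n) (@cube n)) => //.
- exact: measurable_oboxesE.
- exact: oboxI.
- by move=> k; do 2 eexists; reflexivity.
- exact: cube_cover.
- by move=> _ [a [b ->]].
Qed.

Definition shiftv n (z x : 'rV[R]_n) : 'rV[R]_n := x + z.

Lemma measurable_shiftv n z : measurable_fun setT (@shiftv n z).
Proof.
apply: measurable_fun_rV => i; rewrite /shiftv.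
under eq_fun do rewrite mxE.
by apply: measurable_funD => //; exact: measurable_coord.
Qed.

(** Both sides are measures that agree on boxes. *)
Lemma leb_shift n (z : 'rV[R]_n) A : measurable A ->
  leb (shiftv z @^-1` A) = leb A.
Proof.
move=> mA.
pose m1 : {measure set 'rV[R]_n -> \bar R} :=
  measure_function_pushforward__canonical__measure_function_Measure
    (@leb R n) (@measurable_shiftv n z).
have m1E a b : m1 (obox a b) =
    leb (obox (fun i => a i - z ord0 i) (fun i => b i - z ord0 i)).
  congr (leb _); apply/seteqP; split => x xk i; have := xk i;
  by rewrite /shiftv !mxE ltrBlDr ltrBrDr.
rewrite -[LHS]/(m1 A); apply: measure_oboxes_eq => // [k|a b].
  by rewrite /cube m1E leb_obox ltry.
rewrite m1E [LHS]leb_obox [RHS]leb_obox; congr EFin; apply: eq_bigr => i _.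
by congr (Num.max 0 _); ring.
Qed.

(** * Open sets *)

(** Rational vertices make the family of such boxes countable. *)
Lemma open_box_sub n (U : set 'rV[R]_n) x : open U -> U x ->
  exists ab : ('I_n -> rat) * ('I_n -> rat),
    obox (fun i => ratr (ab.1 i)) (fun i => ratr (ab.2 i)) x /\
    (forall y : 'rV[R]_n, (forall i, ratr (ab.1 i) <= y ord0 i <= ratr (ab.2 i)) -> U y).
Proof.
move=> oU Ux.
have /nbhs_ballP[e /= e0 eU] : nbhs x U by exact: open_nbhs_nbhs.
have e2 : 0 < e / 2 by rewrite divr_gt0.
have ha i : exists q : rat, ratr q \in `]x ord0 i - e / 2, x ord0 i[.
  by apply: rat_in_itvoo; rewrite gtrBl.
have hb i : exists q : rat, ratr q \in `]x ord0 i, x ord0 i + e / 2[.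
  by apply: rat_in_itvoo; rewrite ltrDl.
exists (fun i => projT1 (cid (ha i)), fun i => projT1 (cid (hb i))).
split => [i|y yb] /=.
  have := projT2 (cid (ha i)); have := projT2 (cid (hb i)).
  by rewrite !in_itv/= => /andP[-> _] /andP[_ ->].
apply: eU; rewrite -ball_normE /=.
apply: le_lt_trans (_ : e / 2 < e); last by rewrite ltr_pdivrMr// ltr_pMr// ltr1n.
apply: norm_leP; first exact: ltW.
move=> i; rewrite !mxE.
have := projT2 (cid (ha i)); have := projT2 (cid (hb i)); have := yb i.
rewrite !in_itv/= ler_norml => /andP[h1 h2] /andP[h3 h4] /andP[h5 h6].
by apply/andP; split; lra.
Qed.

(** The indices enumerate all pairs of rational vertices; requiring the closed
    boxes to lie in the open set makes them usable as compact subsets. *)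
Lemma open_rV_bigcup n (U : set 'rV[R]_n) : open U ->
  exists (I : set nat) (a b : nat -> 'I_n -> R),
    U = \bigcup_(k in I) obox (a k) (b k) /\
    (forall k, I k -> forall y : 'rV[R]_n,
       (forall i, a k i <= y ord0 i <= b k i) -> U y).
Proof.
move=> oU.
pose un k : seq rat * seq rat := odflt ([::], [::]) (unpickle k).
pose a k (i : 'I_n) : R := ratr (nth 0 (un k).1 i).
pose b k (i : 'I_n) : R := ratr (nth 0 (un k).2 i).
exists [set k | forall y : 'rV[R]_n, (forall i, a k i <= y ord0 i <= b k i) -> U y].
exists a, b; split; last by move=> ab.
apply/seteqP; split => [x Ux|x [ab abU xab]]; last first.
  by apply: abU => i; have /andP[/ltW -> /ltW ->] := xab i.
have [[p q] /= [xab abU]] := open_box_sub oU Ux.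
have E (c : 'I_n -> rat) (i : 'I_n) : nth 0 [seq c j | j <- enum 'I_n] i = c i.
  by rewrite (nth_map i) ?size_enum_ord// nth_ord_enum.
exists (pickle ([seq p j | j <- enum 'I_n], [seq q j | j <- enum 'I_n])) => /=.
  by move=> y yab; apply: abU => i; have := yab i; rewrite /a /b /un pickleK /= !E.
by move=> i; rewrite /a /b /un pickleK /= !E; exact: xab.
Qed.

Lemma open_rV_measurable n (U : set 'rV[R]_n) : open U -> measurable U.
Proof.
move=> /open_rV_bigcup[I [a [b [-> _]]]].
by apply: bigcup_measurable => ab _; exact: measurable_obox.
Qed.

Lemma closed_rV_measurable n (U : set 'rV[R]_n) : closed U -> measurable U.
Proof.
move=> cU; rewrite -[X in measurable X]setCK; apply: measurableC.
by apply: open_rV_measurable; rewrite openC.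
Qed.

Lemma leb_open_gt0 n (U : set 'rV[R]_n) : open U -> U !=set0 -> (0 < leb U)%E.
Proof.
move=> oU [x Ux]; have [[a b] /= [xab abU]] := open_box_sub oU Ux.
apply: lt_le_trans (_ : (leb (obox (fun i => ratr (a i)) (fun i => ratr (b i))) <= _)%E).
  rewrite leb_obox lte_fin; apply: prodr_gt0 => i _.
  by rewrite lt_max subr_gt0; have /andP[h1 h2] := xab i; rewrite (lt_trans h1 h2) orbT.
apply: le_measure; rewrite ?inE; [exact: measurable_obox|exact: open_rV_measurable|].
by move=> y yab; apply: abU => i; have /andP[/ltW -> /ltW ->] := yab i.
Qed.

Lemma within_continuous_measurable n (D : set 'rV[R]_n) (f : 'rV[R]_n -> R) :
  measurable D -> {within D, continuous f} -> measurable_fun D f.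
Proof.
move=> mD /continuousP cf; apply: (measurability _ (RGenOpens.measurableE R)).
move=> _ [_ [a [b ->] <-]].
have oI : open (`]a, b[%classic : set R) by exact: interval_open.
have /open_subspaceP[V oV VD] := cf _ oI.
rewrite setIC -VD; apply: measurableI => //; exact: open_rV_measurable.
Qed.

Lemma bounded_sub_cube n (D : set 'rV[R]_n) : bounded_set D ->
  exists k, D `<=` @cube n k.
Proof.
move=> [M [_ DM]]; exists (Num.bound `|M + 1|).+1 => x Dx i.
rewrite -ltr_norml; apply: le_lt_trans (coord_le_norm x i) _.
apply: le_lt_trans (DM (M + 1) _ x Dx) _; first by rewrite ltrDl.
apply: le_lt_trans (ler_norm _) _.
by apply: lt_trans (archi_boundP (normr_ge0 _)) _; rewrite ltr_nat.
Qed.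

End boxes.

(** * Integrals of bounded functions with bounded support *)

Lemma integrable_finite_indic d (T : measurableType d) (R : realType)
  (mu : {measure set T -> \bar R}) (A : set T) : measurable A ->
  (mu A < +oo)%E -> mu.-integrable setT (fun x => (\1_A x)%:E).
Proof.
move=> mA Afin; apply/integrableP; split.
  by apply/measurable_EFinP; exact: measurable_indic.
rewrite (eq_integral (fun x => (\1_A x)%:E)); last first.
  by move=> t _; rewrite gee0_abs// lee_fin.
by rewrite integral_indic// setIT.
Qed.

Section bounded_functions.
Context {R : realType} {n : nat}.
Notation E := 'rV[R]_n.
Implicit Types f g : E -> R.

(** Bounded measurable functions, and those that vanish outside a cube: for the
    latter integrability, Fubini's theorem and dominated convergence come for
    free, and most integrands on the whole space below are of this kind. *)
Definition bmeas f := measurable_fun setT f /\ exists C, forall x, `|f x| <= C.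

Definition bsupp f := exists k, forall x, ~ @cube R n k x -> f x = 0.

Definition bs f := bmeas f /\ bsupp f.

Lemma cube_mono k l : (k <= l)%N -> @cube R n k `<=` @cube R n l.
Proof.
move=> kl x xk i; have := xk i; rewrite -!ltr_norml => /lt_le_trans; apply.
by rewrite ler_nat.
Qed.

Lemma measurable_cube k : measurable (@cube R n k).
Proof. exact: measurable_obox. Qed.

Lemma bmeas_bound f : bmeas f -> exists2 C, 0 <= C & forall x, `|f x| <= C.
Proof.
move=> [_ [C fC]]; exists (Num.max 0 C); first by rewrite le_max lexx.
by move=> x; rewrite le_max fC orbT.
Qed.

Lemma bmeasD f g : bmeas f -> bmeas g -> bmeas (fun x => f x + g x).
Proof.
move=> [mf [C fC]] [mg [C' gC]]; split; first exact: measurable_funD.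
by exists (C + C') => x; apply: le_trans (ler_normD _ _) _; rewrite lerD.
Qed.

Lemma bmeasM f g : bmeas f -> bmeas g -> bmeas (fun x => f x * g x).
Proof.
move=> [mf [C fC]] [mg [C' gC]]; split; first exact: measurable_funM.
by exists (C * C') => x; rewrite normrM ler_pM.
Qed.

Lemma bmeas_cst c : bmeas (fun=> c).
Proof. by split; [exact: measurable_cst|exists `|c|]. Qed.

Lemma bmeas_indic A : measurable A -> bmeas (\1_A : E -> R).
Proof.
move=> mA; split; first exact: measurable_indic.
by exists 1 => x; rewrite indicE; case: (_ \in _); rewrite ?normr1 ?normr0.
Qed.

Lemma bmeasN f : bmeas f -> bmeas (fun x => - f x).
Proof.
by move=> [mf [C fC]]; split; [exact: measurableT_comp|exists C => x; rewrite normrN].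
Qed.

Lemma bmeasB f g : bmeas f -> bmeas g -> bmeas (fun x => f x - g x).
Proof. by move=> bf bg; apply: bmeasD => //; exact: bmeasN. Qed.

Lemma bmeas_norm f : bmeas f -> bmeas (fun x => `|f x|).
Proof.
by move=> [mf [C fC]]; split; [exact: measurableT_comp|exists C => x; rewrite normr_id].
Qed.

Lemma bmeas_shift f z : bmeas f -> bmeas (fun x => f (x + z)).
Proof.
move=> [mf [C fC]]; split; last by exists C => x.
exact: (measurableT_comp mf (@measurable_shiftv R n z)).
Qed.

Lemma bsMl f g : bs f -> bmeas g -> bs (fun x => f x * g x).
Proof.
by move=> [bf [k fk]] bg; split; [exact: bmeasM|exists k => x /fk ->; rewrite mul0r].
Qed.

Lemma bsMr f g : bmeas f -> bs g -> bs (fun x => f x * g x).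
Proof.
by move=> bf [bg [k gk]]; split; [exact: bmeasM|exists k => x /gk ->; rewrite mulr0].
Qed.

Lemma bsD f g : bs f -> bs g -> bs (fun x => f x + g x).
Proof.
move=> [bf [k fk]] [bg [l gl]]; split; first exact: bmeasD.
exists (maxn k l) => x xkl; rewrite fk ?gl ?addr0//; apply: contra_not xkl.
  by apply: cube_mono; rewrite leq_maxr.
by apply: cube_mono; rewrite leq_maxl.
Qed.

Lemma bsN f : bs f -> bs (fun x => - f x).
Proof.
by move=> [bf [k fk]]; split; [exact: bmeasN|exists k => x /fk ->; rewrite oppr0].
Qed.

Lemma bsB f g : bs f -> bs g -> bs (fun x => f x - g x).
Proof. by move=> bf bg; apply: bsD => //; exact: bsN. Qed.

Lemma bs_norm f : bs f -> bs (fun x => `|f x|).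
Proof.
by move=> [bf [k fk]]; split; [exact: bmeas_norm|exists k => x /fk ->; rewrite normr0].
Qed.

Lemma bs_indic A k : measurable A -> A `<=` @cube R n k -> bs (\1_A : E -> R).
Proof.
move=> mA Ak; split; first exact: bmeas_indic.
by exists k => x xk; rewrite indicE memNset// => /Ak.
Qed.

Lemma bs_sum I (r : seq I) (F : I -> E -> R) : (forall i, bs (F i)) ->
  bs (fun x => \sum_(i <- r) F i x).
Proof.
move=> bF; elim: r => [|i r IH].
  under eq_fun do rewrite big_nil.
  by split; [exact: bmeas_cst|exists 0].
by under eq_fun do rewrite big_cons; exact: bsD.
Qed.

Lemma bs_shift f z : bs f -> bs (fun x => f (x + z)).
Proof.
move=> [bf [k fk]]; split; first exact: bmeas_shift.
exists (k + (Num.bound `|z|))%N => x xk; apply: fk; apply: contra_not xk => xzk i.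
rewrite -ltr_norml natrD -[x](addrK z) mxE; apply: le_lt_trans (ler_normD _ _) _.
apply: ltrD; first by rewrite ltr_norml; exact: xzk.
rewrite mxE normrN; apply: le_lt_trans (coord_le_norm z i) _.
exact: archi_boundP.
Qed.

Lemma bs_integrable f D : measurable D -> bs f -> leb.-integrable D (EFin \o f).
Proof.
move=> mD [[mf [C fC]] [k fk]].
apply: (integrableS measurableT) => //.
apply: (@le_integrable _ _ _ leb _ measurableT _ (EFin \o (fun x => C * \1_(cube k) x))).
- exact/measurable_EFinP.
- move=> x _ /=; rewrite lee_fin indicE.
  have [xk|xk] := pselect (cube k x).
    by rewrite mem_set// mulr1; apply: le_trans (fC x) (ler_norm _).
  by rewrite fk// normr0.
- have -> : EFin \o (fun x => C * \1_(cube k) x) =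
     (fun x : E => C%:E * (\1_(cube k) x)%:E)%E by apply/funext => x /=; rewrite EFinM.
  apply: integrableZl => //; apply: integrable_finite_indic => //.
    exact: measurable_cube.
  exact: leb_cube.
Qed.

Lemma bs_bmeas f : bs f -> bmeas f. Proof. by case. Qed.

Lemma intD f g : bs f -> bs g ->
  \int[leb]_x (f x + g x) = \int[leb]_x f x + \int[leb]_x g x.
Proof. by move=> bf bg; apply: RintegralD => //; exact: bs_integrable. Qed.

Lemma intB f g : bs f -> bs g ->
  \int[leb]_x (f x - g x) = \int[leb]_x f x - \int[leb]_x g x.
Proof. by move=> bf bg; apply: RintegralB => //; exact: bs_integrable. Qed.

Lemma intZ c f : bs f ->
  \int[leb]_x (c * f x) = c * \int[leb]_x f x.
Proof. by move=> bf; apply: RintegralZl => //; exact: bs_integrable. Qed.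

Lemma intN f : bs f -> \int[leb]_x (- f x) = - \int[leb]_x f x.
Proof. by move=> bf; rewrite -mulN1r -intZ//; apply: eq_Rintegral => x _; rewrite mulN1r. Qed.

Lemma int0 : \int[leb]_(x in (setT : set E)) (0 : R) = 0.
Proof. by rewrite Rintegral_cst ?mul0r. Qed.

Lemma int_sum I (r : seq I) (F : I -> E -> R) : (forall i, bs (F i)) ->
  \int[leb]_x (\sum_(i <- r) F i x) = \sum_(i <- r) \int[leb]_x F i x.
Proof.
move=> bF; elim: r => [|i r IH].
  by rewrite big_nil; under eq_Rintegral do rewrite big_nil; exact: int0.
rewrite big_cons -IH -intD//; last exact: bs_sum.
by apply: eq_Rintegral => x _; rewrite big_cons.
Qed.

Lemma int_le f g : bs f -> bs g -> (forall x, f x <= g x) ->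
  \int[leb]_x f x <= \int[leb]_x g x.
Proof. by move=> bf bg fg; apply: le_Rintegral => //; exact: bs_integrable. Qed.

Lemma int_norm f : bs f -> `|\int[leb]_x f x| <= \int[leb]_x `|f x|.
Proof. by move=> bf; apply: le_normr_Rintegral => //; exact: bs_integrable. Qed.

Lemma int_shift f z : bs f -> \int[leb]_x f (x + z) = \int[leb]_x f x.
Proof.
move=> bf; congr fine.
pose m1 : {measure set E -> \bar R} :=
  measure_function_pushforward__canonical__measure_function_Measure
    (@leb R n) (@measurable_shiftv R n z).
have -> : (\int[leb]_x (f x)%:E = \int[m1]_x (f x)%:E)%E.
  by apply: eq_measure_integral => A mA _; rewrite -[LHS](leb_shift z).
rewrite /m1 (@integral_pushforward _ _ _ _ _ _ (@measurable_shiftv R n z))//.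
- by apply/measurable_EFinP; case: bf => -[].
- by rewrite preimage_setT; apply: bs_integrable => //; exact: bs_shift.
Qed.

Lemma int_dominated (F : nat -> E -> R) f g :
  (forall m, measurable_fun setT (F m)) -> measurable_fun setT f ->
  {ae leb, forall x, F m x @[m --> \oo] --> f x} ->
  leb.-integrable setT (EFin \o g) ->
  (forall m x, `|F m x| <= g x) ->
  \int[leb]_x F m x @[m --> \oo] --> \int[leb]_x f x.
Proof.
move=> mF mf Ff ig Fg.
have h1 : forall m, measurable_fun setT (fun x => (F m x)%:E).
  by move=> m; exact/measurable_EFinP.
have h2 : measurable_fun setT (EFin \o f) by exact/measurable_EFinP.
have h3 : {ae leb, forall x, setT x -> (F m x)%:E @[m --> \oo] --> (EFin \o f) x}.
  by apply: filterS Ff => x Fx _; apply/fine_cvgP; split; [exact: nearW|].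
have h4 : {ae leb, forall x m, setT x -> (`|(F m x)%:E| <= (EFin \o g) x)%E}.
  by apply: aeW => x m _; rewrite /= lee_fin.
have [fint _ cv] := @dominated_convergence _ _ _ (@leb R n) setT measurableT
  (fun m x => (F m x)%:E) (EFin \o f) (EFin \o g) h1 h2 h3 ig h4.
by apply: fine_cvg; rewrite fineK//; exact: integrable_fin_num.
Qed.

Lemma int_bounded_cvg (F : nat -> E -> R) f C k :
  (forall m, measurable_fun setT (F m)) -> measurable_fun setT f ->
  {ae leb, forall x, F m x @[m --> \oo] --> f x} ->
  (forall m x, `|F m x| <= C) -> (forall m x, ~ @cube R n k x -> F m x = 0) ->
  \int[leb]_x F m x @[m --> \oo] --> \int[leb]_x f x.
Proof.
move=> mF mf Ff FC Fk.
apply: (@int_dominated _ _ (fun x => `|C| * \1_(cube k) x)) => //.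
  apply: bs_integrable => //; apply: bsMr; first exact: bmeas_cst.
  by apply: (@bs_indic _ k) => //; exact: measurable_cube.
move=> m x; rewrite indicE; have [xk|xk] := pselect (cube k x).
  by rewrite mem_set// mulr1; apply: le_trans (FC m x) (ler_norm _).
by rewrite Fk// normr0 mulr_ge0.
Qed.

Lemma bs_int_bound f C k : bs f -> (forall x, `|f x| <= C) ->
  (forall x, ~ @cube R n k x -> f x = 0) ->
  `|\int[leb]_x f x| <= C * fine (leb (@cube R n k)).
Proof.
move=> bf fC fk.
have C0 : 0 <= C by apply: le_trans (fC 0).
apply: le_trans (int_norm bf) _.
apply: le_trans (_ : \int[leb]_x (C * \1_(cube k) x) <= _).
  apply: int_le; first exact: bs_norm.
    apply: bsMr; first exact: bmeas_cst.
    by apply: (@bs_indic _ k) => //; exact: measurable_cube.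
  move=> x; rewrite indicE; have [xk|xk] := pselect (cube k x).
    by rewrite mem_set// mulr1.
  by rewrite fk// normr0 mulr_ge0.
rewrite intZ; last by apply: (@bs_indic _ k) => //; exact: measurable_cube.
by rewrite /Rintegral integral_indic ?setIT//; exact: measurable_cube.
Qed.

Lemma ae_eq_int f g (D : set E) : measurable D ->
  measurable_fun D f -> measurable_fun D g ->
  {ae leb, forall x, D x -> f x = g x} ->
  \int[leb]_(x in D) f x = \int[leb]_(x in D) g x.
Proof.
move=> mD mf mg fg; congr fine; apply: ae_eq_integral => //; try exact/measurable_EFinP.
by apply: filterS fg => x /[apply] ->.
Qed.

End bounded_functions.

Section fubini.
Context {R : realType} {n : nat}.
Notation E := 'rV[R]_n.
Implicit Types F : E * E -> R.

Definition bs2 F := [/\ measurable_fun setT F, exists C, forall x, `|F x| <= C &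
  exists k, forall x y, ~ (@cube R n k x /\ @cube R n k y) -> F (x, y) = 0].

Lemma bs2_integrable F : bs2 F -> (leb \x leb)%E.-integrable setT (EFin \o F).
Proof.
move=> [mF [C FC] [k Fk]].
have mk : measurable (@cube R n k `*` @cube R n k).
  by apply: measurableX; exact: measurable_cube.
apply: (@le_integrable _ _ _ _ _ measurableT _
    (EFin \o (fun x => C * \1_(cube k `*` cube k) x))).
- exact/measurable_EFinP.
- move=> [x y] _ /=; rewrite lee_fin indicE.
  have [xk|xk] := pselect (cube k x /\ cube k y).
    by rewrite mem_set// mulr1; apply: le_trans (FC (x, y)) (ler_norm _).
  by rewrite Fk// normr0.
- have -> : EFin \o (fun x => C * \1_(cube k `*` cube k) x) =
     (fun x : E * E => C%:E * (\1_(cube k `*` cube k) x)%:E)%E.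
    by apply/funext => x /=; rewrite EFinM.
  apply: integrableZl => //; apply: integrable_finite_indic => //.
  have H : ((@leb R n \x @leb R n) (cube k `*` cube k) =
      leb (@cube R n k) * leb (@cube R n k))%E.
    by apply: product_measure1E; exact: measurable_cube.
  apply: (eq_ind_r (fun z => (z < +oo)%E) _ H).
  apply: lte_mul_pinfty => //; last exact: leb_cube.
  by rewrite ge0_fin_numE//; exact: leb_cube.
Qed.

Lemma bs2_section1 F y : bs2 F -> bs (fun x => F (x, y)).
Proof.
move=> [mF [C FC] [k Fk]]; split; [split|].
- exact: measurableT_comp.
- by exists C.
- by exists k => x xk; apply: Fk => -[].
Qed.

Lemma bs2_section2 F x : bs2 F -> bs (fun y => F (x, y)).
Proof.
move=> [mF [C FC] [k Fk]]; split; [split|].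
- exact: measurableT_comp.
- by exists C.
- by exists k => y yk; apply: Fk => -[].
Qed.

Lemma bs2_swap F : bs2 F -> bs2 (fun p => F (p.2, p.1)).
Proof.
move=> [mF [C FC] [k Fk]]; split.
- by apply: (measurableT_comp mF); exact: measurable_fun_pair.
- by exists C.
- by exists k => x y xy; apply: Fk => -[yk xk]; exact: xy.
Qed.

Lemma int2_fubini F : bs2 F ->
  \int[leb]_x (\int[leb]_y F (x, y)) = \int[leb]_y (\int[leb]_x F (x, y)).
Proof.
move=> bF; have := @Fubini _ _ _ _ _ (@leb R n) (@leb R n) _ (bs2_integrable bF).
move=> H; rewrite /Rintegral; congr fine.
transitivity (\int[leb]_x (\int[leb]_y (F (x, y))%:E))%E.
  apply: eq_integral => x _; rewrite fineK//.
  apply: integrable_fin_num => //.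
  exact: (bs_integrable measurableT (bs2_section2 x bF)).
rewrite [LHS]H; apply: eq_integral => y _; rewrite fineK//.
apply: integrable_fin_num => //.
exact: (bs_integrable measurableT (bs2_section1 y bF)).
Qed.

Lemma bs2_int F : bs2 F -> bs (fun x => \int[leb]_y F (x, y)).
Proof.
move=> bF; have [mF [C FC] [k Fk]] := bF; split; [split|].
- apply: measurableT_comp => //.
  exact: (@measurable_fubini_F _ _ _ _ _ (@leb R n) (@leb R n) _ (bs2_integrable bF)).
- exists (C * fine (leb (@cube R n k))) => x.
  apply: bs_int_bound => //; first exact: bs2_section2.
  by move=> y yk; apply: Fk => -[].
- exists k => x xk; rewrite (_ : (fun y => F (x, y)) = fun=> 0) ?int0//.
  by apply/funext => y; apply: Fk => -[].
Qed.

End fubini.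

(** * Smooth bumps and test functions *)

Section smooth1.
Context {R : realType}.
Implicit Types f g : R -> R.

(** Differentiability to order k, stated with explicit derivatives so that sums,
    products and affine substitutions follow by induction on k. *)
Fixpoint C1 (k : nat) f : Prop :=
  if k is k'.+1 then
    exists f', (forall t, is_derive t (1:R) f (f' t)) /\ C1 k' f'
  else True.

Definition smooth1 f := forall k, C1 k f.

Lemma C1W k f : C1 k.+1 f -> C1 k f.
Proof.
elim: k f => // k IH f [f' [df cf']]; exists f'; split => //; exact: IH.
Qed.

Lemma C1D k f g : C1 k f -> C1 k g -> C1 k (fun t => f t + g t).
Proof.
elim: k f g => // k IH f g [f' [df cf]] [g' [dg cg]].
exists (fun t => f' t + g' t); split; last exact: IH.
by move=> t; exact: is_deriveD.
Qed.

Lemma C1M k f g : C1 k f -> C1 k g -> C1 k (fun t => f t * g t).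
Proof.
elim: k f g => // k IH f g [f' [df cf]] [g' [dg cg]].
exists (fun t => f t * g' t + g t * f' t); split.
  by move=> t; exact: is_deriveM.
apply: C1D; apply: IH => //; apply: C1W; [by exists f'|by exists g'].
Qed.

Lemma C1_cst k (c : R) : C1 k (fun=> c).
Proof.
by elim: k c => //= k IH c; exists (fun=> 0); split => // t; exact: is_derive_cst.
Qed.

Lemma C1_affine k f (a b : R) : C1 k f -> C1 k (fun t => f (a * t + b)).
Proof.
elim: k f => // k IH f [f' [df cf]].
exists (fun t => f' (a * t + b) * a); split; last first.
  by apply: C1M; [exact: IH|exact: C1_cst].
move=> t.
have h : is_derive t (1 : R) (fun t : R => a * t + b) a.
  by apply: is_derive_eq; rewrite addr0 /GRing.scale/= mulr1.
exact: (@is_derive1_comp R f (fun t : R => a * t + b) t (f' (a * t + b)) a).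
Qed.

Lemma C1_continuous k f : C1 k.+1 f -> continuous f.
Proof.
move=> [f' [df _]] t; apply: differentiable_continuous.
by apply/derivable1_diffP; have [] := df t.
Qed.

(** The family is closed under differentiation, see [is_derive_flat], which
    gives smoothness at 0 by induction. *)
Definition flat (k : nat) (t : R) : R :=
  if 0 < t then t^-1 ^+ k * expR (- t^-1) else 0.

(** Quadratic decay at 0, from the term of order k + 2 of the exponential series;
    it makes the derivative at 0 vanish. *)
Lemma flat_bound k t : `|flat k t| <= k.+2`!%:R * t ^+ 2.
Proof.
rewrite /flat; case: ifPn => [t0|]; last by rewrite normr0 mulr_ge0// sqr_ge0.
have s0 : 0 < t^-1 by rewrite invr_gt0.
rewrite ger0_norm; last by rewrite mulr_ge0 ?expR_ge0// exprn_ge0// ltW.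
rewrite expRN ler_pdivrMr ?expR_gt0//.
have := expR_ge1Dxn k.+1 (ltW s0) => h.
have f0 : (0 : R) < k.+2`!%:R by rewrite ltr0n fact_gt0.
rewrite -ler_pdivrMl ?mulr_gt0 ?exprn_gt0//.
apply: le_trans h; rewrite ler_wpDl//.
by rewrite -addn2 exprD invfM -exprVn le_eqVlt; apply/orP; left; apply/eqP; ring.
Qed.

Lemma is_derive_cvg (V : normedModType R) (f : V -> R) a v df :
  (fun h : R => h^-1 *: (f (h *: v + a) - f a)) @ 0^' --> df ->
  is_derive a v f df.
Proof.
move=> h; apply: DeriveDef; last exact: cvg_lim.
by apply/cvg_ex; exists df.
Qed.

Lemma is_deriveP (V : normedModType R) (f : V -> R) a v df :
  is_derive a v f df ->
  (fun h : R => h^-1 *: (f (h *: v + a) - f a)) @ 0^' --> df.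
Proof. by move=> [/cvg_ex[l hl] <-]; rewrite /derive (cvg_lim _ hl). Qed.

Lemma is_derive_flat k t :
  is_derive t (1 : R) (flat k) (- k%:R * flat k.+1 t + flat k.+2 t).
Proof.
have [t0|t0|->] := ltgtP t 0.
- rewrite /flat (lt_gtF t0) mulr0 addr0.
  apply: (@near_eq_is_derive _ _ _ (cst 0)) => //.
    near=> u; rewrite ifF//; apply/negbTE; rewrite -leNgt ltW//.
    by near: u; exact: lt_nbhsl.
- rewrite {2 3}/flat t0.
  have tn0 : t != 0 by rewrite gt_eqF.
  have h1 : is_derive t (1 : R) (fun t : R => t^-1) (- t^-1 ^+ 2).
    have := @is_deriveV R id t 1 1 tn0 (is_derive_id _ _).
    by rewrite /GRing.scale/= mulr1 -exprVn.
  have h2 : is_derive t (1 : R) (fun t : R => t^-1 ^+ k) (- k%:R * t^-1 ^+ k.+1).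
    elim: k => [|k IH].
      rewrite oppr0 mul0r (_ : (fun _ => _) = cst 1); first exact: is_derive_cst.
      by apply/funext => u; rewrite expr0.
    have := is_deriveM h1 IH.
    rewrite (_ : _ *: _ + _ = - k.+1%:R * t^-1 ^+ k.+2); last first.
      by rewrite /GRing.scale/= -natr1 !exprS; ring.
    by congr is_derive; apply/funext => u; rewrite exprS.
  have h3 : is_derive t (1 : R) (fun t : R => expR (- t^-1)) (t^-1 ^+ 2 * expR (- t^-1)).
    have := @is_derive1_comp R expR (fun t : R => - t^-1) t (expR (- t^-1)) (t^-1 ^+ 2).
    rewrite mulrC; apply.
    by apply: is_derive_eq; rewrite opprK.
  have h4 : is_derive t (1 : R) (fun t : R => t^-1 ^+ k * expR (- t^-1))
      (- k%:R * (t^-1 ^+ k.+1 * expR (- t^-1)) + t^-1 ^+ k.+2 * expR (- t^-1)).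
    have := is_deriveM h2 h3.
    by congr is_derive; rewrite /GRing.scale/= !exprS; ring.
  apply: near_eq_is_derive h4.
  near=> u; rewrite /flat ifT//.
  by near: u; exact: lt_nbhsr.
- rewrite /flat ltxx mulr0 addr0; apply: is_derive_cvg.
  apply/cvgrPdist_le => e e0.
  have c0 : (0 : R) < k.+2`!%:R by rewrite ltr0n fact_gt0.
  near=> h.
  rewrite sub0r normrN scaler1 addr0 ltxx subr0 /GRing.scale/= -/(flat k h).
  rewrite normrM normfV.
  have hn0 : 0 < `|h| by rewrite normr_gt0; near: h; exact: nbhs_dnbhs_neq.
  rewrite ler_pdivrMl//; apply: le_trans (flat_bound k h) _.
  have -> : h ^+ 2 = `|h| * `|h| by rewrite -normrM -expr2 ger0_norm ?sqr_ge0.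
  rewrite mulrA mulrC ler_pM2l// -ler_pdivlMl//.
  by near: h; apply: dnbhs0_le; rewrite mulr_gt0// invr_gt0.
Unshelve. all: by end_near. Qed.

Lemma flat_C1 n k : C1 n (flat k).
Proof.
elim: n k => //= n IH k.
exists (fun t => - k%:R * flat k.+1 t + flat k.+2 t); split.
  exact: is_derive_flat.
by apply: C1D => //; apply: C1M => //; exact: C1_cst.
Qed.

(** A smooth function that is positive exactly on ]a, b[ and increases to the
    indicator function of this interval when m grows. *)
Definition bump (a b : R) (m : nat) (t : R) : R :=
  flat 0 (m.+1%:R * t + - (m.+1%:R * a)) * flat 0 (- m.+1%:R * t + m.+1%:R * b).

Lemma bump_smooth a b m : smooth1 (bump a b m).
Proof. by move=> k; apply: C1M; apply: C1_affine; exact: flat_C1. Qed.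

Lemma flat0_ge0 t : 0 <= flat 0 t.
Proof. by rewrite /flat; case: ifP => // _; rewrite mulr_ge0// expR_ge0. Qed.

Lemma flat0_le1 t : flat 0 t <= 1.
Proof.
rewrite /flat; case: ifP => // t0; rewrite expr0 mul1r -expR0 ler_expR.
by rewrite oppr_le0 invr_ge0 ltW.
Qed.

Lemma flat0_gt0 t : (0 < flat 0 t) = (0 < t).
Proof.
by rewrite /flat; case: ifP => //; rewrite ?ltxx// expr0 mul1r expR_gt0.
Qed.

Lemma bump_ge0 a b m t : 0 <= bump a b m t.
Proof. by rewrite mulr_ge0 ?flat0_ge0. Qed.

Lemma bump_le1 a b m t : bump a b m t <= 1.
Proof. by rewrite mulr_ile1 ?flat0_ge0 ?flat0_le1. Qed.

Lemma bumpE a b m t :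
  bump a b m t = flat 0 (m.+1%:R * (t - a)) * flat 0 (m.+1%:R * (b - t)).
Proof. by congr (flat 0 _ * flat 0 _); ring. Qed.

Lemma bump_gt0 a b m t : (0 < bump a b m t) = (a < t < b).
Proof.
rewrite bumpE; have m0 : (0 : R) < m.+1%:R by rewrite ltr0n.
apply/idP/idP => [|/andP[at_ tb]]; last first.
  by rewrite mulr_gt0// flat0_gt0 pmulr_rgt0// subr_gt0.
rewrite lt0r mulf_eq0 negb_or => /andP[/andP[h1 h2] _].
have : 0 < flat 0 (m.+1%:R * (t - a)) by rewrite lt0r h1 flat0_ge0.
have : 0 < flat 0 (m.+1%:R * (b - t)) by rewrite lt0r h2 flat0_ge0.
by rewrite !flat0_gt0 !pmulr_rgt0// !subr_gt0 => -> ->.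
Qed.

Lemma bump_eq0 a b m t : ~~ (a < t < b) -> bump a b m t = 0.
Proof.
by rewrite -(bump_gt0 _ _ m) -leNgt => h; apply/eqP; rewrite eq_le h bump_ge0.
Qed.

Lemma flat0_cvg1 (s : R) : 0 < s -> flat 0 (m.+1%:R * s) @[m --> \oo] --> (1 : R).
Proof.
move=> s0.
have E m : flat 0 (m.+1%:R * s) = expR (- (s^-1 * m.+1%:R^-1)).
  by rewrite /flat pmulr_rgt0// s0 expr0 mul1r invfM mulrC.
rewrite (_ : (fun m => _) = (fun m => expR (- (s^-1 * harmonic m)))); last exact/funext.
rewrite -[X in _ --> X](@expR0 R) -[X in expR X](@oppr0 R) -[X in expR (- X)](mulr0 s^-1).
apply: continuous_cvg; first exact: continuous_expR.
by apply: cvgN; apply: cvgM; [exact: cvg_cst|exact: cvg_harmonic].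
Qed.

Lemma bump_cvg (a b t : R) : bump a b m t @[m --> \oo] --> ((a < t < b)%R%:R : R).
Proof.
have [/andP[at_ tb]|ntab] := boolP (a < t < b); last first.
  rewrite (_ : (fun m => _) = fun=> 0); first exact: cvg_cst.
  by apply/funext => m; exact: bump_eq0.
rewrite /= (_ : (fun m => _) =
  (fun m => flat 0 (m.+1%:R * (t - a)) * flat 0 (m.+1%:R * (b - t)))); last first.
  by apply/funext => m; exact: bumpE.
rewrite -[X in _ --> X](mulr1 1); apply: cvgM.
  by apply: flat0_cvg1; rewrite subr_gt0.
by apply: flat0_cvg1; rewrite subr_gt0.
Qed.

End smooth1.

Section test_functions.
Context {R : realType} {n : nat}.
Notation E := 'rV[R]_n.

Definition prodf (b : 'I_n -> R -> R) (x : E) : R := \prod_i b i (x ord0 i).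

Lemma prodf_continuous (b : 'I_n -> R -> R) :
  (forall i, continuous (b i)) -> continuous (prodf b).
Proof.
move=> cb; apply: continuous_big => [|i _ x]; first exact: mul_continuous.
apply: (@continuous_comp _ _ _ (fun y : E => y ord0 i) (b i)).
  exact: coord_continuous.
exact: cb.
Qed.

Lemma is_derive_prodf (b : 'I_n -> R -> R) (j : 'I_n) (b' : R -> R) (x : E) :
  (forall t, is_derive t (1:R) (b j) (b' t)) ->
  is_derive x 'e_j (prodf b) (prodf (fun i => if i == j then b' else b i) x).
Proof.
move=> db; apply: is_derive_cvg.
pose c := \prod_(i | i != j) b i (x ord0 i).
have -> : prodf (fun i => if i == j then b' else b i) x = c * b' (x ord0 j).
  rewrite /prodf (bigD1 j)//= eqxx mulrC; congr (_ * _).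
  by apply: eq_bigr => i /negbTE ->.
have E1 h : prodf b (h *: 'e_j + x) = c * b j (h + x ord0 j).
  rewrite /prodf (bigD1 j)//= !mxE !eqxx mulr1 mulrC; congr (_ * _).
  by apply: eq_bigr => i /negbTE ij; rewrite !mxE /= ij mulr0 add0r.
have E0 : prodf b x = c * b j (x ord0 j) by have := E1 0; rewrite scale0r !add0r.
rewrite (_ : (fun h => _) =
   (fun h => c * (h^-1 *: (b j (h *: (1 : R) + x ord0 j) - b j (x ord0 j))))); last first.
  by apply/funext => h; rewrite E1 E0 -mulrBr /GRing.scale/= mulr1 mulrCA.
by apply: cvgM; [exact: cvg_cst|exact: is_deriveP].
Qed.

(** Each partial derivative is again a product of functions of one variable. *)
Lemma smooth_prodf (b : 'I_n -> R -> R) : (forall i, smooth1 (b i)) ->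
  smooth (prodf b).
Proof.
move=> sb k.
suff H : forall b, (forall i, C1 k.+1 (b i)) -> Ck k (prodf b).
  by apply: H => i; exact: sb.
clear; elim: k => [|k IH] b sb.
  by split => //; apply: prodf_continuous => i; exact: (@C1_continuous _ 0).
split => [|j]; first by apply: prodf_continuous => i; exact: (@C1_continuous _ k.+1).
have [b' [db sb']] := sb j.
split => [x|]; first by have [] := is_derive_prodf x db.
have -> : 'D_('e_j) (prodf b) = prodf (fun i => if i == j then b' else b i).
  by apply/funext => x; have [_ ->] := is_derive_prodf x db.
by apply: IH => i; case: ifP => // _; exact: C1W.
Qed.

Definition cbox (a b : 'I_n -> R) : set E := [set x | forall i, a i <= x ord0 i <= b i].

Lemma compact_cbox a b : compact (cbox a b).
Proof.
apply: bounded_closed_compact.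
  exists (\sum_i (`|a i| + `|b i|)); split; first by rewrite num_real.
  move=> M MM x xab; apply: (le_trans _ (ltW MM)).
  apply: norm_leP; first by apply: sumr_ge0 => i _; rewrite addr_ge0.
  move=> i; apply: le_trans (_ : `|a i| + `|b i| <= _).
    rewrite ler_norml; have /andP[h1 h2] := xab i; apply/andP; split.
      have := ler_norm (- a i); rewrite normrN; have := normr_ge0 (b i); lra.
    have := ler_norm (b i); have := normr_ge0 (a i); lra.
  rewrite (bigD1 i)//= lerDl; apply: sumr_ge0 => j _; rewrite addr_ge0//.
have -> : cbox a b = \bigcap_(i in [set: 'I_n])
    ((fun x : E => x ord0 i) @^-1` `[a i, b i]).
  by apply/seteqP; split=> x bx i; [move=> _|];
    move: (bx i); rewrite /= in_itv/= => // /(_ I).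
apply: closed_bigI => i _; apply: closed_comp; last exact: itv_closed.
by move=> x _; exact: coord_continuous.
Qed.

Definition bumps (a b : 'I_n -> R) (m : nat) : E -> R :=
  prodf (fun i => bump (a i) (b i) m).

Lemma bumps_smooth a b m : smooth (bumps a b m).
Proof. by apply: smooth_prodf => i; exact: bump_smooth. Qed.

Lemma bumps_ge0 a b m x : 0 <= bumps a b m x.
Proof. by apply: prodr_ge0 => i _; exact: bump_ge0. Qed.

Lemma bumps_le1 a b m x : bumps a b m x <= 1.
Proof. by apply: prodr_ile1 => i; rewrite bump_ge0 bump_le1. Qed.

Lemma bumps_gt0 a b m x : obox a b x -> 0 < bumps a b m x.
Proof. by move=> xab; apply: prodr_gt0 => i _; rewrite bump_gt0. Qed.

Lemma bumps_eq0 a b m x : ~ obox a b x -> bumps a b m x = 0.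
Proof.
move=> /existsNP[i /negP xab]; rewrite /bumps /prodf (bigD1 i)//=.
by rewrite bump_eq0 ?mul0r.
Qed.

Lemma bumps_cvg a b x : bumps a b m x @[m --> \oo] --> (\1_(obox a b) x : R).
Proof.
have [xab|xab] := pselect (obox a b x); last first.
  rewrite indicE memNset//= (_ : (fun m => _) = fun=> 0); first exact: cvg_cst.
  by apply/funext => m; exact: bumps_eq0.
rewrite indicE mem_set//=.
have -> : (1 : R) = \prod_(i < n) 1 by rewrite big1.
apply: cvg_big => [|i _]; first exact: mul_continuous.
by have := @bump_cvg R (a i) (b i) (x ord0 i); rewrite (xab i).
Qed.

Lemma bumps_test (Om : set E) a b m : cbox a b `<=` Om ->
  test_function Om (bumps a b m).
Proof.
move=> abOm; split; first exact: bumps_smooth.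
exists (cbox a b); split => //; first exact: compact_cbox.
move=> x xab; apply: bumps_eq0; apply: contra_not xab => xab i.
by have /andP[/ltW -> /ltW ->] := xab i.
Qed.

End test_functions.

Section test_function_theory.
Context {R : realType} {n : nat}.
Notation E := 'rV[R]_n.
Implicit Types (Om : set E) (phi : E -> R).

Lemma continuous_rV_measurable (f : E -> R) : continuous f -> measurable_fun setT f.
Proof.
by move=> cf; apply: within_continuous_measurable => //; exact: continuous_subspaceT.
Qed.

Lemma compact_sub_cube (K : set E) : compact K -> exists k, K `<=` @cube R n k.
Proof. by move=> cK; apply: bounded_sub_cube; exact: compact_bounded. Qed.

Lemma continuous_compact_support_bs (f : E -> R) (K : set E) : compact K ->
  continuous f -> (forall x, ~ K x -> f x = 0) -> bs f.
Proof.
move=> cK cf fK; split; [split|]; first exact: continuous_rV_measurable.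
  have /compact_bounded[M [_ fM]] : compact (f @` K).
    apply: continuous_compact => //; exact: continuous_subspaceT.
  exists (Num.max 0 (M + 1)) => x.
  have [Kx|Kx] := pselect (K x); last by rewrite fK// normr0 le_max lexx.
  by rewrite le_max; apply/orP; right; apply: fM; [rewrite ltrDl|exists x].
have [k Kk] := compact_sub_cube cK.
by exists k => x xk; apply: fK; apply: contra_not xk; exact: Kk.
Qed.

Lemma Ck_continuous k phi : Ck k phi -> continuous phi.
Proof. by case: k => [[]|k []]. Qed.

Lemma test_continuous Om phi : test_function Om phi -> continuous phi.
Proof. by move=> [/(_ 0%N)/Ck_continuous]. Qed.

Lemma smooth_derivable phi j x : smooth phi -> derivable phi x 'e_j.
Proof. by move=> /(_ 1%N)[_ /(_ j)[]]. Qed.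

Lemma smooth_derive phi j : smooth phi -> smooth ('D_('e_j) phi).
Proof. by move=> sphi k; have [_ /(_ j)[]] := sphi k.+1. Qed.

Lemma test_derive Om phi j : test_function Om phi ->
  test_function Om ('D_('e_j) phi).
Proof.
move=> [sphi [K [cK KOm phiK]]]; split; first exact: smooth_derive.
exists K; split => // x Kx.
rewrite (@near_eq_derive _ _ _ _ (cst 0)) ?derive_cst//.
have oK : open (~` K) by apply: closed_openC; exact: compact_closed.
by apply: filterS (open_nbhs_nbhs (conj oK Kx)) => y Ky; rewrite phiK.
Qed.

Lemma test_bs Om phi : test_function Om phi -> bs phi.
Proof.
move=> tphi; have [_ [K [cK _ phiK]]] := tphi.
exact: continuous_compact_support_bs cK (test_continuous tphi) phiK.
Qed.

Lemma test_is_derive Om phi j x : test_function Om phi ->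
  is_derive x 'e_j phi ('D_('e_j) phi x).
Proof. by move=> [sphi _]; apply: DeriveDef => //; exact: smooth_derivable. Qed.

Lemma test_lipschitz Om phi j : test_function Om phi ->
  exists2 C, 0 <= C & forall x t, `|phi (x + t *: 'e_j) - phi x| <= C * `|t|.
Proof.
move=> tphi; have [C C0 dC] := bmeas_bound (bs_bmeas (test_bs (test_derive j tphi))).
exists C => // x t.
pose g (t : R) := phi (x + t *: 'e_j).
have dg (s : R) : is_derive s (1:R) g ('D_('e_j) phi (x + s *: 'e_j)).
  apply: is_derive_cvg; have := is_deriveP (test_is_derive j (x + s *: 'e_j) tphi).
  rewrite (_ : (fun h => _) =
    (fun h => h^-1 *: (g (h *: (1 : R) + s) - g s)))//.
  apply/funext => h; congr (_ *: (phi _ - _)).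
  have -> : h *: (1 : R) = h by rewrite /GRing.scale/= mulr1.
  by rewrite scalerDl addrCA addrA.
have cg : continuous g.
  by move=> s; apply: differentiable_continuous; apply/derivable1_diffP; have [] := dg s.
have key (a b : R) : a <= b -> `|g b - g a| <= C * (b - a).
  move=> ab; have [c cab ->] := @MVT_segment R g
    (fun s => 'D_('e_j) phi (x + s *: 'e_j)) a b ab (fun u _ => dg u)
    (continuous_subspaceT cg).
  by rewrite normrM (ger0_norm (_ : 0 <= b - a)) ?subr_ge0// ler_wpM2r ?subr_ge0.
have g0 : g 0 = phi x by rewrite /g scale0r addr0.
rewrite -g0 -/(g t); have [t0|t0] := leP 0 t.
  by have := key _ _ t0; rewrite subr0 (ger0_norm t0).
by have := key _ _ (ltW t0); rewrite distrC sub0r (ltr0_norm t0).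
Qed.

Lemma derive_seq phi j (df : R) (x : E) (s : nat -> R) : is_derive x 'e_j phi df ->
  (forall m, s m != 0) -> s m @[m --> \oo] --> (0 : R) ->
  (s m)^-1 * (phi (x + s m *: 'e_j) - phi x) @[m --> \oo] --> df.
Proof.
move=> dp s0 cs; have h := is_deriveP dp.
have cs' : s @ \oo --> (0 : R)^'.
  move=> A A0; have : \forall m \near \oo, s m != 0 -> A (s m) := cs _ A0.
  by apply: filterS => m; apply; exact: s0.
have := cvg_comp _ _ cs' h.
rewrite (_ : _ \o s = (fun m => (s m)^-1 * (phi (x + s m *: 'e_j) - phi x)))//.
by apply/funext => m; rewrite /= [x + _]addrC.
Qed.

End test_function_theory.

(** * The fundamental lemma and uniqueness of weak derivatives *)

Lemma seq_cvg_unique {R : realType} (u : nat -> R) (l l' : R) :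
  u m @[m --> \oo] --> l -> u m @[m --> \oo] --> l' -> l = l'.
Proof. by move=> h1 h2; rewrite -(cvg_lim (@Rhausdorff R) h1) (cvg_lim _ h2). Qed.

Section fundamental_lemma.
Context {R : realType} {n : nat}.
Notation E := 'rV[R]_n.
Implicit Types (Om : set E) (f phi : E -> R).

(** The sets on which the integral vanishes form a Dynkin system that contains
    the boxes. *)
Lemma ae0_boxes f : leb.-integrable setT (EFin \o f) ->
  (\int[leb]_x (f x)%:E = 0)%E ->
  (forall a b, \int[leb]_(x in obox a b) (f x)%:E = 0)%E ->
  {ae leb, forall x, f x = 0}.
Proof.
move=> fi f0 fbox.
pose G : set (set E) := [set A | measurable A /\ (\int[leb]_(x in A) (f x)%:E = 0)%E].
have dG : dynkin G.
  split.
  - by split.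
  - move=> A [mA A0]; split; first exact: measurableC.
    have := @integral_setU_EFin _ _ _ (@leb R n) A (~` A) f mA (measurableC mA).
    have mf : measurable_fun setT f by apply/measurable_EFinP; exact: measurable_int fi.
    have dA : [disjoint A & ~` A] by apply/disj_setPS; rewrite setICr.
    by rewrite setUv => /(_ mf dA); rewrite f0 A0 add0e => /esym.
  - move=> F tF GF; split; first by apply: bigcupT_measurable => k; case: (GF k).
    rewrite integral_bigcup//.
    + by apply: eseries0 => k _ _; case: (GF k).
    + by move=> k; case: (GF k).
    + by apply: integrableS fi => //; apply: bigcupT_measurable => k; case: (GF k).
have Gall A : measurable A -> G A.
  rewrite measurable_oboxesE -setI_closed_g_dynkin_g_sigma_algebra; last exact: oboxI.
  apply; split => // _ [a [b ->]]; split; [exact: measurable_obox|exact: fbox].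
have H : ae_eq leb setT (EFin \o f) (cst 0%E).
  apply: integral_ae_eq => // A _ mA; rewrite integral0.
  by have [_] := Gall _ mA.
by apply: filterS H => x /(_ I) [].
Qed.

Lemma loc_int_test Om f phi : open Om -> loc_integrable Om f ->
  test_function Om phi -> leb.-integrable Om (EFin \o (fun x => f x * phi x)).
Proof.
move=> oOm fi tphi; have [sphi [K [cK KOm phiK]]] := tphi.
have mK : measurable K by apply: closed_rV_measurable; exact: compact_closed.
have mOm : measurable Om by exact: open_rV_measurable.
have [[mphi [C phiC]] _] := test_bs tphi.
have h : leb.-integrable K (EFin \o (fun x => f x * phi x)).
  have -> : EFin \o (fun x => f x * phi x) = ((EFin \o f) \* (EFin \o phi))%E by [].
  apply: integrableMl => //; first exact: fi.
    exact: measurable_funTS.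
  by exists C; split; [exact: num_real|move=> M CM x _; apply: le_trans (phiC x) (ltW CM)].
move/integrable_mkcond : h => /(_ mK) h.
apply/integrable_mkcond => //; apply: eq_integrable h => // x _.
rewrite /patch; case: ifPn => [xK|].
  by rewrite ifT//; move: xK; rewrite !inE; exact: KOm.
by rewrite notin_setE => /phiK /= ->; rewrite mulr0; case: ifP.
Qed.

Lemma ae_bigcup_in (D : set nat) (F : nat -> set E) (P : E -> Prop) :
  (forall k, D k -> {ae leb, forall x, F k x -> P x}) ->
  {ae leb, forall x, (\bigcup_(k in D) F k) x -> P x}.
Proof.
move=> h.
have : {ae leb, forall x k, D k -> F k x -> P x}.
  apply: ae_foralln => k; have [/h H|Dk] := pselect (D k).
    by apply: filterS H => x H _.
  by apply: aeW => x.
by apply: filterS => x H [k Dk Fk]; exact: H Dk Fk.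
Qed.

(** The bumps of a box in Om converge boundedly to its indicator function, so the
    integral of f over every such box is zero. *)
Lemma fundamental_lemma Om f : open Om -> loc_integrable Om f ->
  (forall phi, test_function Om phi -> \int[leb]_(x in Om) (f x * phi x) = 0) ->
  {ae leb, forall x, Om x -> f x = 0}.
Proof.
move=> oOm fi f0; have mOm := open_rV_measurable oOm.
have [D [a [b [OmE abOm]]]] := open_rV_bigcup oOm.
rewrite OmE; apply: ae_bigcup_in => k Dk.
set Q := obox (a k) (b k).
have mQ : measurable Q by exact: measurable_obox.
have cQ : Q `<=` cbox (a k) (b k).
  by move=> x xQ i; have /andP[/ltW -> /ltW ->] := xQ i.
have fQ : leb.-integrable Q (EFin \o f).
  apply: (@integrableS _ _ _ _ (cbox (a k) (b k))) => //.
    by apply: closed_rV_measurable; apply: compact_closed => //; exact: compact_cbox.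
  by apply: fi; [exact: compact_cbox|exact: abOm].
pose F := f \_ Q.
have Fi : leb.-integrable setT (EFin \o F).
  move/integrable_mkcond : fQ => /(_ mQ); apply: eq_integrable => // x _.
  by rewrite /F /patch /=; case: ifP.
have mF : measurable_fun setT F by apply/measurable_EFinP; exact: measurable_int Fi.
have key a' b' : (\int[leb]_(x in obox a' b') (F x)%:E = 0)%E.
  pose a2 i := Num.max (a k i) (a' i); pose b2 i := Num.min (b k i) (b' i).
  have QI : Q `&` obox a' b' = obox a2 b2 by exact: obox_setI.
  have tb m : test_function Om (bumps a2 b2 m).
    apply: bumps_test => x xab; apply: (abOm k Dk) => i; have := xab i.
    by rewrite ge_max le_min => /andP[/andP[-> _] /andP[-> _]].
  have I0 m : \int[leb]_x (F x * bumps a2 b2 m x) = 0.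
    rewrite -[RHS](f0 _ (tb m)) [RHS]Rintegral_mkcond; apply: eq_Rintegral => x _.
    rewrite /F /patch; have [xQ|xQ] := pselect (Q x).
      by rewrite !mem_set// OmE; exists k.
    rewrite memNset// mul0r; case: ifP => // _; rewrite bumps_eq0 ?mulr0//.
    by rewrite -QI => -[].
  have cv : \int[leb]_x (F x * bumps a2 b2 m x) @[m --> \oo] -->
      \int[leb]_x (F x * \1_(obox a2 b2) x).
    apply: (@int_dominated _ _ _ _ (fun x => `|F x|)).
    - move=> m; apply: measurable_funM => //.
      by apply: continuous_rV_measurable; exact: test_continuous (tb m).
    - apply: measurable_funM => //; apply: measurable_indic; exact: measurable_obox.
    - by apply: aeW => x; apply: cvgM; [exact: cvg_cst|exact: bumps_cvg].
    - exact: integrable_norm.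
    - move=> m x; rewrite normrM ler_piMr// ger0_norm ?bumps_ge0//.
      exact: bumps_le1.
  have {}cv : \int[leb]_x (F x * \1_(obox a2 b2) x) = 0.
    apply: (seq_cvg_unique cv); rewrite (_ : (fun m => _) = fun=> 0).
      exact: cvg_cst.
    exact/funext.
  rewrite integral_mkcond.
  have E1 : (fun x => (F x)%:E) \_ (obox a' b') = EFin \o (fun x => F x * \1_(obox a2 b2) x).
    apply/funext => x; rewrite /patch /= -QI indicE in_setI /F /patch.
    case: (x \in Q) => /=; case: (x \in obox a' b'); rewrite ?mulr1 ?mulr0 ?mul0r//.
  rewrite E1 -[LHS]fineK ?[fine _]cv//.
  apply: integrable_fin_num => //; rewrite -E1.
  apply/(integrable_mkcond _ (measurable_obox a' b')).
  by apply: (@integrableS _ _ _ _ setT) => //; exact: measurable_obox.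
have := ae0_boxes Fi _ key.
have F00 : (\int[leb]_x (F x)%:E = 0)%E.
  rewrite -(key (a k) (b k)) [RHS]integral_mkcond; apply: eq_integral => x _.
  by rewrite /F /patch; case: ifP => // ->.
move=> /(_ F00); apply: filterS => x; rewrite /F /patch => Fx Qx.
by move: Fx; rewrite mem_set.
Qed.

End fundamental_lemma.

Section weak_derivatives.
Context {R : realType} {n : nat}.
Notation E := 'rV[R]_n.
Implicit Types (Om : set E) (f w phi : E -> R) (G : E -> E).

Lemma loc_integrableB Om f g : loc_integrable Om f -> loc_integrable Om g ->
  loc_integrable Om (fun x => f x - g x).
Proof.
move=> lf lg K cK KOm.
have mK : measurable K by apply: closed_rV_measurable; exact: compact_closed.
have -> : EFin \o (fun x => f x - g x) = ((EFin \o f) \- (EFin \o g))%E by [].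
by apply: integrableB => //; [exact: lf|exact: lg].
Qed.

(** This is what makes statements about the chosen representative of a weak
    gradient possible: any explicit weak gradient is equal to it almost
    everywhere. *)
Lemma weak_grad_unique Om w w' G G' : open Om -> (forall x, Om x -> w x = w' x) ->
  is_weak_grad Om w G -> is_weak_grad Om w' G' ->
  {ae leb, forall x, Om x -> G x = G' x}.
Proof.
move=> oOm ww' [_ wG] [_ wG'].
have H j : {ae leb, forall x, Om x -> G x ord0 j - G' x ord0 j = 0}.
  have [lG hG] := wG j; have [lG' hG'] := wG' j.
  apply: fundamental_lemma => // [|phi tphi]; first exact: loc_integrableB.
  under eq_Rintegral do rewrite mulrBl.
  have mOm := open_rV_measurable oOm.
  rewrite RintegralB//; [|exact: loc_int_test|exact: loc_int_test].
  apply: oppr_inj; rewrite opprB oppr0 -[X in _ - X]opprK -[X in X + _]opprK -hG// -hG'//.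
  rewrite opprK addrC; apply/eqP; rewrite subr_eq0; apply/eqP.
  by apply: eq_Rintegral => x; rewrite inE => /ww' ->.
have : {ae leb, forall x j, Om x -> G x ord0 j - G' x ord0 j = 0}.
  exact: filter_forall.
by apply: filterS => x H' Omx; apply/rowP => j; apply/eqP; rewrite -subr_eq0 H'.
Qed.

Lemma weak_lap_unique Om w L L' : open Om ->
  is_weak_lap Om w L -> is_weak_lap Om w L' ->
  {ae leb, forall x, Om x -> L x = L' x}.
Proof.
move=> oOm [_ lL hL] [_ lL' hL'].
have H : {ae leb, forall x, Om x -> L x - L' x = 0}.
  apply: fundamental_lemma => // [|phi tphi]; first exact: loc_integrableB.
  under eq_Rintegral do rewrite mulrBl.
  have mOm := open_rV_measurable oOm.
  rewrite RintegralB//; [|exact: loc_int_test|exact: loc_int_test].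
  by rewrite -hL// -hL'// subrr.
by apply: filterS H => x H' Omx; apply/eqP; rewrite -subr_eq0 H'.
Qed.

Lemma weak_gradP Om w G : is_weak_grad Om w G -> is_weak_grad Om w (weak_grad Om w).
Proof. by move=> h; rewrite /weak_grad; case: xgetP => [_ -> //|/(_ G)]. Qed.

Lemma weak_lapP Om w L : is_weak_lap Om w L -> is_weak_lap Om w (weak_lap Om w).
Proof. by move=> h; rewrite /weak_lap; case: xgetP => [_ -> //|/(_ L)]. Qed.

Definition step (m : nat) : R := m.+1%:R^-1.

Lemma step_gt0 m : 0 < step m. Proof. by rewrite invr_gt0. Qed.

Lemma step_cvg : step m @[m --> \oo] --> (0 : R).
Proof. exact: cvg_harmonic. Qed.

Lemma step_le m N : (N <= m)%N -> step m <= step N.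
Proof. by move=> Nm; rewrite lef_pV2 ?posrE// ler_nat. Qed.

Lemma step_le1 m : step m <= 1.
Proof. by rewrite invf_le1// ler1n. Qed.

Lemma norm_ej j : `|'e_j : E| <= 1.
Proof.
by apply: norm_leP => // i; rewrite mxE; case: (_ && _); rewrite ?normr1 ?normr0.
Qed.

(** Difference quotients can be moved from one factor to the other because the
    Lebesgue measure is translation invariant; then pass to the limit. Only the
    sequence of steps 1 / (m + 1) is used, so that the limits are those of
    dominated convergence. *)
Lemma ibp_difference_quotients f g phi dphi (j : 'I_n) (C1 C2 : R) (N : nat) :
  bmeas f -> bmeas g -> bs phi -> bs dphi ->
  (forall x, is_derive x 'e_j phi (dphi x)) ->
  (forall x t, `|phi (x + t *: 'e_j) - phi x| <= C1 * `|t|) ->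
  (forall m x, (N <= m)%N -> phi x != 0 ->
     `|f (x + step m *: 'e_j) - f x| <= C2 * step m) ->
  {ae leb, forall x, phi x != 0 ->
    (step m)^-1 * (f (x + step m *: 'e_j) - f x) @[m --> \oo] --> g x} ->
  \int[leb]_x (f x * dphi x) = - \int[leb]_x (g x * phi x).
Proof.
move=> bf bg bphi bdphi dp lphi lf cf.
have [mf [Cf fC]] := bf; have [[mphi [Cp phiC]] [k phik]] := bphi.
pose A m := \int[leb]_x ((step m)^-1 * (f (x + step m *: 'e_j) - f x) * phi x).
pose B m := \int[leb]_x (f x * ((step m)^-1 * (phi (x + (- step m) *: 'e_j) - phi x))).
have AB m : A m = B m.
  have b1 : bs (fun x => f (x + step m *: 'e_j) * phi x).
    by apply: bsMr => //; exact: bmeas_shift.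
  have b2 : bs (fun x => f x * phi x) by exact: bsMr.
  have b3 : bs (fun x => f x * phi (x + (- step m) *: 'e_j)).
    by apply: bsMr => //; exact: bs_shift.
  rewrite /A /B.
  transitivity ((step m)^-1 * (\int[leb]_x (f (x + step m *: 'e_j) * phi x) -
      \int[leb]_x (f x * phi x))).
    rewrite -intB// -intZ; last exact: bsB.
    by apply: eq_Rintegral => x _; rewrite -mulrA mulrBl.
  transitivity ((step m)^-1 * (\int[leb]_x (f x * phi (x + (- step m) *: 'e_j)) -
      \int[leb]_x (f x * phi x))).
    congr (_ * (_ - _)); rewrite -[RHS](int_shift (step m *: 'e_j))//.
    by apply: eq_Rintegral => x _; rewrite scaleNr addrK.
  rewrite -intB// -intZ; last exact: bsB.
  by apply: eq_Rintegral => x _; rewrite -mulrBr mulrCA.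
have cB : B m @[m --> \oo] --> \int[leb]_x (f x * - dphi x).
  apply: (@int_bounded_cvg _ _ _ _ (Cf * `|C1|) k.+1).
  - move=> m; apply: measurable_funM => //; apply: measurable_funM => //.
    by apply: measurable_funB => //; case: (bmeas_shift ((- step m) *: 'e_j) (bs_bmeas bphi)).
  - by apply: measurable_funM => //; apply: measurableT_comp => //; case: bdphi => -[].
  - apply: aeW => x; apply: cvgM; first exact: cvg_cst.
    rewrite (_ : (fun m => _) =
      (fun m => - ((- step m)^-1 * (phi (x + (- step m) *: 'e_j) - phi x)))); last first.
      by apply/funext => m; rewrite invrN mulNr opprK.
    apply: cvgN; apply: derive_seq => //.
      by move=> m; rewrite oppr_eq0 gt_eqF// step_gt0.
    by rewrite -oppr0; apply: cvgN; exact: step_cvg.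
  - move=> m x; rewrite !normrM ler_pM//.
    have s0 := step_gt0 m.
    rewrite gtr0_norm ?invr_gt0// ler_pdivrMl//.
    apply: le_trans (lphi _ _) _; rewrite normrN (gtr0_norm s0) mulrC ler_pM2l//.
    exact: ler_norm.
  - move=> m x xk; rewrite !phik ?subrr ?mulr0//.
      by apply: contra_not xk; apply: cube_mono.
    apply: contra_not xk; apply: cube_shift; rewrite scaleNr normrN normrZ.
    by rewrite mulr_ile1 ?norm_ej// gtr0_norm ?step_gt0 ?step_le1.
have cA : A m @[m --> \oo] --> \int[leb]_x (g x * phi x).
  rewrite -(cvg_shiftn N).
  apply: (@int_bounded_cvg _ _ _ _ (`|C2| * Cp) k).
  - move=> m; apply: measurable_funM => //; apply: measurable_funM => //.
    by apply: measurable_funB => //; case: (bmeas_shift (step (m + N) *: 'e_j) bf).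
  - by apply: measurable_funM => //; case: bg.
  - apply: filterS cf => x cx; have [->|px] := eqVneq (phi x) 0.
      by under eq_cvg do rewrite mulr0; rewrite mulr0; exact: cvg_cst.
    apply: cvgM; last exact: cvg_cst.
    have := cx px; rewrite -(cvg_shiftn N); exact.
  - move=> m x; have [->|px] := eqVneq (phi x) 0.
      by rewrite mulr0 normr0 mulr_ge0// (le_trans _ (phiC x)).
    rewrite !normrM ler_pM//; have s0 := step_gt0 (m + N).
    rewrite gtr0_norm ?invr_gt0// ler_pdivrMl// mulrC.
    apply: le_trans (lf _ _ _ px) _; first by rewrite leq_addl.
    by rewrite ler_pM2r//; exact: ler_norm.
  - by move=> m x /phik ->; rewrite mulr0.
rewrite -[LHS]opprK; congr (- _).
have cB' : B m @[m --> \oo] --> \int[leb]_x (g x * phi x).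
  by rewrite (_ : B = A)//; apply/funext => m; rewrite AB.
rewrite (seq_cvg_unique cB' cB) -intN; last exact: bsMr.
by apply: eq_Rintegral => x _; rewrite mulrN.
Qed.

End weak_derivatives.

(** * Lipschitz functions on chains of closed sets *)

Lemma near_all_seq (T : Type) (I : eqType) (F : set_system T) {FF : Filter F}
    (s : seq I) (P : I -> T -> Prop) :
  (forall i, i \in s -> \forall x \near F, P i x) ->
  \forall x \near F, forall i, i \in s -> P i x.
Proof.
elim: s => [|i s IH] h; first exact: nearW.
have h1 : \forall x \near F, P i x by apply: h; rewrite inE eqxx.
have h2 : \forall x \near F, forall i, i \in s -> P i x.
  by apply: IH => l ls; apply: h; rewrite inE ls orbT.
apply: filterS2 h1 h2 => x Pi Ps l; rewrite inE => /predU1P[->//|].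
exact: Ps.
Qed.

(** A function that is Lipschitz on each of finitely many closed sets covering an
    interval is Lipschitz on the interval, although it may pass from one set to
    another infinitely often: jump to the last point of the set that contains
    the left end, which is then never met again, and induct on the number of
    sets. *)
Lemma closed_segment_chain {R : realType} (T : eqType) (s : seq T) (S : T -> set R)
    (f : R -> R) (a b L : R) : a <= b ->
  (forall K, K \in s -> closed (S K)) ->
  (forall t, a <= t <= b -> exists2 K, K \in s & S K t) ->
  (forall K t u, K \in s -> S K t -> S K u -> `|f t - f u| <= L * `|t - u|) ->
  `|f b - f a| <= L * (b - a).
Proof.
have [n] := ubnP (size s); elim: n s a => // n IH s a sn ab cS cov lip.
have [K Ks Ka] : exists2 K, K \in s & S K a by apply: cov; rewrite lexx.
pose I := S K `&` `[a, b].
have cI : closed I by apply: closedI; [exact: cS|exact: itv_closed].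
have I0 : I !=set0 by exists a; split => //=; rewrite in_itv/= lexx.
have ubI : has_ubound I by exists b => t [_] /=; rewrite in_itv/= => /andP[].
have supI : has_sup I by split.
set m := sup I.
have Im : I m.
  apply: contrapT => nIm.
  have /nbhs_ballP[e /= e0 eI] := open_nbhs_nbhs (conj (closed_openC cI) nIm).
  have [t It mt] := sup_adherent e0 supI.
  apply: (eI t) => //; rewrite /ball/= ger0_norm; first by rewrite -/m in mt; lra.
  by rewrite subr_ge0; exact: ub_le_sup.
have [Km] := Im; rewrite /= in_itv/= => /andP[am mb].
have h1 : `|f m - f a| <= L * (m - a).
  by have := lip K m a Ks Km Ka; rewrite (@ger0_norm _ (m - a)) ?subr_ge0.
have [mb'|mneb] := eqVneq m b; first by rewrite -mb'.
have {mneb}mb' : m < b by rewrite lt_neqAle mneb.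
have after t : m < t <= b -> ~ S K t.
  move=> /andP[mt tb] Kt; have : t <= m.
    by apply: ub_le_sup => //; split => //=; rewrite in_itv/= tb andbT (le_trans am)// ltW.
  by rewrite leNgt mt.
have cov' t : m < t <= b -> exists2 K', K' \in rem K s & S K' t.
  move=> /[dup] /after Kt /andP[mt tb].
  have [|K' K's K't] := cov t; first by rewrite tb andbT (le_trans am)// ltW.
  exists K' => //; have [E|ne] := eqVneq K' K; first by rewrite E in K't.
  have := perm_to_rem Ks => /perm_mem /(_ K'); rewrite K's inE (negbTE ne) /=.
  by move=> <-.
have h2 : `|f b - f m| <= L * (b - m).
  apply: (IH (rem K s)) => //.
  - by rewrite size_rem//; move: sn; case: (s) Ks => //= x l _; rewrite ltnS.
  - by move=> K' /mem_rem; exact: cS.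
  - move=> t /andP[mt tb]; have [E|ne] := eqVneq t m; last first.
      by apply: cov'; rewrite lt_neqAle eq_sym ne mt.
    subst t; apply: contrapT => no.
    have near_no : \forall t \near m, forall K', K' \in rem K s -> ~ S K' t.
      apply: (@near_all_seq R T (nbhs m) _ (rem K s) (fun K' t => ~ S K' t)) => K' K's.
      apply: open_nbhs_nbhs; split.
        by apply: closed_openC; apply: cS; exact: mem_rem K's.
      by move=> K'm; apply: no; exists K'.
    near m^'+ => t.
    have [|K' K's K't] := cov' t.
      by apply/andP; split; near: t; [exact: nbhs_right_gt|exact: nbhs_right_ltW].
    by have : forall K', K' \in rem K s -> ~ S K' t;
      [near: t; exact: (@cvg_within _ _ _ _ _ near_no)|move=> /(_ K' K's)].
  - by move=> K' t u /mem_rem; exact: lip.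
rewrite (_ : f b - f a = (f b - f m) + (f m - f a)); last by ring.
apply: le_trans (ler_normD _ _) _; apply: le_trans (lerD h2 h1) _.
by rewrite -mulrDr (_ : b - m + (m - a) = b - a)//; ring.
Unshelve. all: by end_near. Qed.

(** A positive distance between a compact set and the complement of an open
    neighbourhood, by compactness. *)
Lemma compact_margin {R : realType} n (K U : set 'rV[R]_n) : compact K -> open U ->
  K `<=` U -> exists2 d : R, 0 < d & forall x y, K x -> `|y - x| < d -> U y.
Proof.
move=> cK oU KU.
have H : \forall d \near (0:R)^'+, K `<=` [set x | forall y, `|y - x| < d -> U y].
  apply: ((compact_near_coveringP K).1 cK) => x Kx.
  have /nbhs_ballP[e /= e0 eU] := open_nbhs_nbhs (conj oU (KU _ Kx)).
  have e2 : 0 < e / 2 by rewrite divr_gt0.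
  near=> z d => /= y yz; apply: eU; rewrite -ball_normE /=.
  have h1 : `|x - z| < e / 2.
    by near: z; have := nbhsx_ballx x _ e2; rewrite -ball_normE.
  have h2 : d < e / 2 by near: d; exact: nbhs_right_lt.
  rewrite (_ : x - y = (x - z) - (y - z)); last by rewrite opprB addrA subrK.
  by apply: le_lt_trans (ler_normB _ _) _; lra.
near (0:R)^'+ => d; exists d; first by near: d; exact: nbhs_right_gt.
have Kd : K `<=` [set x | forall y, `|y - x| < d -> U y] by near: d.
by move=> x y /Kd; apply.
Unshelve. all: by end_near. Qed.

(** * Exit points of convex sets are null *)

Section null_sets.
Context {R : realType} {n : nat}.
Notation E := 'rV[R]_n.

(** The translates have equal measure and there are infinitely many of them in a
    bounded region. *)
Lemma null_disjoint_translates (A : set E) (k : nat) (v : E) (t : nat -> R) :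
  measurable A -> A `<=` cube k -> `|v| <= 1 -> (forall i, `|t i| <= 1) ->
  (forall i l x, i != l -> A (x + t i *: v) -> A (x + t l *: v) -> False) ->
  leb A = 0.
Proof.
move=> mA Ak v1 t1 disj.
pose c := \int[leb]_x (\1_A x : R).
have bA : bs (\1_A : E -> R) by exact: (bs_indic mA Ak).
have c0 : 0 <= c by apply: Rintegral_ge0 => x _; rewrite indicE.
pose C := \int[leb]_x (\1_(@cube R n k.+1) x : R).
have key N : c *+ N <= C.
  have -> : c *+ N = \int[leb]_x (\sum_(i < N) \1_A (x + t i *: v)).
    rewrite int_sum; last by move=> i; exact: bs_shift.
    rewrite (eq_bigr (fun=> c)); last by move=> i _; rewrite (int_shift (t i *: v) bA).
    by rewrite sumr_const card_ord.
  apply: int_le.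
  - by apply: bs_sum => i; exact: bs_shift.
  - by apply: (@bs_indic _ _ _ k.+1) => //; exact: measurable_cube.
  - move=> x; have [[i Ai]|no] := pselect (exists i : 'I_N, A (x + t i *: v)).
      rewrite (bigD1 i)//= big1 ?addr0.
        rewrite !indicE !mem_set//; apply: cube_shift (Ak _ Ai).
        by rewrite normrZ mulr_ile1.
      move=> l li; rewrite indicE memNset// => Al.
      by apply: (disj l i x) => //; apply: contra_neq li => /val_inj.
    rewrite big1; first by rewrite indicE.
    by move=> i _; rewrite indicE memNset// => Ai; apply: no; exists i.
have cE : c = 0.
  apply/eqP; rewrite eq_le c0 andbT leNgt; apply/negP => cp.
  have := key (Num.bound (C / c)).
  have := archi_boundP (_ : 0 <= C / c); rewrite divr_ge0//; last first.
    by apply: Rintegral_ge0 => x _; rewrite indicE.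
  by move=> /(_ isT); rewrite ltr_pdivrMr// mulr_natl => /lt_geF ->.
have Afin : leb A \is a fin_num.
  rewrite ge0_fin_numE//; apply: (@le_lt_trans _ _ (leb (cube k))); last exact: leb_cube.
  by apply: le_measure; rewrite ?inE//; exact: measurable_cube.
move: cE; rewrite /c /Rintegral integral_indic// setIT => h.
by rewrite -(fineK Afin) h.
Qed.

(** The exceptional points leave K at once in the direction v. As K is convex in
    this direction, each line of direction v carries at most one of them, so
    their translates along v are disjoint. Applied to simplices, this replaces
    the statement that faces are null sets. *)
Lemma null_exit_points (K : set E) (v : E) : compact K -> `|v| <= 1 ->
  (forall x t u, K x -> 0 <= u <= t -> K (x + t *: v) -> K (x + u *: v)) ->
  {ae leb, forall x, K x -> \forall m \near \oo, K (x + step m *: v)}.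
Proof.
move=> cK v1 conv.
have clK : closed K by apply: compact_closed.
have mK : measurable K by exact: closed_rV_measurable.
have [k Kk] := compact_sub_cube cK.
pose A := K `&` \bigcap_m ~` (shiftv (step m *: v) @^-1` K).
have mA : measurable A.
  apply: measurableI => //; apply: bigcapT_measurable => m; apply: measurableC.
  by rewrite -[X in measurable X]setTI; exact: measurable_shiftv.
have A0 : leb A = 0.
  apply: (@null_disjoint_translates A k v (@step R)) => //.
  - by move=> x [/Kk].
  - by move=> i; rewrite gtr0_norm ?step_gt0 ?step_le1.
  - have H i l x : @step R i < @step R l ->
       A (x + step i *: v) -> A (x + step l *: v) -> False.
      move=> il [Ki nK] [Kl _].
      have d0 : 0 < @step R l - @step R i by rewrite subr_gt0.
      near \oo%classic => m.
      apply: (nK m) => //; rewrite /shiftv.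
      apply: (conv _ (step l - step i)) => //.
        by rewrite (ltW (@step_gt0 R m)) /=; near: m; exact: (cvgr_le _ (@step_cvg R)).
      by rewrite -addrA -scalerDl addrCA subrr addr0.
    move=> i l x; rewrite neq_ltn => /orP[il|il] Ai Al.
      by apply: (H l i x) => //; rewrite ltf_pV2 ?posrE// ltr_nat.
    by apply: (H i l x) => //; rewrite ltf_pV2 ?posrE// ltr_nat.
exists A; split => // x /= /not_implyP[Kx no]; split => // m _ Km; apply: no.
exists m => // l /= ml; apply: (conv _ (step m)) => //.
by rewrite (ltW (@step_gt0 R l)) step_le.
Unshelve. all: by end_near. Qed.

End null_sets.

(** * Simplices *)

Section simplices.
Context {R : realType} {d : nat} (M : mesh R d).
Notation E := 'rV[R]_d.
Notation N := (nnode M).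
Implicit Types K : {set 'I_N}.

Definition bary (lam : 'rV[R]_N) : E := \sum_l lam ord0 l *: node l.

Lemma bary_continuous : continuous bary.
Proof.
apply: continuous_big => [|l _ lam]; first exact: add_continuous.
have h1 : (x ord0 l : R) @[x --> lam] --> (lam ord0 l : R).
  exact: (@coord_continuous R 1 N ord0 l lam).
exact: (cvgZ h1 (cvg_cst (node l))).
Qed.

(** Continuous image of the compact set of barycentric coordinates. *)
Lemma simplex_compact K : compact (simplex K).
Proof.
pose S : set 'rV[R]_N := cbox (fun=> 0) (fun l => (l \in K)%:R) `&`
   [set lam | \sum_l lam ord0 l = 1].
have cS : compact S.
  apply: compact_closedI; first exact: compact_cbox.
  have h : closed ((fun lam : 'rV[R]_N => \sum_l lam ord0 l) @^-1` [set x : R | x = 1]).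
    apply: closed_comp; last exact: closed_eq.
    move=> x _; apply: continuous_big => [|l _]; first exact: add_continuous.
    exact: (@coord_continuous R 1 N ord0 l).
  exact: h.
have -> : simplex K = bary @` S.
  apply/seteqP; split => x.
    move=> [lam [l0 lK l1 ->]]; exists (\row_l lam l).
      split; last by rewrite /= -[RHS]l1; apply: eq_bigr => l _; rewrite mxE.
      move=> l; rewrite mxE l0/=; case: (boolP (l \in K)) => [_|/lK -> //].
      rewrite -l1 (bigD1 l)//= lerDl; exact: sumr_ge0.
    by apply: eq_bigr => l _; rewrite mxE.
  move=> [lam [lamb lam1] <-]; exists (fun l => lam ord0 l); split => //.
    by move=> l; have /andP[] := lamb l.
  by move=> l lK; have := lamb l; rewrite (negbTE lK) -eq_le => /eqP.
apply: continuous_compact => //; apply: continuous_subspaceT.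
exact: bary_continuous.
Qed.

Lemma simplex_closed K : closed (simplex K).
Proof. by apply: compact_closed => //; exact: simplex_compact. Qed.

Lemma simplex_measurable K : measurable (simplex K).
Proof. by apply: closed_rV_measurable; exact: simplex_closed. Qed.

Lemma simplex_convex K x y (t : R) : simplex K x -> simplex K y -> 0 <= t <= 1 ->
  simplex K ((1 - t) *: x + t *: y).
Proof.
move=> [l1 [p1 z1 s1 ->]] [l2 [p2 z2 s2 ->]] /andP[t0 t1].
exists (fun l => (1 - t) * l1 l + t * l2 l); split.
- by move=> l; rewrite addr_ge0// mulr_ge0// subr_ge0.
- by move=> l lK; rewrite z1// z2// !mulr0 addr0.
- by rewrite big_split/= -!mulr_sumr s1 s2 !mulr1 subrK.
- rewrite !scaler_sumr -big_split/=; apply: eq_bigr => l _.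
  by rewrite [RHS]scalerDl !scalerA.
Qed.

Lemma simplex_segment K x (v : E) (t u : R) : simplex K x -> 0 <= u <= t ->
  simplex K (x + t *: v) -> simplex K (x + u *: v).
Proof.
move=> Kx /andP[u0 ut] Kt; have [t0|tn0] := eqVneq t 0.
  have -> : u = 0 by apply/eqP; rewrite eq_le u0 andbT -[X in _ <= X]t0.
  by rewrite scale0r addr0.
have t0 : 0 < t by rewrite lt_neqAle eq_sym tn0 (le_trans u0).
have -> : x + u *: v = (1 - u / t) *: x + (u / t) *: (x + t *: v).
  by rewrite scalerBl scale1r scalerDr scalerA divfK// addrA subrK.
by apply: simplex_convex => //; rewrite divr_ge0 ?(ltW t0)//= ler_pdivrMr// mul1r.
Qed.

Lemma simplex_node K l : l \in K -> simplex K (node l).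
Proof.
move=> lK; exists (fun m => (m == l)%:R); split.
- by move=> m; rewrite ler0n.
- by move=> m mK; have [E|//] := eqVneq m l; move: mK; rewrite E lK.
- by rewrite (bigD1 l)//= eqxx big1 ?addr0// => m /negbTE ->.
- by rewrite (bigD1 l)//= eqxx scale1r big1 ?addr0// => m /negbTE ->; rewrite scale0r.
Qed.

(** A piecewise constant function, with value, on overlaps, that of the first
    cell of the list; fixing the choice makes it depend linearly on [c]
    everywhere. *)
Fixpoint sel (s : seq {set 'I_N}) (c : {set 'I_N} -> R) (x : E) : R :=
  if s is K :: s' then \1_(simplex K) x * c K + (1 - \1_(simplex K) x) * sel s' c x
  else 0.

Lemma selP s x : (exists2 K, K \in s & simplex K x) ->
  exists K, [/\ K \in s, simplex K x & forall c, sel s c x = c K].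
Proof.
elim: s => [[]//|K s IH] h /=.
have [Kx|nKx] := pselect (simplex K x).
  exists K; split; rewrite ?inE ?eqxx// => c.
  by rewrite indicE mem_set// mul1r subrr mul0r addr0.
have [|K' [K's K'x selE]] := IH.
  case: h => K'; rewrite inE => /predU1P[->//|K's K'x]; by exists K'.
exists K'; split => //; first by rewrite inE K's orbT.
by move=> c; rewrite indicE memNset// mul0r add0r subr0 mul1r.
Qed.

Lemma sel_bmeas s c : bmeas (sel s c).
Proof.
elim: s => [|K s IH] /=; first exact: bmeas_cst.
have bK : bmeas (\1_(simplex K) : E -> R) by apply: bmeas_indic; exact: simplex_measurable.
apply: bmeasD; first by apply: bmeasM => //; exact: bmeas_cst.
by apply: bmeasM => //; apply: bmeasB => //; exact: bmeas_cst.
Qed.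

(** Almost every point of a cell is not an end point of its intersection with
    the line of direction v, so that difference quotients along v can be
    computed inside one cell. *)
Lemma ae_inside (v : E) : `|v| <= 1 -> {ae leb, forall x, forall K, simplex K x ->
  \forall m \near \oo, simplex K (x + step m *: v)}.
Proof.
move=> v1; apply: filter_forall => K.
apply: null_exit_points => //; first exact: simplex_compact.
by move=> x t u; exact: simplex_segment.
Qed.

End simplices.

(** * Finite element functions and their weak gradients *)

Section fe_functions.
Context {R : realType} {d : nat} (Om : set 'rV[R]_d) (M : mesh R d).
Notation E := 'rV[R]_d.
Notation N := (nnode M).
Hypotheses (oOm : open Om) (bOm : bounded_set Om) (mM : is_mesh Om M).
Implicit Types (w u : E -> R).

Local Notation cl := (closure Om).

Lemma closure_compact : compact cl.
Proof.
apply: bounded_closed_compact; last exact: closed_closure.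
have [k Ok] := bounded_sub_cube bOm.
exists k%:R; split => [|r kr x clx]; first by rewrite num_real.
have h : cl `<=` cbox (fun=> - k%:R) (fun=> k%:R).
  have : closed (cbox (fun=> - k%:R) (fun=> k%:R) : set E).
    by apply: compact_closed => //; exact: compact_cbox.
  move=> /closure_id ->; apply: closureS => y /Ok yk i.
  by have /andP[/ltW -> /ltW ->] := yk i.
apply: (le_trans _ (ltW kr)); apply: norm_leP => // i.
by rewrite ler_norml; exact: h.
Qed.

Lemma closure_measurable : measurable cl.
Proof. by apply: closed_rV_measurable; exact: closed_closure. Qed.

Lemma Om_measurable : measurable Om. Proof. exact: open_rV_measurable. Qed.

Lemma cell_cover_closure x : cl x -> exists2 K, K \in cells M & simplex K x.
Proof. by rewrite -(cell_cover mM) => -[K KM Kx]; exists K. Qed.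

Lemma simplex_sub_closure K x : K \in cells M -> simplex K x -> cl x.
Proof. by move=> KM Kx; rewrite -(cell_cover mM); exists K. Qed.

Lemma node_closure (l : 'I_N) : cl (node l).
Proof.
have [K KM lK] := node_cell mM l.
by apply: (simplex_sub_closure KM); exact: simplex_node.
Qed.

(** The coordinates serve all finite element functions at once: sup norm bounds,
    signs and equalities can be checked at the nodes. *)
Lemma fe_barycentric x : cl x -> exists lam : 'I_N -> R,
  [/\ forall l, 0 <= lam l, \sum_l lam l = 1 &
      forall w, fe_space Om M w -> w x = \sum_l lam l * w (node l)].
Proof.
move=> /cell_cover_closure[K KM Kx].
have [lam [l0 lK l1 xE]] := Kx; exists lam; split => // w [_ /(_ K KM)[p [c wE]]].
rewrite wE// xE.
have -> : c = \sum_l lam l * c by rewrite -mulr_suml l1 mul1r.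
have -> : dotv p (\sum_l lam l *: node l) = \sum_l lam l * dotv p (node l).
  under [RHS]eq_bigr do rewrite /dotv mulr_sumr.
  rewrite exchange_big/=; apply: eq_bigr => j _; rewrite summxE mulr_sumr.
  by apply: eq_bigr => l _; rewrite mxE mulrCA.
rewrite -big_split/=; apply: eq_bigr => l _.
have [lnK|lK'] := boolP (l \in K); last by rewrite lK// !mul0r addr0.
by rewrite -mulrDr wE//; exact: simplex_node.
Qed.

Lemma fe_nodal_bound w (C : R) : fe_space Om M w ->
  (forall l : 'I_N, `|w (node l)| <= C) -> forall x, cl x -> `|w x| <= C.
Proof.
move=> ww wC x /fe_barycentric[lam [l0 l1 ->//]].
apply: le_trans (ler_norm_sum _ _ _) _.
rewrite -[leRHS]mul1r -l1 mulr_suml; apply: ler_sum => l _.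
by rewrite normrM (ger0_norm (l0 l)) ler_wpM2l.
Qed.

Lemma fe_nodal_eq w u : fe_space Om M w -> fe_space Om M u ->
  (forall l : 'I_N, w (node l) = u (node l)) -> forall x, cl x -> w x = u x.
Proof.
move=> ww uu wu x /fe_barycentric[lam [_ _ h]]; rewrite (h _ ww) (h _ uu).
by apply: eq_bigr => l _; rewrite wu.
Qed.

Lemma fe_nodal_ge0 w : fe_space Om M w ->
  (forall l : 'I_N, 0 <= w (node l)) -> forall x, cl x -> 0 <= w x.
Proof.
move=> ww w0 x /fe_barycentric[lam [l0 _ ->//]].
by apply: sumr_ge0 => l _; rewrite mulr_ge0.
Qed.

Lemma fe_lincomb (c : R) w u : fe_space Om M w -> fe_space Om M u ->
  fe_space Om M (fun x => w x + c * u x).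
Proof.
move=> [cw aw] [cu au]; split.
  have h : continuous (fun x : subspace cl => (w x : R) + c * (u x : R)).
    move=> x; apply: cvgD; first exact: cw.
    by apply: cvgM; [exact: cvg_cst|exact: cu].
  exact: h.
move=> K KM; have [p [e wE]] := aw K KM; have [p' [e' uE]] := au K KM.
exists (p + c *: p'), (e + c * e') => x Kx; rewrite wE// uE//.
have -> : dotv (p + c *: p') x = dotv p x + c * dotv p' x.
  by rewrite /dotv mulr_sumr -big_split/=; apply: eq_bigr => j _; rewrite !mxE; ring.
ring.
Qed.

Lemma fe_cst c : fe_space Om M (fun=> c).
Proof.
split; first by apply: continuous_subspaceT; exact: cst_continuous.
move=> K _; exists 0, c => x _; rewrite (_ : dotv 0 x = 0) ?add0r//.
by rewrite /dotv big1// => j _; rewrite mxE mul0r.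
Qed.

Lemma fe_sum I (r : seq I) (c : I -> R) (F : I -> E -> R) :
  (forall i, fe_space Om M (F i)) ->
  fe_space Om M (fun x => \sum_(i <- r) c i * F i x).
Proof.
move=> fF; elim: r => [|i r IH].
  by rewrite (_ : (fun _ => _) = fun=> 0); [exact: fe_cst|apply/funext => x; rewrite big_nil].
rewrite (_ : (fun _ => _) = (fun x => \sum_(j <- r) c j * F j x + c i * F i x)).
  exact: fe_lincomb.
by apply/funext => x; rewrite big_cons addrC.
Qed.

Lemma fe_bounded w : fe_space Om M w -> exists2 C, 0 <= C & forall x, cl x -> `|w x| <= C.
Proof.
move=> ww; exists (\sum_(l < N) `|w (node l)|); first exact: sumr_ge0.
apply: fe_nodal_bound => // l.
by rewrite (bigD1 l)//= lerDl; exact: sumr_ge0.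
Qed.

Lemma fe_bs w (D : set E) : measurable D -> D `<=` cl -> fe_space Om M w -> bs (w \_ D).
Proof.
move=> mD Dcl ww; have [C C0 wC] := fe_bounded ww.
have [k clk] := compact_sub_cube closure_compact.
split; [split|].
- apply/(measurable_restrictT _ mD).
  apply: (measurable_funS closure_measurable) => //.
  by apply: within_continuous_measurable; [exact: closure_measurable|case: ww].
- exists C => x; rewrite /patch; case: ifPn => [|_]; last by rewrite normr0.
  by rewrite inE => /Dcl; exact: wC.
- exists k => x xk; rewrite /patch memNset// => /Dcl /clk; exact: xk.
Qed.

Lemma fe_slopes w : fe_space Om M w -> exists p : {set 'I_N} -> E,
  forall K, K \in cells M -> forall x y, simplex K x -> simplex K y ->
    w x - w y = dotv (p K) (x - y).
Proof.
move=> [_ aw].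
have /choice[p pE] : forall K, exists p : E, K \in cells M ->
    forall x y, simplex K x -> simplex K y -> w x - w y = dotv p (x - y).
  move=> K; have [/aw[p [c wE]]|_] := boolP (K \in cells M); last by exists 0.
  exists p => _ x y Kx Ky; rewrite !wE// opprD addrACA subrr addr0.
  by rewrite /dotv -sumrB; apply: eq_bigr => j _; rewrite !mxE mulrBr.
by exists p.
Qed.

Lemma dotv_ej (p : E) (j : 'I_d) t : dotv p (t *: 'e_j) = t * p ord0 j.
Proof.
rewrite /dotv (bigD1 j)//= big1 ?addr0; first by rewrite !mxE !eqxx mulr1 mulrC.
by move=> i /negbTE ij; rewrite !mxE /= ij mulr0 mulr0.
Qed.

Lemma fe_lipschitz w (p : {set 'I_N} -> E) (j : 'I_d) (L : R) x t :
  (forall K, K \in cells M -> forall x y, simplex K x -> simplex K y ->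
    w x - w y = dotv (p K) (x - y)) ->
  (forall K, K \in cells M -> `|p K ord0 j| <= L) -> 0 <= t ->
  (forall u : R, 0 <= u <= t -> cl (x + u *: 'e_j)) ->
  `|w (x + t *: 'e_j) - w x| <= L * t.
Proof.
move=> wp pL t0 seg.
pose f (u : R) := w (x + u *: 'e_j).
have := @closed_segment_chain R _ (enum (cells M))
  (fun K => (fun u : R => x + u *: 'e_j) @^-1` simplex K) f 0 t L t0.
rewrite subr0 /f scale0r addr0; apply.
- move=> K _; apply: closed_comp; last exact: simplex_closed.
  move=> u _; apply: cvgD; first exact: cvg_cst.
  by apply: cvgZ; [exact: cvg_id|exact: cvg_cst].
- move=> u /seg/cell_cover_closure[K KM Ku]; exists K => //.
  by rewrite mem_enum.
- move=> K u r; rewrite mem_enum => KM Ku Kr.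
  rewrite (wp K)// [X in dotv _ X](_ : _ = (u - r) *: 'e_j); last first.
    by rewrite scalerBl opprD addrACA subrr add0r.
  by rewrite dotv_ej normrM mulrC ler_wpM2r// pL.
Qed.

Lemma bmeas_loc_integrable (f : E -> R) : bmeas f -> loc_integrable Om f.
Proof.
move=> bf K cK _; have [k Kk] := compact_sub_cube cK.
have mK : measurable K by apply: closed_rV_measurable; exact: compact_closed.
have b : bs (fun x => f x * \1_(cube k) x).
  by apply: bsMr => //; apply: (@bs_indic _ _ _ k) => //; exact: measurable_cube.
apply: eq_integrable (bs_integrable mK b) => // x; rewrite inE => /Kk xk.
by rewrite /= indicE mem_set// mulr1.
Qed.

Lemma loc_integrable_eq (f g : E -> R) : (forall x, Om x -> f x = g x) ->
  loc_integrable Om f -> loc_integrable Om g.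
Proof.
move=> fg lf K cK KOm; apply: eq_integrable (lf K cK KOm).
  by apply: closed_rV_measurable; exact: compact_closed.
by move=> x; rewrite inE => /KOm /fg /= ->.
Qed.

Definition pgrad (p : {set 'I_N} -> E) (x : E) : E :=
  \row_j sel (enum (cells M)) (fun K => p K ord0 j) x.

Lemma pgradE p j x : pgrad p x ord0 j = sel (enum (cells M)) (fun K => p K ord0 j) x.
Proof. by rewrite mxE. Qed.

Lemma pgrad_bmeas p j : bmeas (fun x => pgrad p x ord0 j).
Proof. by under eq_fun do rewrite pgradE; exact: sel_bmeas. Qed.

Lemma subOmcl : Om `<=` cl. Proof. exact: subset_closure. Qed.

(** Near the support of the test function, w is Lipschitz in each coordinate
    direction, and its difference quotients converge to the slope in the cell
    for almost every point. *)
Lemma fe_weak_grad w p : fe_space Om M w ->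
  (forall K, K \in cells M -> forall x y, simplex K x -> simplex K y ->
    w x - w y = dotv (p K) (x - y)) ->
  is_weak_grad Om w (pgrad p).
Proof.
move=> ww wp; have bw := fe_bs Om_measurable subOmcl ww.
split.
  apply: loc_integrable_eq (bmeas_loc_integrable (bs_bmeas bw)) => x Omx.
  by rewrite /patch mem_set.
move=> j; split; first by apply: bmeas_loc_integrable; exact: pgrad_bmeas.
move=> phi tphi; have [sphi [K [cK KOm phiK]]] := tphi.
have [del del0 Kdel] := compact_margin cK oOm KOm.
have [C C0 lphi] := test_lipschitz j tphi.
have [N0 N0del] : exists N0, forall m, (N0 <= m)%N -> @step R m < del.
  have [N0 _ h] := cvgr_lt (0:R) (@step_cvg R) del del0.
  by exists N0.
have phin0 x : phi x != 0 -> K x.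
  by move=> /eqP px; apply: contrapT => /phiK.
have seg x m (u : R) : phi x != 0 -> (N0 <= m)%N -> 0 <= u <= step m -> Om (x + u *: 'e_j).
  move=> /phin0 Kx N0m /andP[u0 um]; apply: (Kdel x) => //.
  rewrite addrAC subrr add0r normrZ ger0_norm//; apply: le_lt_trans (N0del _ N0m).
  by apply: le_trans um; rewrite ler_piMr// norm_ej.
have s0 m : 0 <= @step R m by apply: ltW; exact: step_gt0.
have IBP : \int[leb]_x ((w \_ Om) x * 'D_('e_j) phi x) =
    - \int[leb]_x (pgrad p x ord0 j * phi x).
  apply: (@ibp_difference_quotients _ _ _ _ _ _ j C
     (\sum_(K : {set 'I_N}) `|p K ord0 j|) N0).
  - exact: bs_bmeas.
  - exact: pgrad_bmeas.
  - exact: test_bs tphi.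
  - exact: test_bs (test_derive j tphi).
  - by move=> x; exact: test_is_derive tphi.
  - by move=> x t; exact: lphi.
  - move=> m x N0m px; have Kx := phin0 _ px.
    have O1 : Om (x + step m *: 'e_j).
      by apply: (seg x m) => //; rewrite lexx andbT.
    rewrite /patch !mem_set//; last exact: KOm.
    apply: (fe_lipschitz wp) => //.
      by move=> K' _; rewrite (bigD1 K')//= lerDl; exact: sumr_ge0.
    by move=> u us; apply: subOmcl; exact: (seg x m).
  - have := ae_inside M (norm_ej j); apply: filterS => x inx px.
    have Kx := phin0 _ px; have Omx := KOm _ Kx.
    have [K0 K0M K0x] := cell_cover_closure (subOmcl Omx).
    have [|K' [K's K'x selE]] := @selP _ _ M (enum (cells M)) x.
      by exists K0; rewrite ?mem_enum.
    rewrite pgradE selE.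
    apply: cvg_near_cst; near=> m.
    have N0m : (N0 <= m)%N by near: m; exists N0.
    have K'm : simplex K' (x + step m *: 'e_j) by near: m; exact: inx.
    rewrite /patch !mem_set//; last by apply: (seg x m) => //; rewrite s0 lexx.
    rewrite (wp K')//; last by rewrite -mem_enum.
    rewrite addrAC subrr add0r dotv_ej mulrA mulVf ?mul1r//.
    by rewrite gt_eqF// step_gt0.
rewrite Rintegral_mkcond [in RHS]Rintegral_mkcond.
transitivity (\int[leb]_x ((w \_ Om) x * 'D_('e_j) phi x)).
  by apply: eq_Rintegral => x _; rewrite /patch; case: ifP => // _; rewrite mul0r.
rewrite IBP; congr (- _); apply: eq_Rintegral => x _.
rewrite /patch; case: ifPn => //; rewrite notin_setE => nOm.
by rewrite phiK ?mulr0//; apply: contra_not nOm; exact: KOm.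
Unshelve. all: by end_near. Qed.

End fe_functions.

(** * Continuity of translations in L^1 *)

Section translation_continuity.
Context {R : realType} {n : nat}.
Notation E := 'rV[R]_n.
Implicit Types f g : E -> R.

(** Translations of f are continuous at 0 in L^1. Being stable under sums and
    products, the property reduces to indicators of closed sets and continuous
    functions. *)
Definition tc f := bs f /\ forall z : nat -> E, z m @[m --> \oo] --> (0 : E) ->
  \int[leb]_x `|f (x + z m) - f x| @[m --> \oo] --> (0 : R).

Lemma tc_bs f : tc f -> bs f. Proof. by case. Qed.

Lemma bs_diff f z : bs f -> bs (fun x => `|f (x + z) - f x|).
Proof. by move=> bf; apply: bs_norm; apply: bsB => //; exact: bs_shift. Qed.

Lemma tc_squeeze f g (u : (nat -> E) -> nat -> R) : bs f ->
  (forall z m, \int[leb]_x `|f (x + z m) - f x| <= u z m) ->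
  (forall z, z m @[m --> \oo] --> (0 : E) -> u z m @[m --> \oo] --> (0 : R)) ->
  tc f.
Proof.
move=> bf fu u0; split => // z z0.
apply: (squeeze_cvgr _ (cvg_cst 0) (u0 z z0)).
apply: nearW => m; rewrite fu andbT; exact: Rintegral_ge0.
Qed.

Lemma tcD f g : tc f -> tc g -> tc (fun x => f x + g x).
Proof.
move=> [bf cf] [bg cg].
apply: (@tc_squeeze _ f (fun z m => \int[leb]_x `|f (x + z m) - f x| +
    \int[leb]_x `|g (x + z m) - g x|)).
- exact: bsD.
- move=> z m; rewrite -intD; [|exact: bs_diff|exact: bs_diff].
  apply: int_le; first exact: (bs_diff _ (bsD bf bg)).
    by apply: bsD; exact: bs_diff.
  by move=> x; rewrite opprD addrACA; exact: ler_normD.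
- by move=> z z0; rewrite -[X in _ --> X](addr0 0); apply: cvgD; [exact: cf|exact: cg].
Qed.

Lemma tcM f g : tc f -> tc g -> tc (fun x => f x * g x).
Proof.
move=> [bf cf] [bg cg].
have [C C0 fC] := bmeas_bound (bs_bmeas bf).
have [C' C'0 gC] := bmeas_bound (bs_bmeas bg).
apply: (@tc_squeeze _ f (fun z m => C' * \int[leb]_x `|f (x + z m) - f x| +
    C * \int[leb]_x `|g (x + z m) - g x|)).
- by apply: bsMl => //; exact: bs_bmeas.
- move=> z m; rewrite -!intZ; [|exact: bs_diff|exact: bs_diff].
  rewrite -intD; [|by apply: bsMr; [exact: bmeas_cst|exact: bs_diff]..].
  apply: int_le.
  + by apply: (bs_diff _ (bsMl bf _)); exact: bs_bmeas.
  + by apply: bsD; apply: bsMr; [exact: bmeas_cst|exact: bs_diff|exact: bmeas_cst|exact: bs_diff].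
  + move=> x; rewrite (_ : _ - _ = g (x + z m) * (f (x + z m) - f x) +
        f x * (g (x + z m) - g x)); last by ring.
    by apply: le_trans (ler_normD _ _) _; rewrite !normrM lerD// ler_wpM2r.
- move=> z z0; rewrite -[X in _ --> X](addr0 0) -[X in _ --> X + _](mulr0 C').
  rewrite -[X in _ --> _ + X](mulr0 C); apply: cvgD; apply: cvgM.
  + exact: cvg_cst.
  + exact: cf.
  + exact: cvg_cst.
  + exact: cg.
Qed.

Lemma tcZ c f : tc f -> tc (fun x => c * f x).
Proof.
move=> [bf cf].
apply: (@tc_squeeze _ f (fun z m => `|c| * \int[leb]_x `|f (x + z m) - f x|)).
- by apply: bsMr => //; exact: bmeas_cst.
- move=> z m; rewrite -intZ; last exact: bs_diff.
  rewrite le_eqVlt; apply/orP; left; apply/eqP; apply: eq_Rintegral => x _.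
  by rewrite -mulrBr normrM.
- move=> z z0; rewrite -[X in _ --> X](mulr0 `|c|); apply: cvgM; last exact: cf.
  exact: cvg_cst.
Qed.

Lemma tcB f g : tc f -> tc g -> tc (fun x => f x - g x).
Proof.
move=> tf tg; rewrite (_ : (fun _ => _) = (fun x => f x + (-1) * g x)).
  by apply: tcD => //; exact: tcZ.
by apply/funext => x; rewrite mulN1r.
Qed.

Lemma tc0 : tc (fun=> 0).
Proof.
split; first by split; [exact: bmeas_cst|exists 0].
move=> z _; rewrite (_ : (fun m => _) = fun=> 0); first exact: cvg_cst.
apply/funext => m; rewrite -[RHS](@int0 R n); apply: eq_Rintegral => x _.
by rewrite subrr normr0.
Qed.

Lemma cvg_norm_bound (z : nat -> E) : z m @[m --> \oo] --> (0 : E) ->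
  exists N0, forall m, (N0 <= m)%N -> `|z m| <= 1.
Proof.
move=> /cvgr0_norm_le z0; have [N0 _ h] := z0 1 ltr01.
by exists N0 => m; exact: h.
Qed.

Lemma int_bounded_cvg0 (F : nat -> E -> R) C k N0 :
  (forall m, measurable_fun setT (F m)) ->
  {ae leb, forall x, F m x @[m --> \oo] --> (0 : R)} ->
  (forall m x, `|F m x| <= C) ->
  (forall m x, (N0 <= m)%N -> ~ @cube R n k x -> F m x = 0) ->
  \int[leb]_x F m x @[m --> \oo] --> (0 : R).
Proof.
move=> mF cF FC Fk.
have H : \int[leb]_x F (m + N0)%N x @[m --> \oo] --> \int[leb]_(x in (setT : set E)) (0 : R).
  apply: (@int_bounded_cvg _ _ _ _ C k) => //.
    apply: filterS cF => x h.
    by have := h; rewrite -(cvg_shiftn N0); exact.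
  by move=> m x; apply: Fk; rewrite leq_addl.
by rewrite int0 (cvg_shiftn N0 (fun m => \int[leb]_x F m x)) in H.
Qed.

Lemma shift_notin_cube k (x z : E) : `|z| <= 1 -> ~ cube k.+1 x -> ~ cube k (x + z).
Proof. by move=> z1; apply: contra_not; exact: cube_shift. Qed.

Lemma tc_pointwise f : bs f ->
  (forall x (z : nat -> E), z m @[m --> \oo] --> (0 : E) -> f (x + z m) @[m --> \oo] --> f x) ->
  tc f.
Proof.
move=> bf cf; split => // z z0.
have [C C0 fC] := bmeas_bound (bs_bmeas bf).
have [_ [k fk]] := bf.
have [N0 zN0] := cvg_norm_bound z0.
apply: (@int_bounded_cvg0 _ (C + C) k.+1 N0).
- by move=> m; case: (bs_diff (z m) bf) => -[].
- apply: aeW => x; have := cvg_norm (cvgB (cf x z z0) (cvg_cst (f x))).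
  by rewrite subrr normr0; apply.
- move=> m x; rewrite normr_id; apply: le_trans (ler_normB _ _) _.
  exact: lerD.
- move=> m x N0m xk; rewrite !fk ?subrr ?normr0//.
    by apply: contra_not xk; apply: cube_mono.
  exact: shift_notin_cube (zN0 m N0m) xk.
Qed.

Lemma tc_continuous f : bs f -> continuous f -> tc f.
Proof.
move=> bf cf; apply: tc_pointwise => // x z z0.
apply: continuous_cvg; first exact: cf.
by rewrite -[X in _ --> X](addr0 x); apply: cvgD; [exact: cvg_cst|exact: z0].
Qed.

(** The points outside K that a small translation moves into K have small
    measure by dominated convergence, as K is closed; those that leave K are
    the same set for the opposite translation. *)
Lemma tc_indic (K : set E) k : closed K -> K `<=` cube k -> tc (\1_K : E -> R).
Proof.
move=> cK Kk; have mK := closed_rV_measurable cK.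
have bK : bs (\1_K : E -> R) by exact: bs_indic Kk.
split => // z z0.
pose i : E -> R := \1_K.
have b1 y : bs (fun x => i (x + y) * (1 - i x)).
  apply: bsMl; first exact: bs_shift.
  by apply: bmeasB; [exact: bmeas_cst|exact: bs_bmeas].
have half (y : nat -> E) : y m @[m --> \oo] --> (0 : E) ->
    \int[leb]_x (i (x + y m) * (1 - i x)) @[m --> \oo] --> (0 : R).
  move=> y0; have [N0 yN0] := cvg_norm_bound y0.
  apply: (@int_bounded_cvg0 _ 1 k.+1 N0).
  - by move=> m; case: (b1 (y m)) => -[].
  - apply: aeW => x; have [Kx|nKx] := pselect (K x).
      rewrite (_ : (fun m => _) = fun=> 0); first exact: cvg_cst.
      by apply/funext => m; rewrite /i [X in 1 - X]indicE mem_set// subrr mulr0.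
    apply: cvg_near_cst.
    have oK : nbhs x (~` K) by apply: open_nbhs_nbhs; split => //; exact: closed_openC.
    have xy : x + y m @[m --> \oo] --> x.
      rewrite -[X in _ --> X](addr0 x); apply: cvgD; first exact: cvg_cst.
      exact: y0.
    have : \forall m \near \oo, ~ K (x + y m) := xy _ oK.
    apply: filterS => m nK.
    by rewrite /i [X in X * _]indicE memNset// mul0r.
  - move=> m x; rewrite normrM /i !indicE.
    by case: (_ \in _); case: (_ \in _); rewrite ?subrr ?subr0 ?normr0 ?normr1 ?mulr0 ?mul0r ?mulr1.
  - move=> m x N0m xk; rewrite /i indicE memNset ?mul0r// => /Kk.
    exact: shift_notin_cube (yN0 m N0m) xk.
have E1 m : \int[leb]_x `|i (x + z m) - i x| =
    \int[leb]_x (i (x + z m) * (1 - i x)) + \int[leb]_x (i (x + - z m) * (1 - i x)).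
  rewrite -[X in _ + X](int_shift (z m)) -?intD//.
    apply: eq_Rintegral => x _; rewrite addrK /i !indicE.
    by case: (_ \in _); case: (_ \in _);
      rewrite ?subrr ?subr0 ?sub0r ?normrN ?normr0 ?normr1 ?mulr0 ?mul0r ?mulr1 ?addr0 ?add0r.
  exact: (bs_shift (z m) (b1 (- z m))).
rewrite (_ : (fun m => _) = (fun m => \int[leb]_x (i (x + z m) * (1 - i x)) +
    \int[leb]_x (i (x + - z m) * (1 - i x)))); last exact/funext.
rewrite -[X in _ --> X](addr0 0); apply: cvgD; apply: half => //.
by rewrite -oppr0; exact: cvgN.
Qed.

End translation_continuity.

(** * Green's formula for Lipschitz functions with compact support *)

Section green.
Context {R : realType} {n : nat}.
Notation E := 'rV[R]_n.
Implicit Types (Om : set E) (u v f L H : E -> R).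

(** Symmetric and translation invariant: as a function of either variable it is
    a smooth bump of radius r centred at the other one. *)
Definition ker (r : R) (x y : E) : R :=
  bumps (fun i => x ord0 i - r) (fun i => x ord0 i + r) 0 y.

Lemma kerC r x y : ker r x y = ker r y x.
Proof.
apply: eq_bigr => i _; rewrite !bumpE mulrC; congr (flat 0 _ * flat 0 _); ring.
Qed.

Lemma kerE r x y : ker r x y = ker r 0 (y - x).
Proof.
apply: eq_bigr => i _; rewrite !bumpE !mxE; congr (flat 0 _ * flat 0 _); ring.
Qed.

Definition dker (r : R) (j : 'I_n) (z : E) : R := 'D_('e_j) (ker r 0) z.

Lemma ker_test Om r x : (forall y, `|y - x| <= r -> Om y) -> 0 <= r ->
  test_function Om (ker r x).
Proof.
move=> xOm r0; apply: bumps_test => y yb; apply: xOm; apply: norm_leP => // i.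
by rewrite !mxE ler_norml; have /andP[h1 h2] := yb i; apply/andP; split; lra.
Qed.

Lemma ker_testT r x : 0 <= r -> test_function setT (ker r x).
Proof. by move=> r0; exact: ker_test. Qed.

Lemma derive_ker r j x y : 0 <= r -> 'D_('e_j) (ker r x) y = dker r j (y - x).
Proof.
move=> r0; have h := is_deriveP (test_is_derive j (y - x) (ker_testT 0 r0)).
have : is_derive y 'e_j (ker r x) (dker r j (y - x)).
  apply: is_derive_cvg; move: h; rewrite (_ : (fun h => _) =
     (fun h => h^-1 *: (ker r x (h *: 'e_j + y) - ker r x y)))//.
  by apply/funext => t; rewrite addrA -!kerE.
by case.
Qed.

Lemma dker_opp r j z : 0 <= r -> dker r j (- z) = - dker r j z.
Proof.
move=> r0; have h := is_deriveP (test_is_derive j z (ker_testT 0 r0)).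
have E1 w : ker r 0 (- w) = ker r 0 w by rewrite kerC kerE opprK add0r.
have : is_derive (- z) 'e_j (ker r 0) (- dker r j z).
  apply: is_derive_cvg.
  rewrite (_ : (fun t => _) = (fun t : R =>
      - ((- t)^-1 *: (ker r 0 (- t *: 'e_j + z) - ker r 0 z)))); last first.
    apply/funext => t; have -> : t *: 'e_j - z = - (- t *: 'e_j + z).
      by rewrite opprD scaleNr opprK.
    by rewrite !E1 invrN [X in _ = - X]scaleNr opprK.
  apply: cvgN.
  have c : (- t) @[t --> (0:R)^'] --> (0:R)^'.
    move=> A A0.
    have c0 : (- t) @[t --> (0:R)] --> (0:R).
      by rewrite -[X in _ --> X]oppr0; apply: cvgN; exact: cvg_id.
    have A1 : \forall t \near (0:R), - t != 0 -> A (- t) := c0 _ A0.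
    have A2 : \forall t \near (0:R), t != 0 -> A (- t).
      by apply: filterS A1 => t tA t0; apply: tA; rewrite oppr_eq0.
    exact: A2.
  exact: (cvg_comp _ _ c h).
by case.
Qed.

(** Cross-correlation. *)
Definition corr u v (z : E) : R := \int[leb]_y (u y * v (y + z)).

Lemma measurable_add : measurable_fun setT (fun p : E * E => p.1 + p.2).
Proof.
apply: measurable_fun_rV => i; under eq_fun do rewrite mxE.
by apply: measurable_funD; apply: (measurableT_comp (measurable_coord i)).
Qed.

Lemma measurable_sub : measurable_fun setT (fun p : E * E => p.2 - p.1).
Proof.
apply: measurable_fun_rV => i; under eq_fun do rewrite !mxE.
apply: measurable_funB; apply: (measurableT_comp (measurable_coord i)) => //.
Qed.

Lemma bs2_prod u v w : bs u -> bmeas v -> bs w ->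
  bs2 (fun p : E * E => u p.1 * v p.2 * w (p.2 - p.1)).
Proof.
move=> [[mu [Cu uC]] [k uk]] [mv [Cv vC]] [[mw [Cw wC]] [l wl]]; split.
- apply: measurable_funM.
    by apply: measurable_funM; [exact: (measurableT_comp mu)|exact: (measurableT_comp mv)].
  exact: (measurableT_comp mw measurable_sub).
- by exists (Cu * Cv * Cw) => p; rewrite !normrM !ler_pM.
- exists (k + l)%N => x y; have [xk|xk] := pselect (cube k x); last first.
    by rewrite /= uk// !mul0r.
  have [yl|yl] := pselect (cube l (y - x)); last by rewrite /= (wl _ yl) mulr0.
  move=> xy; exfalso; apply: xy; split.
    by apply: cube_mono xk; rewrite leq_addr.
  move=> i; rewrite -ltr_norml -[y](subrK x) mxE natrD addrC [k%:R + _]addrC.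
  apply: le_lt_trans (ler_normD _ _) _; rewrite addrC.
  by apply: ltrD; rewrite ltr_norml; [exact: xk|exact: yl].
Qed.

Lemma bs2_corr u v w : bs u -> bmeas v -> bs w ->
  bs2 (fun p : E * E => u p.1 * v (p.1 + p.2) * w p.2).
Proof.
move=> [[mu [Cu uC]] [k uk]] [mv [Cv vC]] [[mw [Cw wC]] [l wl]]; split.
- apply: measurable_funM; last exact: (measurableT_comp mw).
  apply: measurable_funM; first exact: (measurableT_comp mu).
  exact: (measurableT_comp mv measurable_add).
- by exists (Cu * Cv * Cw) => p; rewrite !normrM !ler_pM.
- exists (maxn k l) => x y; have [xk|xk] := pselect (cube k x); last first.
    by rewrite /= uk// !mul0r.
  have [yl|yl] := pselect (cube l y); last by rewrite /= (wl _ yl) mulr0.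
  move=> xy; exfalso; apply: xy; split.
    by apply: cube_mono xk; rewrite leq_maxl.
  by apply: cube_mono yl; rewrite leq_maxr.
Qed.

Lemma bs_sub v w y : bmeas v -> bs w -> bs (fun x => v x * w (x - y)).
Proof. by move=> bv bw; apply: bsMr => //; exact: (bs_shift (- y)). Qed.

Lemma bs_sub' u w x : bs u -> bs w -> bs (fun y => u y * w (x - y)).
Proof.
move=> bu bw; have := bs2_section1 x (bs2_prod bu (bmeas_cst 1) bw).
by congr bs; apply/funext => y /=; rewrite mulr1.
Qed.

Lemma fubini_ker u v w : bs u -> bmeas v -> bs w ->
  \int[leb]_y (u y * \int[leb]_x (v x * w (x - y))) =
  \int[leb]_x (v x * \int[leb]_y (u y * w (x - y))).
Proof.
move=> bu bv bw; have := int2_fubini (bs2_prod bu bv bw) => /= h.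
transitivity (\int[leb]_x \int[leb]_y (u x * v y * w (y - x))).
  apply: eq_Rintegral => y _; rewrite -intZ; last exact: bs_sub.
  by apply: eq_Rintegral => x _; rewrite mulrA.
rewrite h; apply: eq_Rintegral => x _; rewrite -intZ; last exact: bs_sub'.
by apply: eq_Rintegral => y _; rewrite mulrA [v x * _]mulrC.
Qed.

Lemma bs_int_ker u v w : bs u -> bmeas v -> bs w ->
  bs (fun y => u y * \int[leb]_x (v x * w (x - y))).
Proof.
move=> bu bv bw; have := bs2_int (bs2_prod bu bv bw).
congr bs; apply/funext => y /=; rewrite -intZ; last exact: bs_sub.
by apply: eq_Rintegral => x _; rewrite mulrA.
Qed.

Lemma ker_bs r x : 0 <= r -> bs (ker r x).
Proof. by move=> r0; exact: test_bs (ker_testT x r0). Qed.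

Lemma dker_bs r j : 0 <= r -> bs (dker r j).
Proof. by move=> r0; exact: test_bs (test_derive j (ker_testT 0 r0)). Qed.

Lemma corr_ker r u v z : bs u -> bmeas v ->
  \int[leb]_y (u y * v (y + z) * ker r 0 z) = ker r 0 z * corr u v z.
Proof.
move=> bu bv; rewrite -intZ; last by apply: bsMl => //; exact: bmeas_shift.
by apply: eq_Rintegral => y _; rewrite mulrC.
Qed.

(** Fubini's theorem and the substitution x = y + z. *)
Lemma int_ker_corr r u v : bs u -> bmeas v -> 0 <= r ->
  \int[leb]_y (u y * \int[leb]_x (v x * ker r 0 (x - y))) =
  \int[leb]_z (ker r 0 z * corr u v z).
Proof.
move=> bu bv r0; have bk := ker_bs 0 r0.
have := int2_fubini (bs2_corr bu bv bk) => /= h.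
transitivity (\int[leb]_x \int[leb]_y (u x * v (x + y) * ker r 0 y)).
  apply: eq_Rintegral => y _; rewrite -[X in _ * X](int_shift y); last exact: bs_sub.
  rewrite -intZ; last first.
    exact: (bs_shift y (bs_sub y bv bk)).
  by apply: eq_Rintegral => z _; rewrite mulrA addrK [z + y]addrC.
by rewrite h; apply: eq_Rintegral => z _; exact: corr_ker.
Qed.

(** Only the factor u needs continuous translations, since v is bounded. *)
Lemma corr_cvg u v (z : nat -> E) : tc u -> bmeas v -> z m @[m --> \oo] --> (0 : E) ->
  corr u v (z m) @[m --> \oo] --> corr u v 0.
Proof.
move=> [bu cu] bv z0; have [C C0 vC] := bmeas_bound bv.
have E1 y : corr u v y = \int[leb]_x (u (x - y) * v x).
  rewrite /corr -[LHS](int_shift (- y)).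
    by apply: eq_Rintegral => x _; rewrite subrK.
  by apply: bsMl => //; exact: bmeas_shift.
have zN0 : (- z m) @[m --> \oo] --> (0 : E) by rewrite -oppr0; exact: cvgN.
apply/cvgrPdist_le => e e0.
have /cvgrPdist_le := cu _ zN0.
move=> /(_ (e / (C + 1))); rewrite divr_gt0// ?ltr_wpDl// => /(_ isT).
apply: filterS => m; rewrite sub0r normrN ger0_norm; last exact: Rintegral_ge0.
rewrite ler_pdivlMr ?ltr_wpDl// => h.
rewrite !E1 -intB; last 2 first.
- by apply: bsMl; [exact: bs_shift|].
- by apply: bsMl; [exact: bs_shift|].
apply: le_trans (int_norm _) _.
  by apply: bsB; apply: bsMl => //; exact: bs_shift.
apply: le_trans h; rewrite mulrC -intZ; last exact: bs_diff.
apply: int_le.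
- by apply: bs_norm; apply: bsB; apply: bsMl => //; exact: bs_shift.
- by apply: bsMr; [exact: bmeas_cst|exact: bs_diff].
- move=> x; rewrite subr0 -mulrBl normrM mulrC distrC ler_wpM2r//.
  by apply: le_trans (vC x) _; rewrite lerDl.
Qed.

Lemma corr0 u v : corr u v 0 = \int[leb]_x (u x * v x).
Proof. by apply: eq_Rintegral => x _; rewrite addr0. Qed.

Lemma bs_ker_corr r u v : bs u -> bmeas v -> 0 <= r ->
  bs (fun z => ker r 0 z * corr u v z).
Proof.
move=> bu bv r0; have := bs2_int (bs2_swap (bs2_corr bu bv (ker_bs 0 r0))).
by congr bs; apply/funext => z /=; exact: corr_ker.
Qed.

Lemma ker_gt0 r x : `|x| < r -> 0 < ker r 0 x.
Proof.
move=> xr; apply: bumps_gt0 => i; rewrite mxE sub0r add0r -ltr_norml.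
exact: le_lt_trans (coord_le_norm x i) xr.
Qed.

Lemma ker_neq0 r x : 0 <= r -> ker r 0 x != 0 -> `|x| <= r.
Proof.
move=> r0 xr; apply: norm_leP => // i; apply: ltW.
have : obox (fun i => (0 : E) ord0 i - r) (fun i => (0 : E) ord0 i + r) x.
  by apply: contrapT => h; move: xr; rewrite /ker bumps_eq0 ?eqxx.
by move=> /(_ i); rewrite mxE sub0r add0r -ltr_norml.
Qed.

(** Were H 0 positive, H would be positive near 0, and so would its mean against
    a bump of small radius. Sequential continuity at 0 suffices. *)
Lemma zero_at_origin H (r0 : R) : 0 < r0 ->
  (forall z : nat -> E, z m @[m --> \oo] --> (0 : E) -> H (z m) @[m --> \oo] --> H 0) ->
  (forall r, 0 < r <= r0 -> bs (fun z => ker r 0 z * H z) /\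
    \int[leb]_z (ker r 0 z * H z) = 0) ->
  H 0 <= 0.
Proof.
move=> rp cH key; rewrite leNgt; apply/negP => H0.
have ex r : 0 < r <= r0 -> exists2 z : E, `|z| <= r & H z <= 0.
  move=> rr; apply: contrapT => no.
  have pos z : `|z| <= r -> 0 < H z.
    by move=> zr; rewrite ltNge; apply/negP => Hz; apply: no; exists z.
  have [bg g0] := key r rr; set g := (fun z => _) in bg g0.
  have r1 : 0 <= r by case/andP: rr => /ltW.
  have gge0 z : 0 <= g z.
    have [k0|kn0] := eqVneq (ker r 0 z) 0; first by rewrite /g k0 mul0r.
    by rewrite mulr_ge0 ?bumps_ge0// ltW// pos// ker_neq0.
  have : ae_eq leb setT (EFin \o g) (cst 0%E).
    apply/ae_eq_integral_abs => //; first by apply/measurable_EFinP; case: bg => -[].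
    have fi := integrable_fin_num measurableT (bs_integrable measurableT bg).
    rewrite -[LHS](_ : \int[leb]_x (g x)%:E = _)%E; last first.
      by apply: eq_integral => x _ /=; rewrite ger0_norm.
    by rewrite -[LHS]fineK//; congr (_%:E).
  move=> [N [mN N0 NN]].
  have ob : open (ball (0 : E) r) by exact: ball_open.
  have b0 : ball (0 : E) r 0 by apply: ballxx; case/andP: rr.
  have := leb_open_gt0 ob (ex_intro _ _ b0); rewrite ltNge => /negP; apply.
  rewrite -N0; apply: le_measure; rewrite ?inE//; first exact: open_rV_measurable.
  move=> x; rewrite -ball_normE /= sub0r normrN => xr; apply: NN => /= /(_ I) [].
  apply/eqP; rewrite gt_eqF// mulr_gt0// ?ker_gt0//; apply: pos; exact: ltW.
have H' k : exists z : E, `|z| <= r0 * step k /\ H z <= 0.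
  have [|z z1 z2] := ex (r0 * step k); last by exists z.
  by rewrite mulr_gt0 ?step_gt0//= ler_piMr ?step_le1// ltW.
have /choice[z zP] := H'.
have z0 : z m @[m --> \oo] --> (0 : E).
  apply/cvgr0Pnorm_le => e e0.
  have : r0 * step m @[m --> \oo] --> (0 : R).
    by rewrite -[X in _ --> X](mulr0 r0); apply: cvgM; [exact: cvg_cst|exact: step_cvg].
  move=> /cvgr0_norm_le /(_ e e0); apply: filterS => m h.
  have [zm _] := zP m; apply: le_trans zm _; apply: le_trans h; exact: ler_norm.
have := cH z z0; move=> /(cvgr_gt (H 0)) /(_ 0 H0) [N _ /(_ N (leqnn N))] /=.
by have [_] := zP N; rewrite leNgt => /negP.
Qed.

Opaque ker dker corr Rintegral.

(** The field G and the density L are merely bounded, and satisfy the divergence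
    identity against smooth functions only, so f has to be regularised. Let H(z)
    be the left-hand side with G and L translated by z. The mean of H against a
    bump of small radius centred at 0 is, by Fubini's theorem, an average over y
    of f(y) times the identity tested with the bump centred at y, which is
    supported in Om when y is in C; hence it vanishes. As H is continuous at 0,
    H(0) = 0. *)
Lemma green_lipschitz Om (G : 'I_n -> E -> R) L f (F : 'I_n -> E -> R) (C : set E) :
  open Om -> (forall j, bmeas (G j)) -> bmeas L ->
  (forall phi, test_function Om phi ->
    \sum_j \int[leb]_x (G j x * 'D_('e_j) phi x) + \int[leb]_x (L x * phi x) = 0) ->
  tc f -> (forall j, tc (F j)) ->
  compact C -> C `<=` Om -> (forall x, ~ C x -> f x = 0) ->
  (forall j phi, test_function setT phi ->
    \int[leb]_x (f x * 'D_('e_j) phi x) = - \int[leb]_x (F j x * phi x)) ->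
  \sum_j \int[leb]_x (F j x * G j x) + \int[leb]_x (f x * L x) = 0.
Proof.
move=> oOm bG bL GL tf tF cC COm fC fF.
have [del del0 Cdel] := compact_margin cC oOm COm.
pose H z := \sum_j corr (F j) (G j) z + corr f L z.
have H0 : H 0 = \sum_j \int[leb]_x (F j x * G j x) + \int[leb]_x (f x * L x).
  by rewrite /H corr0; congr (_ + _); apply: eq_bigr => j _; rewrite corr0.
have bf := tc_bs tf; have bF j := tc_bs (tF j).
have cH (z : nat -> E) : z m @[m --> \oo] --> (0 : E) -> H (z m) @[m --> \oo] --> H 0.
  move=> z0; apply: cvgD; last exact: corr_cvg.
  apply: cvg_big => [|j _]; first exact: add_continuous.
  exact: corr_cvg.
have key r : 0 < r <= del / 2 -> bs (fun z => ker r 0 z * H z) /\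
    \int[leb]_z (ker r 0 z * H z) = 0.
  move=> /andP[rp rdel]; have r0 := ltW rp.
  have bsF j : bs (fun z => ker r 0 z * corr (F j) (G j) z) by exact: bs_ker_corr.
  have bsf : bs (fun z => ker r 0 z * corr f L z) by exact: bs_ker_corr.
  have HE : (fun z => ker r 0 z * H z) =
      (fun z => \sum_j (ker r 0 z * corr (F j) (G j) z) + ker r 0 z * corr f L z).
    by apply/funext => z; rewrite mulrDr mulr_sumr.
  rewrite HE; split; first by apply: bsD => //; exact: bs_sum.
  rewrite intD//; last exact: bs_sum.
  rewrite int_sum//.
  have bk := ker_bs 0 r0.
  (* The derivative passes from f to the kernel, and changes sign twice: by the
     weak formula for f, and because the derivative of an even kernel is odd. *)
  have moved j : \int[leb]_z (ker r 0 z * corr (F j) (G j) z) =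
      \int[leb]_y (f y * \int[leb]_x (G j x * dker r j (x - y))).
    have h1 := int_ker_corr (bF j) (bG j) r0.
    have h2 := fubini_ker (bF j) (bG j) bk.
    have h3 := fubini_ker bf (bG j) (dker_bs j r0).
    apply: (etrans (esym h1)); apply: (etrans h2); apply: (etrans _ (esym h3)).
    apply: eq_Rintegral => x _; apply: (f_equal (fun t => G j x * t)).
    have h4 : \int[leb]_y (f y * 'D_('e_j) (ker r x) y) =
        - \int[leb]_y (f y * dker r j (x - y)).
      rewrite -(intN (bs_sub' x bf (dker_bs j r0))).
      apply: eq_Rintegral => y _.
      by rewrite (derive_ker j x y r0) -(opprB x y) (dker_opp j (x - y) r0) mulrN.
    have h5 := oppr_inj (etrans (esym h4) (fF j _ (ker_testT x r0))).
    apply: (etrans _ (esym h5)); apply: eq_Rintegral => y _.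
    by rewrite (kerC r x y) (kerE r y x).
  rewrite (eq_bigr _ (fun j _ => moved j)).
  rewrite -(int_ker_corr bf bL r0).
  rewrite -int_sum; last by move=> j; apply: bs_int_ker => //; exact: dker_bs.
  rewrite -intD; last 2 first.
  - by apply: bs_sum => j; apply: bs_int_ker => //; exact: dker_bs.
  - exact: bs_int_ker.
  rewrite -[RHS](@int0 R n); apply: eq_Rintegral => y _.
  have [Cy|nCy] := pselect (C y); last first.
    by rewrite (fC y nCy) mul0r addr0 big1// => j _; rewrite mul0r.
  rewrite -mulr_sumr -mulrDr.
  have tk : test_function Om (ker r y).
    apply: ker_test => // x xy; apply: (Cdel y) => //; apply: le_lt_trans xy _.
    by apply: le_lt_trans rdel _; rewrite ltr_pdivrMr// ltr_pMr// ltr1n.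
  have := GL _ tk => GLy.
  suff E0 : \sum_(i < n) \int[leb]_x (G i x * dker r i (x - y)) +
      \int[leb]_x (L x * ker r 0 (x - y)) = 0 by rewrite E0 mulr0.
  apply: (etrans _ GLy); apply: f_equal2.
    apply: eq_bigr => j _; apply: eq_Rintegral => x _.
    by rewrite (derive_ker j y x r0).
  by apply: eq_Rintegral => x _; rewrite -(kerE r y x).
apply/eqP; rewrite eq_le -H0; apply/andP; split.
  by apply: (@zero_at_origin H (del / 2)) => //; rewrite divr_gt0.
rewrite -oppr_le0; apply: (@zero_at_origin (fun z => - H z) (del / 2)).
- by rewrite divr_gt0.
- by move=> z /cH Hz; exact: cvgN.
- move=> r /key[b1 b2]; rewrite (_ : (fun z => _) = (fun z => - (ker r 0 z * H z))).
    by split; [exact: bsN|rewrite intN// b2 oppr0].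
  by apply/funext => z; rewrite mulrN.
Qed.

Transparent ker dker corr Rintegral.

End green.

(** * Green's formula for finite element functions *)

Section tc_more.
Context {R : realType} {d : nat} (M : mesh R d).
Notation E := 'rV[R]_d.

Lemma sel_tc s c : tc (sel (M := M) s c : E -> R).
Proof.
elim: s => [|K s IH] /=; first exact: tc0.
have [k Kk] := compact_sub_cube (@simplex_compact _ _ M K).
have tK : tc (\1_(simplex K) : E -> R) by apply: tc_indic Kk; exact: simplex_closed.
rewrite (_ : (fun _ => _) = (fun x => c K * \1_(simplex K) x +
    (sel s c x - \1_(simplex K) x * sel s c x))).
  by apply: tcD; [exact: tcZ|apply: tcB => //; exact: tcM].
by apply/funext => x; rewrite mulrC mulrBl mul1r.
Qed.

End tc_more.

Section fe_green.
Context {R : realType} {d : nat} (Om : set 'rV[R]_d) (M : mesh R d).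
Notation E := 'rV[R]_d.
Notation N := (nnode M).
Hypotheses (oOm : open Om) (bOm : bounded_set Om) (mM : is_mesh Om M).
Local Notation cl := (closure Om).
Variables (psi : E -> R) (p : {set 'I_N} -> E).
Hypotheses (fepsi : fe_space Om M psi)
  (psip : forall K, K \in cells M -> forall x y, simplex K x -> simplex K y ->
    psi x - psi y = dotv (p K) (x - y))
  (psi0 : forall x, cl x -> ~ Om x -> psi x = 0)
  (psi_ge0 : forall x, cl x -> 0 <= psi x).

Let ex : E -> R := psi \_ cl.

Let exE x : cl x -> ex x = psi x.
Proof. by move=> clx; rewrite /ex /patch mem_set. Qed.

Let ex0 x : ~ Om x -> ex x = 0.
Proof.
move=> nOm; have [clx|nclx] := pselect (cl x); first by rewrite exE// psi0.
by rewrite /ex /patch memNset.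
Qed.

Let ex_ge0 x : 0 <= ex x.
Proof. by rewrite /ex /patch; case: ifPn => //; rewrite inE; exact: psi_ge0. Qed.

Let ex_bs : bs ex. Proof. by apply: (fe_bs bOm mM) => //; exact: closure_measurable. Qed.

Let ex_continuous : continuous ex.
Proof.
suff H (x : E) : ex y @[y --> x] --> ex x by move=> x; exact: H.
have [Omx|nOmx] := pselect (Om x).
  have cpsi : psi y @[y --> x] --> psi x.
    have : {within Om, continuous psi}.
      by apply: continuous_subspaceW fepsi.1; exact: subset_closure.
    by rewrite continuous_open_subspace// => /(_ x); apply; rewrite inE.
  have h : \forall y \near x, psi y = ex y.
    have : nbhs x Om by exact: open_nbhs_nbhs.
    by apply: filterS => y Omy; rewrite exE//; exact: subset_closure.
  rewrite -(nbhs_singleton h); apply: cvg_trans cpsi.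
  exact: (near_eq_cvg h).
have [clx|nclx] := pselect (cl x); last first.
  have h : \forall y \near x, cst (ex x) y = ex y.
    have : nbhs x (~` cl).
      by apply: open_nbhs_nbhs; split => //; apply: closed_openC; exact: closed_closure.
    by apply: filterS => y ncly; rewrite /ex /patch /= !memNset.
  by apply: (cvg_trans (near_eq_cvg h)); exact: cvg_cst.
rewrite (ex0 nOmx); apply/(@cvgrPdist_le _ _ _ (nbhs (x : E)) _) => e e0.
have := (subspace_continuousP cl psi).1 fepsi.1 x clx; rewrite (psi0 clx nOmx).
move=> /(@cvgrPdist_le _ _ _ (within cl (nbhs (x : E))) _) /(_ e e0) h.
have : nbhs x (fun y => cl y -> `|0 - psi y| <= e) by exact: h.
apply: filterS => y hy; rewrite /ex /patch; case: ifPn => [|_].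
  by rewrite inE; exact: hy.
by rewrite subr0 normr0 ltW.
Qed.

Let slope (j : 'I_d) := \sum_(K : {set 'I_N}) `|p K ord0 j|.

Let slopeP j K : `|p K ord0 j| <= slope j.
Proof. by rewrite /slope (bigD1 K)//= lerDl; exact: sumr_ge0. Qed.

Let slope_ge0 j : 0 <= slope j. Proof. exact: sumr_ge0. Qed.

(** Each line is covered by the cells and the complement of the domain, on which
    the extension vanishes. *)
Let ex_lipschitz (j : 'I_d) x (t : R) : 0 <= t ->
  `|ex (x + t *: 'e_j) - ex x| <= slope j * t.
Proof.
move=> t0; pose f (u : R) := ex (x + u *: 'e_j).
have := @closed_segment_chain R _ (None :: [seq Some K | K <- enum (cells M)])
  (fun o => (fun u : R => x + u *: 'e_j) @^-1`
     (if o is Some K then simplex K else ~` Om)) f 0 t (slope j) t0.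
rewrite subr0 /f scale0r addr0; apply.
- move=> o _; apply: closed_comp.
    move=> u _; apply: cvgD; first exact: cvg_cst.
    by apply: cvgZ; [exact: cvg_id|exact: cvg_cst].
  by case: o => [K|]; [exact: simplex_closed|exact: open_closedC].
- move=> u _; have [Omu|nOmu] := pselect (Om (x + u *: 'e_j)).
    have [K KM Ku] := cell_cover_closure mM (subset_closure Omu).
    by exists (Some K) => //; rewrite inE /= map_f// mem_enum.
  by exists None; rewrite ?inE.
- move=> [K|] u r; rewrite inE /=; last first.
    by move=> _ nu nr; rewrite !ex0// subrr normr0 mulr_ge0.
  rewrite mem_map; last by move=> ? ? [].
  rewrite mem_enum => KM Ku Kr.
  rewrite !exE; [|exact: (simplex_sub_closure mM KM)..].
  rewrite (psip KM)// [X in dotv _ X](_ : _ = (u - r) *: 'e_j); last first.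
    by rewrite scalerBl opprD addrACA subrr add0r.
  by rewrite dotv_ej normrM mulrC ler_wpM2r.
Qed.

Let big e : set E := [set x | e <= ex x].
Let lev e : set E := [set x | ex x = e].

Let big_closed e : closed (big e).
Proof.
by apply: (@closed_comp _ _ ex [set x : R | e <= x]) => [x _|];
  [exact: ex_continuous|exact: closed_ge].
Qed.

Let lev_closed e : closed (lev e).
Proof.
by apply: (@closed_comp _ _ ex [set x : R | x = e]) => [x _|];
  [exact: ex_continuous|exact: closed_eq].
Qed.

Let big_Om e : 0 < e -> big e `<=` Om.
Proof.
move=> e0 x bx; apply: contrapT => /ex0 E0; move: bx.
by rewrite /big/= E0 leNgt e0.
Qed.

Let big_compact e : 0 < e -> compact (big e).
Proof.
move=> e0; apply: (subclosed_compact _ (closure_compact bOm)) => //.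
by move=> x bx; apply: subset_closure; exact: (@big_Om e e0 x).
Qed.

(** The positive part of ex - e, which has compact support in the open domain. *)
Let trunc e x := (ex x - e) * \1_(big e) x.

Let truncE e x : trunc e x = Num.max (ex x - e) 0.
Proof.
rewrite /trunc indicE; have [h|h] := leP e (ex x).
  by rewrite mem_set// mulr1 max_l// subr_ge0.
rewrite memNset; last by rewrite /big/= leNgt h.
by rewrite mulr0 max_r// subr_le0 ltW.
Qed.

(** The right derivative of [trunc e], including on the level set ex = e, where it
    is the positive part of the slope; this choice avoids the discussion of the
    measure of level sets. *)
Let dtrunc e j x :=
  sel (enum (cells M)) (fun K => p K ord0 j) x * (\1_(big e) x - \1_(lev e) x) +
  sel (enum (cells M)) (fun K => Num.max (p K ord0 j) 0) x * \1_(lev e) x.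

Let trunc_tc e : 0 < e -> tc (trunc e).
Proof.
move=> e0; have [k bk] := compact_sub_cube (big_compact e0).
have tb : tc (\1_(big e) : E -> R) by apply: tc_indic bk; exact: big_closed.
rewrite (_ : trunc e = (fun x => ex x * \1_(big e) x - e * \1_(big e) x)).
  apply: tcB; last exact: tcZ.
  by apply: tcM => //; apply: tc_continuous; [exact: ex_bs|exact: ex_continuous].
by apply/funext => x; rewrite /trunc mulrBl.
Qed.

Let dtrunc_tc e j : 0 < e -> tc (dtrunc e j).
Proof.
move=> e0; have [k bk] := compact_sub_cube (big_compact e0).
have tb : tc (\1_(big e) : E -> R) by apply: tc_indic bk; exact: big_closed.
have tl : tc (\1_(lev e) : E -> R).
  apply: (@tc_indic _ _ _ k); first exact: lev_closed.
  by move=> x lx; apply: bk; rewrite /big/= lx.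
apply: tcD; apply: tcM => //; [exact: sel_tc|exact: tcB|exact: sel_tc].
Qed.

Let near_inside (j : 'I_d) : {ae leb, forall x,
  Om x -> exists K, [/\ K \in cells M, simplex K x,
    forall c, sel (enum (cells M)) c x = c K,
    \forall m \near \oo, simplex K (x + step m *: 'e_j) &
    \forall m \near \oo, simplex K (x + (- step m) *: 'e_j)]}.
Proof.
have h1 := ae_inside M (norm_ej j).
have h2 : {ae leb, forall x, forall K : {set 'I_N}, simplex K x ->
    \forall m \near \oo, simplex K (x + step m *: (- 'e_j))}.
  by apply: ae_inside; rewrite normrN norm_ej.
apply: filterS2 h1 h2 => x h1 h2 Omx.
have [K0 K0M K0x] := cell_cover_closure mM (subset_closure Omx).
have [|K [KM Kx selE]] := @selP _ _ M (enum (cells M)) x.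
  by exists K0; rewrite ?mem_enum.
exists K; split.
- by rewrite -mem_enum.
- exact: Kx.
- exact: selE.
- exact: (h1 K Kx).
- by apply: filterS (h2 K Kx) => m; rewrite scalerN scaleNr.
Qed.

Let trunc_ibp e j phi : 0 < e -> test_function setT phi ->
  \int[leb]_x (trunc e x * 'D_('e_j) phi x) = - \int[leb]_x (dtrunc e j x * phi x).
Proof.
move=> e0 tphi; have [C C0 lphi] := test_lipschitz j tphi.
have maxlip (a b : R) : `|Num.max a 0 - Num.max b 0| <= `|a - b|.
  by case: (leP a 0); case: (leP b 0) => h1 h2;
    rewrite ?subrr ?normr0// ?sub0r ?subr0 ?normrN;
    rewrite ler_norml; apply/andP; split; have := ler_norm (a - b);
    have := ler_norm (- (a - b)); rewrite ?normrN; lra.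
apply: (@ibp_difference_quotients _ _ _ _ _ _ j C (slope j) 0).
- exact: bs_bmeas (tc_bs (trunc_tc e0)).
- exact: bs_bmeas (tc_bs (dtrunc_tc j e0)).
- exact: test_bs tphi.
- exact: test_bs (test_derive j tphi).
- by move=> x; exact: test_is_derive tphi.
- by move=> x t; exact: lphi.
- move=> m x _ _; rewrite !truncE; apply: le_trans (maxlip _ _) _.
  rewrite opprB addrA subrK; apply: ex_lipschitz; apply: ltW; exact: step_gt0.
- have := near_inside j; apply: filterS => x inx _.
  have [xe|ex_ge] := ltP (ex x) e.
    have nl : ~ lev e x by move=> lx; move: xe; rewrite (lx : ex x = e) ltxx.
    have nb : ~ big e x by rewrite /big/= leNgt xe.
    rewrite /dtrunc !indicE (memNset nl) (memNset nb).
    rewrite subrr !mulr0 addr0; apply: cvg_near_cst.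
    have h : \forall m \near \oo, ex (x + step m *: 'e_j) < e.
      have xm : x + step m *: 'e_j @[m --> \oo] --> x.
        rewrite -[X in _ --> X](addr0 x); apply: cvgD; first exact: cvg_cst.
        rewrite -(scale0r 'e_j); apply: cvgZ; [exact: step_cvg|exact: cvg_cst].
      have xc : ex (x + step m *: 'e_j) @[m --> \oo] --> ex x.
        exact: (cvg_comp _ _ xm (@ex_continuous x)).
      exact: (cvgr_lt (ex x) xc e xe).
    apply: filterS h => m h; rewrite !truncE !max_r ?subr_le0; try exact: ltW.
    by rewrite subrr mulr0.
  have Omx : Om x by exact: (big_Om e0).
  have [K [KM Kx selE Kp _]] := inx Omx.
  have val : \forall m \near \oo, ex (x + step m *: 'e_j) = ex x + step m * p K ord0 j.
    apply: filterS Kp => m Km.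
    rewrite !exE; [|exact: (simplex_sub_closure mM KM)..].
    rewrite -[LHS](subrK (psi x)) (psip KM)// addrAC subrr add0r dotv_ej.
    exact: addrC.
  rewrite /dtrunc !selE indicE mem_set//.
  have [a0|an0] := eqVneq (ex x) e.
    rewrite indicE mem_set//= subrr mulr0 add0r mulr1.
    apply: cvg_near_cst; apply: filterS val => m val.
    rewrite !truncE val a0 subrr maxxx subr0 addrAC subrr add0r.
    rewrite -[X in Num.max _ X](mulr0 (step m)) -maxr_pMr; last by apply: ltW; exact: step_gt0.
    by rewrite mulrA mulVf ?mul1r// gt_eqF// step_gt0.
  have xe : e < ex x by rewrite lt_neqAle eq_sym an0.
  rewrite indicE memNset/=; last by move/eqP; rewrite (negbTE an0).
  rewrite subr0 mulr1 mulr0 addr0; apply: cvg_near_cst.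
  have small : \forall m \near \oo, 0 <= ex x + step m * p K ord0 j - e.
    have : ex x + step m * p K ord0 j - e @[m --> \oo] --> ex x + 0 * p K ord0 j - e.
      apply: cvgB; last exact: cvg_cst; apply: cvgD; first exact: cvg_cst.
      by apply: cvgM; [exact: step_cvg|exact: cvg_cst].
    rewrite mul0r addr0 => h; apply: (cvgr_ge _ h); rewrite subr_gt0//.
  apply: filterS2 val small => m val small.
  rewrite !truncE val !max_l//; last by rewrite subr_ge0.
  rewrite opprB addrA subrK addrAC subrr add0r mulrA mulVf ?mul1r//.
  by rewrite gt_eqF// step_gt0.
Qed.

(** At a zero psi is minimal, so its slope vanishes in a direction that stays in
    the cell on both sides. *)
Let ae_flat (j : 'I_d) : {ae leb, forall x, Om x -> ex x = 0 -> pgrad p x ord0 j = 0}.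
Proof.
have := near_inside j; apply: filterS => x inx Omx ex0x.
have [K [KM Kx selE Kp Km]] := inx Omx; rewrite pgradE selE.
near \oo%classic => m.
have sp : 0 < @step R m := step_gt0 m.
have psx : psi x = 0 by rewrite -exE//; exact: (simplex_sub_closure mM KM Kx).
have val (s : R) : simplex K (x + s *: 'e_j) -> 0 <= s * p K ord0 j.
  move=> Ks; rewrite -dotv_ej -[s *: _](addKr x) addrC -(psip KM)// psx subr0.
  by apply: psi_ge0; exact: (simplex_sub_closure mM KM Ks).
have h1 : 0 <= step m * p K ord0 j by apply: val; near: m.
have h2 : 0 <= - step m * p K ord0 j by apply: val; near: m.
apply/eqP; rewrite eq_le; move: h1 h2; rewrite mulNr oppr_ge0 pmulr_rge0// pmulr_rle0//.
by move=> -> ->.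
Unshelve. all: by end_near. Qed.

(** Green's formula for a nonnegative finite element function with zero boundary
    values: apply [green_lipschitz] to the truncations at height e, and let e
    tend to 0. *)
Lemma fe_green (G : 'I_d -> E -> R) (L : E -> R) :
  (forall j, bmeas (G j)) -> bmeas L ->
  (forall phi, test_function Om phi ->
    \sum_j \int[leb]_x (G j x * 'D_('e_j) phi x) + \int[leb]_x (L x * phi x) = 0) ->
  \sum_j \int[leb]_x (\1_Om x * pgrad p x ord0 j * G j x) +
    \int[leb]_x ((psi \_ cl) x * L x) = 0.
Proof.
move=> bG bL GL.
have main k : \sum_j \int[leb]_x (dtrunc (step k) j x * G j x) +
    \int[leb]_x (trunc (step k) x * L x) = 0.
  have s0 := @step_gt0 R k.
  apply: (@green_lipschitz _ _ Om G L (trunc (step k)) (dtrunc (step k)) (big (step k))).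
  - exact: oOm.
  - exact: bG.
  - exact: bL.
  - exact: GL.
  - exact: trunc_tc.
  - by move=> j; exact: dtrunc_tc.
  - exact: big_compact.
  - exact: big_Om.
  - by move=> x nb; rewrite /trunc indicE memNset// mulr0.
  - by move=> j phi; exact: trunc_ibp.
have [r rcl] := compact_sub_cube (closure_compact bOm).
have nbig k x : ~ cube r x -> ~ big (step k) x.
  move=> xr bx; apply: xr; apply: rcl; apply: subset_closure.
  by apply: (@big_Om (step k)) => //; exact: step_gt0.
have c1 : \int[leb]_x (trunc (step k) x * L x) @[k --> \oo] -->
    \int[leb]_x (ex x * L x).
  have [C C0 exC] := bmeas_bound (bs_bmeas ex_bs).
  have [C' C'0 LC] := bmeas_bound bL.
  apply: (@int_bounded_cvg _ _ _ _ (C * C') r).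
  - by move=> k; apply: measurable_funM; [case: (trunc_tc (@step_gt0 R k)) => -[[]]|case: bL].
  - by apply: measurable_funM; [case: ex_bs => -[]|case: bL].
  - apply: aeW => x; apply: cvgM; last exact: cvg_cst.
    have h : ex x - step k @[k --> \oo] --> ex x.
      rewrite -[X in _ --> X](subr0 (ex x)).
      by apply: cvgB; [exact: cvg_cst|exact: step_cvg].
    have [exx|exx] := eqVneq (ex x) 0.
      rewrite exx; apply: cvg_near_cst; apply: nearW => k.
      by rewrite truncE exx sub0r max_r// oppr_le0 ltW// step_gt0.
    have exp : 0 < ex x by rewrite lt_neqAle eq_sym exx ex_ge0.
    have h' : \forall k \near \oo, ex x - step k = trunc (step k) x.
      have ks : \forall k \near \oo, @step R k < ex x.
        exact: (cvgr_lt (0:R) (@step_cvg R) _ exp).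
      by apply: filterS ks => k kx; rewrite truncE max_l// subr_ge0 ltW.
    by apply: cvg_trans h; exact: (near_eq_cvg h').
  - move=> k x; rewrite normrM ler_pM// truncE.
    apply: le_trans (exC x); rewrite (ger0_norm (ex_ge0 x)) ger0_norm ?le_max ?lexx ?orbT//.
    by rewrite ge_max ex_ge0 andbT lerBlDr lerDl ltW// step_gt0.
  - by move=> k x /(nbig k) nb; rewrite /trunc indicE memNset// mulr0 mul0r.
have c2 j : \int[leb]_x (dtrunc (step k) j x * G j x) @[k --> \oo] -->
    \int[leb]_x (\1_Om x * pgrad p x ord0 j * G j x).
  have bs1 := sel_bmeas (M := M) (enum (cells M)) (fun K => p K ord0 j).
  have bs2 := sel_bmeas (M := M) (enum (cells M)) (fun K => Num.max (p K ord0 j) 0).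
  have [C C0 s1C] := bmeas_bound bs1; have [C2 C20 s2C] := bmeas_bound bs2.
  have [C' C'0 GC] := bmeas_bound (bG j).
  apply: (@int_bounded_cvg _ _ _ _ ((C * 1 + C2 * 1) * C') r).
  - by move=> k; apply: measurable_funM;
      [case: (dtrunc_tc j (@step_gt0 R k)) => -[[]]|case: (bG j)].
  - apply: measurable_funM; last by case: (bG j).
    apply: measurable_funM; last by case: (pgrad_bmeas p j).
    by apply: measurable_indic; exact: open_rV_measurable.
  - apply: filterS (ae_flat j) => x flat; apply: cvgM; last exact: cvg_cst.
    have [exx|exx] := eqVneq (ex x) 0.
      have -> : \1_Om x * pgrad p x ord0 j = 0.
        rewrite indicE; have [Omx|nOmx] := pselect (Om x).
          by rewrite flat ?mulr0.
        by rewrite memNset// mul0r.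
      apply: cvg_near_cst; apply: nearW => k; have sp := @step_gt0 R k.
      rewrite /dtrunc !indicE.
      have nb : ~ big (step k) x by rewrite /big/= exx leNgt sp.
      have nl : ~ lev (step k) x by rewrite /lev/= exx => /eqP; rewrite lt_eqF.
      by rewrite (memNset nl) (memNset nb) subrr !mulr0 addr0.
    have exp : 0 < ex x by rewrite lt_neqAle eq_sym exx ex_ge0.
    have Omx : Om x by apply: contrapT => /ex0/eqP; rewrite (negbTE exx).
    have ks : \forall k \near \oo, @step R k < ex x.
      exact: (cvgr_lt (0:R) (@step_cvg R) _ exp).
    apply: cvg_near_cst; apply: filterS ks => k kx.
    have nb : big (step k) x by exact: ltW.
    have nl : ~ lev (step k) x by rewrite /lev/= => /eqP; rewrite gt_eqF.
    rewrite /dtrunc !indicE (mem_set nb) (memNset nl) (mem_set Omx) pgradE.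
    by rewrite subr0 mulr1 mulr0 addr0 mul1r.
  - move=> k x; rewrite normrM ler_pM// /dtrunc.
    apply: le_trans (ler_normD _ _) _; rewrite !normrM; apply: lerD; apply: ler_pM => //.
      have [bx|nb] := pselect (big (step k) x).
        rewrite !indicE (mem_set bx); case: (_ \in _);
          by rewrite ?subrr ?subr0 ?normr0 ?normr1.
      have nl : ~ lev (step k) x by move=> lx; apply: nb; rewrite /big/= lx.
      by rewrite !indicE (memNset nb) (memNset nl) subrr normr0.
    by rewrite indicE; case: (_ \in _); rewrite ?normr0 ?normr1.
  - move=> k x /(nbig k) nb.
    have nl : ~ lev (step k) x by move=> lx; apply: nb; rewrite /big/= lx.
    by rewrite /dtrunc !indicE (memNset nb) (memNset nl) subrr !mulr0 addr0 mul0r.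
have c3 : \sum_j \int[leb]_x (dtrunc (step k) j x * G j x) @[k --> \oo] -->
    \sum_j \int[leb]_x (\1_Om x * pgrad p x ord0 j * G j x).
  by apply: cvg_big => [|j _]; [exact: add_continuous|exact: c2].
apply: (seq_cvg_unique (cvgD c3 c1)).
under eq_cvg do rewrite main.
exact: cvg_cst.
Qed.

End fe_green.

(** * Essential bounds *)

Section essential_bounds.
Context {R : realType} {d : nat} (Om : set 'rV[R]_d).
Notation E := 'rV[R]_d.
Hypotheses (oOm : open Om) (bOm : bounded_set Om) (nOm : Om !=set0).
Implicit Types (f g : E -> R).

Let mOm : measurable Om. Proof. exact: open_rV_measurable. Qed.

Lemma leb_setT_gt0 : (0 < leb [set: E])%E.
Proof. by apply: leb_open_gt0 => //; [exact: openT|exists 0]. Qed.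

Lemma Linf_ae D f : {ae leb, forall x, D x -> (`|f x|%:E <= Linf D f)%E}.
Proof.
rewrite /Linf unlock /= leb_setT_gt0.
have := @ess_sup_ge _ _ _ (@leb R d) (abse \o (EFin \o (f \_ D))).
by apply: filterS => x + Dx; rewrite /= /patch mem_set.
Qed.

Lemma Linf_le D f (C : \bar R) : (0 <= C)%E ->
  {ae leb, forall x, D x -> (`|f x|%:E <= C)%E} -> (Linf D f <= C)%E.
Proof.
move=> C0 fC; rewrite /Linf unlock /= leb_setT_gt0; apply/ess_supP.
apply: filterS fC => x fC; rewrite /= /patch; case: ifPn; last by rewrite normr0.
by rewrite inE => /fC.
Qed.

Lemma Linf_ge0 D f : (0 <= Linf D f)%E.
Proof. exact: Lnorm_ge0. Qed.

(** Essentially bounded functions on Om, the class of all integrands of the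
    discrete operators. Measurability is part of it because representatives
    that agree almost everywhere are exchanged under the integral, for a measure
    that is not complete. *)
Definition ebs f := measurable_fun Om f /\
  exists C : R, {ae leb, forall x, Om x -> `|f x| <= C}.

Lemma ebsD f g : ebs f -> ebs g -> ebs (fun x => f x + g x).
Proof.
move=> [mf [C fC]] [mg [C' gC]]; split; first exact: measurable_funD.
exists (C + C'); apply: filterS2 fC gC => x fC gC Omx.
by apply: le_trans (ler_normD _ _) _; rewrite lerD// ?fC ?gC.
Qed.

Lemma ebsM f g : ebs f -> ebs g -> ebs (fun x => f x * g x).
Proof.
move=> [mf [C fC]] [mg [C' gC]]; split; first exact: measurable_funM.
exists (C * C'); apply: filterS2 fC gC => x fC gC Omx.
by rewrite normrM ler_pM// ?fC ?gC.
Qed.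

Lemma ebs_bmeas f : bmeas f -> ebs f.
Proof.
move=> [mf [C fC]]; split; first exact: measurable_funS mf.
by exists C; apply: aeW => x _; exact: fC.
Qed.

Lemma ebs_cst c : ebs (fun=> c).
Proof. exact/ebs_bmeas/bmeas_cst. Qed.

Lemma ebsN f : ebs f -> ebs (fun x => - f x).
Proof.
move=> ef; rewrite (_ : (fun x => - f x) = fun x => - 1 * f x).
  by apply: ebsM => //; exact: ebs_cst.
by apply/funext => x; rewrite mulN1r.
Qed.

Lemma ebs_sum I (r : seq I) (F : I -> E -> R) : (forall i, ebs (F i)) ->
  ebs (fun x => \sum_(i <- r) F i x).
Proof.
move=> bF; elim: r => [|i r IH].
  by under eq_fun do rewrite big_nil; exact: ebs_cst.
by under eq_fun do rewrite big_cons; exact: ebsD.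
Qed.

Lemma ebs_dotv (F G : E -> E) : (forall j, ebs (fun x => F x ord0 j)) ->
  (forall j, ebs (fun x => G x ord0 j)) -> ebs (fun x => dotv (F x) (G x)).
Proof. by move=> eF eG; apply: ebs_sum => j; exact: ebsM. Qed.

Lemma ebs_ae f g : measurable_fun Om f -> {ae leb, forall x, Om x -> f x = g x} ->
  ebs g -> ebs f.
Proof.
move=> mf fg [_ [C gC]]; split=> //; exists C.
by apply: filterS2 fg gC => x fg gC Omx; rewrite fg// gC.
Qed.

Lemma leb_Om : (leb Om < +oo)%E.
Proof.
have [k Ok] := bounded_sub_cube bOm; apply: le_lt_trans (leb_cube d k).
by apply: le_measure; rewrite ?inE//; exact: measurable_cube.
Qed.

Lemma ebs_integrable f : ebs f -> leb.-integrable Om (EFin \o f).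
Proof.
move=> [mf [C fC]]; apply/integrableP; split; first exact/measurable_EFinP.
apply: (@le_lt_trans _ _ (\int[leb]_(x in Om) `|C|%:E)%E).
  apply: ae_ge0_le_integral => //.
  - by apply: measurableT_comp => //; exact/measurable_EFinP.
  - apply: filterS fC => x fC Omx; rewrite /= lee_fin.
    exact: le_trans (fC Omx) (ler_norm _).
by rewrite integral_cst// lte_mul_pinfty//; exact: leb_Om.
Qed.

Lemma ebs_in_L2 f : ebs f -> in_L2 Om f.
Proof.
move=> ef; split; first by case: ef.
by apply: ebs_integrable; under eq_fun do rewrite expr2; exact: ebsM.
Qed.

Lemma in_Linf_ebs f : in_Linf Om f -> ebs f.
Proof.
move=> [mf fi]; split=> //; exists (fine (Linf Om f)).
have := Linf_ae Om f; apply: filterS => x /[apply].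
by rewrite -{1}(@fineK _ (Linf Om f)) ?lee_fin// ge0_fin_numE// Linf_ge0.
Qed.

Lemma normr_enorm (u : E) : `|enorm u| = enorm u.
Proof. by rewrite ger0_norm// sqrtr_ge0. Qed.

Lemma dotv_ge0 (u : E) : 0 <= dotv u u.
Proof. by apply: sumr_ge0 => j _; rewrite -expr2 sqr_ge0. Qed.

Lemma coord_le_enorm (u : E) j : `|u ord0 j| <= enorm u.
Proof.
rewrite -sqrtr_sqr ler_wsqrtr// /dotv (bigD1 j)//= -expr2 lerDl.
by apply: sumr_ge0 => i _; rewrite -expr2 sqr_ge0.
Qed.

(** Cauchy-Schwarz: expand the squared norm of u minus its projection on v. *)
Lemma dotv_le_enorm (u v : E) : `|dotv u v| <= enorm u * enorm v.
Proof.
rewrite /enorm -sqrtrM ?dotv_ge0// -sqrtr_sqr ler_wsqrtr//.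
have dD a (x y : E) : dotv (x + a *: y) (x + a *: y) =
    dotv x x + 2 * a * dotv x y + a ^+ 2 * dotv y y.
  rewrite /dotv !mulr_sumr -!big_split/=; apply: eq_bigr => j _; rewrite !mxE; ring.
have [v0|v0] := eqVneq (dotv v v) 0.
  have v0j j : v ord0 j = 0.
    have := v0; rewrite /dotv => /eqP; rewrite psumr_eq0; last first.
      by move=> i _; rewrite -expr2 sqr_ge0.
    by move=> /allP/(_ j); rewrite mem_index_enum => /(_ isT) /=; rewrite mulf_eq0 orbb => /eqP.
  rewrite v0 mulr0 /dotv big1 ?expr0n// => j _; by rewrite v0j mulr0.
have vpos : 0 < dotv v v by rewrite lt_def v0 dotv_ge0.
have := dotv_ge0 (u + (- (dotv u v / dotv v v)) *: v); rewrite dD => h.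
have : 0 <= (dotv u u + 2 * - (dotv u v / dotv v v) * dotv u v +
   (- (dotv u v / dotv v v)) ^+ 2 * dotv v v) * dotv v v by rewrite mulr_ge0// ltW.
rewrite (_ : _ * _ = dotv u u * dotv v v - dotv u v ^+ 2) ?subr_ge0//.
by field.
Qed.

Lemma Linfv_ae D (F : E -> E) : {ae leb, forall x, D x -> ((enorm (F x))%:E <= Linfv D F)%E}.
Proof.
by have := Linf_ae D (enorm \o F); apply: filterS => x /[apply]; rewrite /= normr_enorm.
Qed.

Lemma in_Linfv_ebs (F : E -> E) j : in_Linfv Om F -> ebs (fun x => F x ord0 j).
Proof.
move=> [mF Fi]; split; first exact: (measurableT_comp (measurable_coord j)).
exists (fine (Linfv Om F)); have := Linfv_ae Om F; apply: filterS => x /[apply].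
rewrite -{1}(@fineK _ (Linfv Om F)) ?lee_fin; last by rewrite ge0_fin_numE// Linf_ge0.
exact: le_trans (coord_le_enorm _ _).
Qed.

(** Om is a countable union of boxes contained in compact subsets. *)
Lemma loc_integrable_measurable f : loc_integrable Om f -> measurable_fun Om f.
Proof.
move=> fi; have [D [a [b [OmE abOm]]]] := open_rV_bigcup oOm.
rewrite OmE bigcup_mkcond; apply/measurable_fun_bigcup.
  by move=> k; case: ifP => // _; exact: measurable_obox.
move=> k; case: ifPn; last by move=> _; exact: measurable_fun_set0.
rewrite inE => Dk.
have fQ : leb.-integrable (cbox (a k) (b k)) (EFin \o f).
  by apply: fi; [exact: compact_cbox|exact: abOm].
apply: (@measurable_funS _ _ _ _ (cbox (a k) (b k))).
- by apply: closed_rV_measurable; apply: compact_closed => //; exact: compact_cbox.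
- by move=> x xQ i; have /andP[/ltW -> /ltW ->] := xQ i.
- by apply/measurable_EFinP; exact: measurable_int fQ.
Qed.

Lemma ebs_intD f g : ebs f -> ebs g -> \int[leb]_(x in Om) (f x + g x) =
  \int[leb]_(x in Om) f x + \int[leb]_(x in Om) g x.
Proof. by move=> ef eg; apply: RintegralD => //; exact: ebs_integrable. Qed.

Lemma ebs_intZ c f : ebs f -> \int[leb]_(x in Om) (c * f x) =
  c * \int[leb]_(x in Om) f x.
Proof. by move=> ef; apply: RintegralZl => //; exact: ebs_integrable. Qed.

Lemma ebs_int_ae f g : ebs f -> ebs g -> {ae leb, forall x, Om x -> f x = g x} ->
  \int[leb]_(x in Om) f x = \int[leb]_(x in Om) g x.
Proof. by move=> [mf _] [mg _]; exact: ae_eq_int. Qed.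

Lemma ebs_int_le f g : ebs f -> ebs g -> {ae leb, forall x, Om x -> f x <= g x} ->
  \int[leb]_(x in Om) f x <= \int[leb]_(x in Om) g x.
Proof.
(* Replacing f by min(f, g) turns the inequality into one that holds everywhere. *)
move=> ef eg fg; pose m x := Num.min (f x) (g x).
have em : ebs m.
  apply: (@ebs_ae _ f) => //; first by apply: measurable_minr; [case: ef|case: eg].
  by apply: filterS fg => x /[apply] fg; rewrite /m min_l.
rewrite (@ebs_int_ae f m)//; last first.
  by apply: filterS fg => x /[apply] fg; rewrite /m min_l.
by apply: le_Rintegral => //; try exact: ebs_integrable;
  move=> x _; rewrite /m ge_min lexx orbT.
Qed.

(** This is how the normalisation of the hat functions enters the estimates. *)
Lemma ebs_int_weight f w (B : \bar R) : ebs f -> ebs w -> (forall x, Om x -> 0 <= w x) ->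
  \int[leb]_(x in Om) w x <= 1 -> (0 <= B)%E ->
  {ae leb, forall x, Om x -> (`|f x|%:E <= B)%E} ->
  (`|\int[leb]_(x in Om) (f x * w x)|%:E <= B)%E.
Proof.
move=> ef ew w0 w1; case: B => [C| |]; rewrite ?leey//.
rewrite lee_fin => C0 fC; rewrite lee_fin.
apply: le_trans (le_normr_Rintegral mOm (ebs_integrable (ebsM ef ew))) _.
apply: (@le_trans _ _ (\int[leb]_(x in Om) (C * w x))); last first.
  by rewrite ebs_intZ// ler_piMr.
apply: ebs_int_le; last first.
- apply: filterS fC => x + Omx => /(_ Omx); rewrite lee_fin => fC.
  by rewrite normrM (ger0_norm (w0 x Omx)) ler_wpM2r// w0.
- by apply: ebsM => //; exact: ebs_cst.
- have [mfw [D fwD]] := ebsM ef ew; split; first exact: measurableT_comp.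
  by exists D; apply: filterS fwD => x /[apply]; rewrite normr_id.
Qed.

End essential_bounds.

(** * Linearity of the discrete operators *)

Opaque Rintegral.

Section fe_gradients.
Context {R : realType} {d : nat} (Om : set 'rV[R]_d) (M : mesh R d).
Notation E := 'rV[R]_d.
Notation N := (nnode M).
Hypotheses (oOm : open Om) (bOm : bounded_set Om) (mM : is_mesh Om M).
Local Notation cl := (closure Om).
Implicit Types (w u : E -> R).

Let subcl : Om `<=` cl. Proof. exact: subset_closure. Qed.

Lemma fe_ext w u : fe_space Om M w -> (forall x, cl x -> u x = w x) -> fe_space Om M u.
Proof.
move=> [cw aw] uw; split.
  apply: subspace_eq_continuous cw; move=> x; rewrite inE => clx; exact/esym/uw.
move=> K KM; have [p [c wE]] := aw K KM; exists p, c => x Kx.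
by rewrite uw ?wE//; exact: (simplex_sub_closure mM KM).
Qed.

Lemma fe_ebs w : fe_space Om M w -> ebs Om w.
Proof.
move=> fw; have mOm : measurable Om := Om_measurable oOm.
have bw : bs (w \_ Om) by apply: (fe_bs bOm mM).
have [[mw _] _] := bw.
split; first by apply/(measurable_restrictT _ mOm).
by have [C C0 wC] := fe_bounded mM fw; exists C; apply: aeW => x /subcl; exact: wC.
Qed.

Lemma fe_weak_gradP w : fe_space Om M w -> is_weak_grad Om w (weak_grad Om w).
Proof.
move=> fw; have [p wp] := fe_slopes fw.
exact: weak_gradP (fe_weak_grad oOm bOm mM fw wp).
Qed.

Lemma fe_pgrad_ae w p : fe_space Om M w ->
  (forall K, K \in cells M -> forall x y, simplex K x -> simplex K y ->
    w x - w y = dotv (p K) (x - y)) ->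
  {ae leb, forall x, Om x -> weak_grad Om w x = pgrad p x}.
Proof.
move=> fw wp; apply: (weak_grad_unique oOm _ (fe_weak_gradP fw)) => //.
exact: fe_weak_grad.
Qed.

Lemma fe_grad_ebs w j : fe_space Om M w -> ebs Om (fun x => weak_grad Om w x ord0 j).
Proof.
move=> fw; have [p wp] := fe_slopes fw.
apply: (@ebs_ae _ _ _ _ (fun x => pgrad p x ord0 j)).
- apply: (loc_integrable_measurable oOm).
  by have [_ /(_ j)[]] := fe_weak_gradP fw.
- by apply: filterS (fe_pgrad_ae fw wp) => x /[apply] ->.
- by apply: ebs_bmeas; exact: pgrad_bmeas.
Qed.

(** One cell computes the piecewise gradients of all finite element functions at
    x; this gives linearity in the slopes without a linear algebra of cells. *)
Lemma pgrad_selE (x : E) : Om x -> exists2 K, K \in cells M &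
  forall q : {set 'I_N} -> E, pgrad q x = q K.
Proof.
move=> /subcl /(cell_cover_closure mM)[K0 K0M K0x].
have [|K [Ks _ selE]] := @selP _ _ M (enum (cells M)) x; first by exists K0; rewrite ?mem_enum.
exists K; first by rewrite -mem_enum.
by move=> q; apply/rowP => j; rewrite pgradE selE.
Qed.

Lemma fe_grad_lincomb (k : R) w u : fe_space Om M w -> fe_space Om M u ->
  {ae leb, forall x, Om x -> weak_grad Om (fun y => w y + k * u y) x =
     weak_grad Om w x + k *: weak_grad Om u x}.
Proof.
move=> fw fu; have [p wp] := fe_slopes fw; have [q uq] := fe_slopes fu.
have fwu := fe_lincomb k fw fu.
have pq : forall K, K \in cells M -> forall x y, simplex K x -> simplex K y ->
    (w x + k * u x) - (w y + k * u y) = dotv (p K + k *: q K) (x - y).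
  move=> K KM x y Kx Ky.
  have -> : dotv (p K + k *: q K) (x - y) = dotv (p K) (x - y) + k * dotv (q K) (x - y).
    by rewrite /dotv mulr_sumr -big_split/=; apply: eq_bigr => j _; rewrite !mxE; ring.
  rewrite -(wp K)// -(uq K)//; ring.
apply: filterS3 (fe_pgrad_ae fw wp) (fe_pgrad_ae fu uq) (fe_pgrad_ae fwu pq).
move=> x hw hu hwu Omx; rewrite hw// hu// hwu//.
by have [K _ h] := pgrad_selE Omx; rewrite !h.
Qed.

Lemma fe_grad_cst (c : R) : {ae leb, forall x, Om x -> weak_grad Om (fun=> c) x = 0 :> E}.
Proof.
have h : forall K, K \in cells M -> forall x y : E, simplex K x -> simplex K y ->
    c - c = dotv ((fun=> 0) K) (x - y).
  by move=> K _ x y _ _; rewrite subrr /dotv big1// => j _; rewrite mxE mul0r.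
apply: filterS (fe_pgrad_ae (fe_cst Om M c) h) => x hx Omx; rewrite hx//.
by have [K _ ->] := pgrad_selE Omx.
Qed.

Section discrete_operator.
Variable phi : 'I_N -> E -> R.
Hypothesis phi_hat : nodal_basis Om phi.
Variables (a : E -> R) (b : E -> E) (c : E -> R).
Hypotheses (eb : forall j, ebs Om (fun x => b x ord0 j)) (ec : ebs Om c).

Lemma nhat_fe l : fe_space Om M (nhat Om (phi l)).
Proof.
have := fe_lincomb (\int[leb]_(y in Om) `|phi l y|)^-1 (fe_cst Om M 0) (phi_hat l).1.
rewrite (_ : (fun _ => _) = nhat Om (phi l))//.
by apply/funext => x; rewrite add0r mulrC.
Qed.

Lemma phi_ge0 l x : cl x -> 0 <= phi l x.
Proof.
apply: (fe_nodal_ge0 mM (phi_hat l).1) => m.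
by rewrite (phi_hat l).2 ler0n.
Qed.

Lemma nhat_ge0 l x : cl x -> 0 <= nhat Om (phi l) x.
Proof. by move=> clx; rewrite divr_ge0 ?phi_ge0//; exact: Rintegral_ge0. Qed.

Lemma nhat_mass l : \int[leb]_(x in Om) nhat Om (phi l) x <= 1.
Proof.
set I := \int[leb]_(y in Om) `|phi l y|.
have -> : \int[leb]_(x in Om) nhat Om (phi l) x = I^-1 * I.
  rewrite -(ebs_intZ oOm bOm); last first.
    have [m [C h]] := fe_ebs (phi_hat l).1; split; first exact: measurableT_comp.
    by exists C; apply: filterS h => x /[apply]; rewrite normr_id.
  apply: eq_Rintegral => x; rewrite inE => Omx.
  by rewrite /nhat mulrC ger0_norm// phi_ge0//; exact: subcl.
have [->|I0] := eqVneq I 0; first by rewrite mulr0.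
by rewrite mulVf.
Qed.

Lemma lower_order_ebs l v : fe_space Om M v -> ebs Om (fun x =>
  (- dotv (b x) (weak_grad Om v x) + c x * v x) * nhat Om (phi l) x).
Proof.
move=> fv; apply: ebsM; last by apply: fe_ebs; exact: nhat_fe.
apply: ebsD; last by apply: ebsM => //; exact: fe_ebs.
by apply: ebsN; apply: ebs_dotv => // j; exact: fe_grad_ebs.
Qed.

(** The representative of the weak gradient is chosen for each function
    separately; additivity holds almost everywhere, by uniqueness. *)
Lemma disc_op_lincomb (k : R) w u l : fe_space Om M w -> fe_space Om M u ->
  disc_op Om phi a b c (fun x => w x + k * u x) l =
  disc_op Om phi a b c w l + k * disc_op Om phi a b c u l.
Proof.
move=> fw fu; have fwu := fe_lincomb k fw fu; have fn := nhat_fe l.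
have eg v : fe_space Om M v -> ebs Om
    (fun x => dotv (weak_grad Om v x) (weak_grad Om (nhat Om (phi l)) x)).
  by move=> fv; apply: ebs_dotv => j; exact: fe_grad_ebs.
have el v (fv : fe_space Om M v) := lower_order_ebs l fv.
have ez (f : E -> R) : ebs Om f -> ebs Om (fun x => k * f x).
  by move=> ef; apply: ebsM => //; exact: ebs_cst.
have alg (A I1 I2 J1 J2 : R) : A * (I1 + k * I2) + (J1 + k * J2) =
    A * I1 + J1 + k * (A * I2 + J2) by ring.
rewrite /disc_op.
have -> : \int[leb]_(x in Om) dotv (weak_grad Om (fun y => w y + k * u y) x)
      (weak_grad Om (nhat Om (phi l)) x) =
    \int[leb]_(x in Om) dotv (weak_grad Om w x) (weak_grad Om (nhat Om (phi l)) x) +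
    k * \int[leb]_(x in Om) dotv (weak_grad Om u x) (weak_grad Om (nhat Om (phi l)) x).
  rewrite -(ebs_intZ oOm bOm); last exact: eg.
  rewrite -(ebs_intD oOm bOm); [|exact: eg|by apply: ez; exact: eg].
  apply: (ebs_int_ae oOm); [exact: eg|by apply: ebsD; [exact: eg|apply: ez; exact: eg]|].
  apply: filterS (fe_grad_lincomb k fw fu) => x h Omx; rewrite h//.
  by rewrite /dotv mulr_sumr -big_split/=; apply: eq_bigr => j _; rewrite !mxE; ring.
have -> : \int[leb]_(x in Om) ((- dotv (b x) (weak_grad Om (fun y => w y + k * u y) x) +
      c x * (w x + k * u x)) * nhat Om (phi l) x) =
    \int[leb]_(x in Om) ((- dotv (b x) (weak_grad Om w x) + c x * w x) * nhat Om (phi l) x) +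
    k * \int[leb]_(x in Om) ((- dotv (b x) (weak_grad Om u x) + c x * u x) *
      nhat Om (phi l) x).
  rewrite -(ebs_intZ oOm bOm); last exact: el.
  rewrite -(ebs_intD oOm bOm); [|exact: el|by apply: ez; exact: el].
  apply: (ebs_int_ae oOm); [exact: el|by apply: ebsD; [exact: el|apply: ez; exact: el]|].
  apply: filterS (fe_grad_lincomb k fw fu) => x h Omx; rewrite h//.
  have -> : dotv (b x) (weak_grad Om w x + k *: weak_grad Om u x) =
      dotv (b x) (weak_grad Om w x) + k * dotv (b x) (weak_grad Om u x).
    by rewrite /dotv mulr_sumr -big_split/=; apply: eq_bigr => j _; rewrite !mxE; ring.
  ring.
exact: alg.
Qed.

Lemma disc_op_ext w u l : fe_space Om M w -> fe_space Om M u ->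
  (forall x, Om x -> w x = u x) ->
  disc_op Om phi a b c w l = disc_op Om phi a b c u l.
Proof.
move=> fw fu wu.
have h := weak_grad_unique oOm wu (fe_weak_gradP fw) (fe_weak_gradP fu).
have fn := nhat_fe l.
have el v (fv : fe_space Om M v) := lower_order_ebs l fv.
have e1 : \int[leb]_(x in Om) dotv (weak_grad Om w x) (weak_grad Om (nhat Om (phi l)) x) =
    \int[leb]_(x in Om) dotv (weak_grad Om u x) (weak_grad Om (nhat Om (phi l)) x).
  apply: (ebs_int_ae oOm).
  - by apply: ebs_dotv => j; exact: fe_grad_ebs.
  - by apply: ebs_dotv => j; exact: fe_grad_ebs.
  - by apply: filterS h => x /[apply] ->.
have e2 : \int[leb]_(x in Om) ((- dotv (b x) (weak_grad Om w x) + c x * w x) *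
      nhat Om (phi l) x) =
    \int[leb]_(x in Om) ((- dotv (b x) (weak_grad Om u x) + c x * u x) *
      nhat Om (phi l) x).
  apply: (ebs_int_ae oOm); [exact: el|exact: el|].
  by apply: filterS h => x hx Omx; rewrite (hx Omx) (wu _ Omx).
by rewrite /disc_op e1 e2.
Qed.

Lemma disc_op_cst l :
  disc_op Om phi a b c (fun=> 1) l = \int[leb]_(x in Om) (c x * nhat Om (phi l) x).
Proof.
have f1 : fe_space Om M (fun=> 1 : R) := fe_cst Om M 1.
have fn := nhat_fe l; have h := fe_grad_cst 1.
have e0 : ebs Om (fun=> 0 : R) by exact: ebs_cst.
rewrite /disc_op (_ : \int[leb]_(x in Om) dotv _ _ = 0); last first.
  apply: (etrans (y := \int[leb]_(x in Om) (0 * 0 : R))); last first.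
    by rewrite (ebs_intZ oOm bOm) ?mul0r//.
  apply: (ebs_int_ae oOm).
  - by apply: ebs_dotv => j; exact: fe_grad_ebs.
  - by rewrite mul0r.
  - apply: filterS h => x hx Omx; rewrite hx// mul0r /dotv big1// => j _.
    by rewrite mxE mul0r.
rewrite mulr0 add0r; apply: (ebs_int_ae oOm).
- exact: (lower_order_ebs l f1).
- by apply: ebsM => //; exact: fe_ebs.
apply: filterS h => x hx Omx; rewrite hx// mulr1.
rewrite (_ : dotv (b x) 0 = 0) ?oppr0 ?add0r//.
by rewrite /dotv big1// => j _; rewrite mxE mulr0.
Qed.

Lemma disc_op_sum l (k : 'I_N -> R) (r : seq 'I_N) :
  disc_op Om phi a b c (fun x => \sum_(m <- r) k m * phi m x) l =
  \sum_(m <- r) k m * disc_op Om phi a b c (phi m) l.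
Proof.
have f0 : fe_space Om M (fun=> 0 : R) := fe_cst Om M 0.
elim: r => [|m r IH].
  rewrite big_nil; under eq_fun do rewrite big_nil.
  have := disc_op_lincomb 1 l f0 f0; under eq_fun do rewrite mulr0 addr0.
  by rewrite mul1r => /eqP; rewrite -subr_eq subrr => /eqP/esym.
rewrite big_cons -IH addrC.
rewrite -disc_op_lincomb//; last 2 first.
- by apply: (fe_sum (Om := Om) (M := M)) => i; have [] := phi_hat i.
- by have [] := phi_hat m.
by under eq_fun do rewrite big_cons addrC.
Qed.

Lemma fe_nodal_expansion w (x : E) : fe_space Om M w -> cl x ->
  w x = \sum_m w (node m) * phi m x.
Proof.
move=> fw.
apply: (fe_nodal_eq (u := fun y => \sum_m w (node m) * phi m y) mM fw).
  by apply: (fe_sum (Om := Om) (M := M)) => m; have [] := phi_hat m.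
move=> m; rewrite (bigD1 m)//= big1 ?addr0; last first.
  by move=> i /negbTE im; rewrite (phi_hat i).2 im mulr0.
by rewrite (phi_hat m).2 eqxx mulr1.
Qed.

Lemma disc_op_nodal w l : fe_space Om M w -> disc_op Om phi a b c w l =
  \sum_m w (node m) * disc_op Om phi a b c (phi m) l.
Proof.
move=> fw; rewrite -disc_op_sum; apply: disc_op_ext => //.
  by apply: (fe_sum (Om := Om) (M := M)) => m; have [] := phi_hat m.
by move=> x /subcl; exact: fe_nodal_expansion.
Qed.

(** The matrix Id - h disc_op has nonnegative entries. Its rows sum to at most
    one: the hat functions sum to 1, and the operator maps the constant 1 to the
    integral of c against a hat function, which is nonnegative. *)
Lemma explicit_step_bound (h C : R) w l : fe_space Om M w ->
  0 < h -> {ae leb, forall x, Om x -> 0 <= c x} ->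
  (forall m, h * disc_op Om phi a b c (phi m) l - (l == m)%:R <= 0) ->
  (forall m : 'I_N, `|w (node m)| <= C) ->
  `|w (node l) - h * disc_op Om phi a b c w l| <= C.
Proof.
move=> fw h0 c0 hE wC.
have C0 : 0 <= C by apply: le_trans (wC l).
pose e m := (l == m)%:R - h * disc_op Om phi a b c (phi m) l.
have e0 m : 0 <= e m by rewrite -oppr_le0 opprB hE.
have -> : w (node l) - h * disc_op Om phi a b c w l = \sum_m w (node m) * e m.
  rewrite disc_op_nodal// mulr_sumr /e.
  under [RHS]eq_bigr do rewrite mulrBr.
  rewrite sumrB; congr (_ - _); last by apply: eq_bigr => m _; rewrite mulrCA.
  rewrite (bigD1 l)//= eqxx mulr1 big1 ?addr0// => i; rewrite eq_sym => /negbTE ->.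
  by rewrite mulr0.
apply: le_trans (ler_norm_sum _ _ _) _.
apply: (@le_trans _ _ (\sum_m C * e m)).
  by apply: ler_sum => m _; rewrite normrM (ger0_norm (e0 m)) ler_wpM2r.
rewrite -mulr_sumr ler_piMr// /e sumrB.
rewrite (bigD1 l)//= eqxx big1 ?addr0; last first.
  by move=> i; rewrite eq_sym => /negbTE ->.
rewrite gerBl -mulr_sumr mulr_ge0//; first exact: ltW.
have := disc_op_nodal l (fe_cst Om M 1); under eq_bigr do rewrite mul1r.
move=> <-; rewrite disc_op_cst.
have fn := nhat_fe l.
apply: (@le_trans _ _ (\int[leb]_(x in Om) (0 * 0 : R))).
  by rewrite (ebs_intZ oOm bOm) ?mul0r// ?int0//; exact: ebs_cst.
apply: (ebs_int_le oOm bOm).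
- by rewrite mul0r; exact: ebs_cst.
- by apply: ebsM => //; exact: fe_ebs.
- apply: filterS c0 => x /[swap] Omx /(_ Omx) cx.
  by rewrite mul0r mulr_ge0// nhat_ge0//; exact: subcl.
Qed.

End discrete_operator.
End fe_gradients.

Transparent Rintegral.

(** * Interior hat functions and boundary data *)

Opaque Rintegral.

Section essential_bounds_more.
Context {R : realType} {d : nat} (Om : set 'rV[R]_d).
Notation E := 'rV[R]_d.
Hypotheses (oOm : open Om) (bOm : bounded_set Om).
Implicit Types (f g : E -> R).

Let mOm : measurable Om. Proof. exact: open_rV_measurable. Qed.

(** Truncation at the essential bound. *)
Lemma ebs_rep f : ebs Om f -> exists f' : E -> R,
  [/\ bmeas f', forall x, ~ Om x -> f' x = 0 & {ae leb, forall x, Om x -> f x = f' x}].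
Proof.
move=> [mf [C fC]]; pose D := `|C|.
exists (fun x => Num.max (- D) (Num.min D ((f \_ Om) x))); split.
- split.
    apply: measurable_maxr => //; apply: measurable_minr => //.
    exact/(measurable_restrictT _ mOm).
  exists D => x; rewrite ler_norml le_max lexx /= ge_max ge_min lexx /= andbT.
  by rewrite ge0_cp// normr_ge0.
- move=> x nOm; rewrite /patch memNset//; have D0 : 0 <= D by exact: normr_ge0.
  by rewrite min_r// max_r// oppr_le0.
- apply: filterS fC => x fC Omx; rewrite /patch mem_set//.
  have : `|f x| <= D by apply: le_trans (fC Omx) (ler_norm _).
  by rewrite ler_norml => /andP[h1 h2]; rewrite min_r// max_r.
Qed.

Lemma int_supported f : (forall x, ~ Om x -> f x = 0) ->
  \int[leb]_x f x = \int[leb]_(x in Om) f x.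
Proof.
move=> f0; rewrite [RHS]Rintegral_mkcond; apply: eq_Rintegral => x _.
by rewrite /patch; case: ifPn => //; rewrite notin_setE => /f0.
Qed.

Lemma test_out phi x : test_function Om phi -> ~ Om x -> phi x = 0.
Proof. by move=> [_ [K [_ KOm phiK]]] nOm; apply: phiK => /KOm. Qed.

Lemma test_function_sub D phi : Om `<=` D -> test_function Om phi -> test_function D phi.
Proof.
move=> OD [sphi [K [cK KOm phiK]]]; split => //.
by exists K; split => //; exact: subset_trans OD.
Qed.

Lemma weak_grad_restrict (w : E -> R) (G : E -> E) :
  is_weak_grad setT w G -> is_weak_grad Om w G.
Proof.
move=> [lw wG]; split; first by move=> K cK _; exact: lw.
move=> j; have [lG h] := wG j; split; first by move=> K cK _; exact: lG.
move=> phi tphi; have := h phi (test_function_sub (@subsetT _ _) tphi).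
rewrite !(@int_supported (fun x => _ * _))//.
- by move=> x nOm; rewrite (test_out tphi nOm) mulr0.
- by move=> x nOm; rewrite (test_out (test_derive j tphi) nOm) mulr0.
Qed.

Lemma ebs_int_sum I (r : seq I) (F : I -> E -> R) : (forall i, ebs Om (F i)) ->
  \int[leb]_(x in Om) (\sum_(i <- r) F i x) = \sum_(i <- r) \int[leb]_(x in Om) F i x.
Proof.
move=> eF; elim: r => [|i r IH].
  rewrite big_nil; have e0 : ebs Om (fun=> 0 : R) by exact: ebs_cst.
  apply: (etrans (y := \int[leb]_(x in Om) (0 * 0 : R))).
    by apply: eq_Rintegral => x _; rewrite big_nil mul0r.
  by rewrite (ebs_intZ oOm bOm 0 e0) mul0r.
rewrite big_cons -IH -(ebs_intD oOm bOm)//; last exact: ebs_sum.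
by apply: eq_Rintegral => x _; rewrite big_cons.
Qed.

End essential_bounds_more.

Section finite_element_bounds.
Context {R : realType} {d : nat} (Om : set 'rV[R]_d) (M : mesh R d).
Notation E := 'rV[R]_d.
Notation N := (nnode M).
Hypotheses (oOm : open Om) (bOm : bounded_set Om) (mM : is_mesh Om M).
Local Notation cl := (closure Om).
Implicit Types (w u : E -> R).

Let subcl : Om `<=` cl. Proof. exact: subset_closure. Qed.

Lemma boundaryE (x : E) : boundary Om x <-> cl x /\ ~ Om x.
Proof. by rewrite /boundary (interior_id _).1. Qed.

(** On the closure, pointwise bounds follow from essential ones by continuity:
    a strict violation would persist on a nonempty open subset of Om. *)
Lemma fe_Linf w : fe_space Om M w -> exists C : R,
  [/\ 0 <= C, Linf Om w = C%:E & forall x, cl x -> `|w x| <= C].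
Proof.
move=> fw; have [B B0 wB] := fe_bounded mM fw.
have LB : (Linf Om w <= B%:E)%E.
  by apply: Linf_le; rewrite ?lee_fin//; apply: aeW => x /subcl; rewrite lee_fin; exact: wB.
have LE : Linf Om w = (fine (Linf Om w))%:E.
  by rewrite fineK// ge0_fin_numE ?Linf_ge0// (le_lt_trans LB)// ltry.
exists (fine (Linf Om w)); split => //; first by rewrite fine_ge0// Linf_ge0.
set C := fine _ in LE *.
move=> x clx; rewrite leNgt; apply/negP => Cx.
have e0 : 0 < `|w x| - C by rewrite subr_gt0.
have := (subspace_continuousP cl w).1 fw.1 x clx.
move=> /(@cvgrPdist_lt _ _ _ (within cl (nbhs (x : E))) _) /(_ _ e0) h.
have : nbhs x (fun y => cl y -> `|w x - w y| < `|w x| - C) by exact: h.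
rewrite nbhsE => -[V [oV Vx] Vw].
have oVO : open (V `&` Om) by exact: openI.
have VO : V `&` Om !=set0 by rewrite setIC; apply: clx; exact: open_nbhs_nbhs.
have := leb_open_gt0 oVO VO.
have [A [mA A0 AE]] := Linf_ae Om w.
have : (leb (V `&` Om) <= leb A)%E.
  apply: le_measure; rewrite ?inE//; first exact: open_rV_measurable.
  move=> y [Vy Omy]; apply: AE => /= /(_ Omy); rewrite LE lee_fin => wy.
  have := Vw y Vy (subcl Omy); apply/negP; rewrite -leNgt.
  by apply: le_trans (lerB_dist _ _); rewrite lerD2l lerN2.
by rewrite A0 => h1 h2; move: (lt_le_trans h2 h1); rewrite ltxx.
Qed.

Variable phi : 'I_N -> E -> R.
Hypothesis phi_hat : nodal_basis Om phi.

(** The space with zero boundary values has as many dimensions as there are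
    interior indices, and its members vanish at the other nodes. The matrix of
    the values of a basis at the interior nodes is therefore injective, hence
    invertible, and some member has the nodal values of the hat function, so
    it is the hat function. *)
Lemma hat_boundary (l : 'I_N) (x : E) : (l < nint M)%N -> cl x -> ~ Om x -> phi l x = 0.
Proof.
move=> lM clx nOmx; have [b [bV0 buniq]] := nint_dim mM.
have bb i y : cl y -> ~ Om y -> b i y = 0.
  by move=> cly nOmy; have [_ h] := bV0 i; apply: h; apply/boundaryE.
(* Indexed by all interior indices so that the matrix is square; indices beyond
   the number of nodes get the value 0. *)
pose val i (m : nat) := if insub m is Some m' then b i (@node _ _ M m') else 0.
have valE i (m : 'I_N) : val i m = b i (node m) by rewrite /val valK.
pose C : 'M[R]_(nint M) := \matrix_(i, m) val i m.
have comb (u : 'rV[R]_(nint M)) : fe_space Om M (fun y => \sum_i u ord0 i * b i y).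
  by apply: (fe_sum (Om := Om) (M := M)) => i; have [] := bV0 i.
have nodal (u : 'rV[R]_(nint M)) (m : 'I_N) (mM' : (m < nint M)%N) :
    \sum_i u ord0 i * b i (node m) = (u *m C) ord0 (Ordinal mM').
  by rewrite mxE; apply: eq_bigr => i _; rewrite mxE /= valE.
have nodal0 (u : 'rV[R]_(nint M)) (m : 'I_N) : ~~ (m < nint M)%N ->
    \sum_i u ord0 i * b i (node m) = 0.
  move=> mM'; rewrite big1// => i _; rewrite bb ?mulr0//; first exact: node_closure mM _.
  by move/(node_order mM); exact/negP.
have Cu : C \in unitmx.
  rewrite -row_free_unit -kermx_eq0; apply/rowV0P => u /sub_kermxP uC.
  have V0 : fe_space0 Om M (fun=> 0) by split => //; exact: fe_cst.
  have [c [_ cu]] := buniq _ V0.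
  rewrite -(cu u) ?(cu 0)//; last first.
    move=> y cly; apply: esym.
    apply: (fe_nodal_eq (w := fun y => \sum_i u ord0 i * b i y) mM (comb u) (fe_cst Om M 0)) => //.
    move=> m; have [mM'|mM'] := boolP (m < nint M)%N; last exact: nodal0.
    by rewrite nodal uC mxE.
  by move=> y _; rewrite big1// => i _; rewrite mxE mul0r.
pose u := (delta_mx ord0 (Ordinal lM) : 'rV[R]_(nint M)) *m invmx C.
rewrite (fe_nodal_eq (u := fun y => \sum_i u ord0 i * b i y) mM (phi_hat l).1 (comb u) _ clx).
  by rewrite big1// => i _; rewrite bb// mulr0.
move=> m; rewrite (phi_hat l).2.
have [mM'|mM'] := boolP (m < nint M)%N.
  rewrite nodal /u mulmxKV// mxE eqxx /=.
  by have -> : (Ordinal mM' == Ordinal lM) = (l == m) by rewrite -!val_eqE /= eq_sym.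
rewrite nodal0//; have [lm|//] := eqVneq l m.
by move: mM'; rewrite -lm lM.
Qed.

Lemma nhat_fe0 (l : 'I_N) : (l < nint M)%N -> fe_space0 Om M (nhat Om (phi l)).
Proof.
move=> lM; split; first exact: nhat_fe.
by move=> x /boundaryE[clx nOmx]; rewrite /nhat (hat_boundary lM)// mul0r.
Qed.

Section data.
Variable g : E -> R.
Hypotheses (g_W1inf : in_W1inf [set: E] g)
  (g_lap : exists2 L, is_weak_lap Om g L & in_Linf Om L).

Let mOm : measurable Om. Proof. exact: open_rV_measurable. Qed.

Lemma boundary_data_grad : exists2 G, is_weak_grad Om g G &
  forall j, ebs Om (fun x => G x ord0 j).
Proof.
have [_ [G gG GL]] := g_W1inf; exists G; first exact: weak_grad_restrict.
move=> j; have [mG [C GC]] := in_Linfv_ebs j GL; split.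
  exact: measurable_funS mG.
by exists C; apply: filterS GC => x GC _; exact: GC.
Qed.

Lemma boundary_data_ebs : ebs Om g.
Proof.
have [gL _] := g_W1inf; have [mg [C gC]] := in_Linf_ebs gL; split.
  exact: measurable_funS mg.
by exists C; apply: filterS gC => x gC _; exact: gC.
Qed.

Lemma boundary_data_H1 : in_H1 Om g.
Proof.
split; first by apply: ebs_in_L2 => //; exact: boundary_data_ebs.
have [G gG eG] := boundary_data_grad; exists G => // j.
exact: ebs_in_L2.
Qed.

Lemma weak_lap_ebs : ebs Om (weak_lap Om g).
Proof.
have [L gL LL] := g_lap; have wL := weak_lapP gL.
apply: (@ebs_ae _ _ _ _ L); last exact: in_Linf_ebs.
  by apply: loc_integrable_measurable => //; case: wL.
exact: weak_lap_unique wL gL.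
Qed.

(** [fe_green] for bounded representatives of the weak gradient and Laplacian of
    g. The divergence identity it asks for is the definition of the weak
    Laplacian combined with the weak derivatives of g, tested with the
    derivatives of the test function. *)
Lemma green_nhat (l : 'I_N) : (l < nint M)%N ->
  \int[leb]_(x in Om) dotv (weak_grad Om g x) (weak_grad Om (nhat Om (phi l)) x) =
  - \int[leb]_(x in Om) (weak_lap Om g x * nhat Om (phi l) x).
Proof.
move=> lM; set psi := nhat Om (phi l).
have fpsi : fe_space Om M psi := nhat_fe phi_hat l.
have [p psip] := fe_slopes fpsi.
have [G gG0 eG0] := boundary_data_grad.
have gG := weak_gradP gG0.
have eg := boundary_data_ebs; have eL := weak_lap_ebs.
have [L0 gL0 _] := g_lap; have [_ _ gL] := weak_lapP gL0.
have eG j : ebs Om (fun x => weak_grad Om g x ord0 j).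
  apply: (ebs_ae _ _ (eG0 j)); first by apply: loc_integrable_measurable => //; case: gG => _ /(_ j)[].
  have : {ae leb, forall x, Om x -> weak_grad Om g x = G x}.
    by apply: (weak_grad_unique oOm _ gG gG0).
  by apply: filterS => x /[apply] ->.
have /choice[G' G'P] : forall j, exists f' : E -> R,
    [/\ bmeas f', forall x, ~ Om x -> f' x = 0 &
     {ae leb, forall x, Om x -> weak_grad Om g x ord0 j = f' x}].
  by move=> j; exact: ebs_rep.
have [L' [bL' L'0 LL']] := ebs_rep oOm eL.
have et f : test_function Om f -> ebs Om f by move=> tf; apply: ebs_bmeas; case: (test_bs tf).
have key f : test_function Om f ->
    \sum_j \int[leb]_x (G' j x * 'D_('e_j) f x) + \int[leb]_x (L' x * f x) = 0.
  move=> tf.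
  have tfj j := test_derive j tf.
  have h1 j : \int[leb]_x (G' j x * 'D_('e_j) f x) =
      - \int[leb]_(x in Om) (g x * 'D_('e_j) ('D_('e_j) f) x).
    have [bG' G'0 GG'] := G'P j.
    rewrite (@int_supported _ _ Om); last by move=> x nOm; rewrite G'0// mul0r.
    have [_ /(_ j)[_ ->]] := gG; last exact: tfj.
    rewrite opprK; apply: (ebs_int_ae oOm).
    - by apply: ebsM; [exact: ebs_bmeas|exact: et].
    - by apply: ebsM => //; exact: et.
    - by apply: filterS GG' => x GG' Omx; rewrite (GG' Omx).
  have h2 : \int[leb]_x (L' x * f x) =
      \sum_j \int[leb]_(x in Om) (g x * 'D_('e_j) ('D_('e_j) f) x).
    rewrite (@int_supported _ _ Om); last by move=> x nOm; rewrite L'0// mul0r.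
    rewrite -(ebs_int_sum oOm bOm); last first.
      by move=> j; apply: ebsM => //; apply: et; exact: test_derive.
    apply: (etrans (y := \int[leb]_(x in Om) (weak_lap Om g x * f x))).
      apply: (ebs_int_ae oOm).
      - by apply: ebsM; [exact: ebs_bmeas|exact: et].
      - by apply: ebsM => //; exact: et.
      - by apply: filterS LL' => x LL' Omx; rewrite (LL' Omx).
    by rewrite -gL//; apply: eq_Rintegral => x _; rewrite mulr_sumr.
  by rewrite h2 -big_split/= big1// => j _; rewrite h1 addrC subrr.
have psi0 x : cl x -> ~ Om x -> psi x = 0.
  by move=> clx nOmx; rewrite /psi /nhat (hat_boundary lM)// mul0r.
have bG' j : bmeas (G' j) by have [] := G'P j.
have psi_ge0 x : cl x -> 0 <= psi x by move=> clx; exact: (nhat_ge0 mM phi_hat).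
have := fe_green oOm bOm mM fpsi psip psi0 psi_ge0 bG' bL' key.
move=> /eqP; rewrite addr_eq0 => /eqP H.
have e1 : \int[leb]_x ((psi \_ cl) x * L' x) =
    \int[leb]_(x in Om) (weak_lap Om g x * psi x).
  rewrite (@int_supported _ _ Om); last by move=> x nOm; rewrite L'0// mulr0.
  have epsi : ebs Om psi by exact: (fe_ebs oOm bOm mM).
  apply: (etrans (y := \int[leb]_(x in Om) (L' x * psi x))).
    apply: eq_Rintegral => x; rewrite inE => Omx.
    have -> : (psi \_ cl) x = psi x by rewrite /patch mem_set//; exact: subcl.
    exact: mulrC.
  apply: (ebs_int_ae oOm).
  - by apply: ebsM => //; exact: ebs_bmeas.
  - by apply: ebsM.
  - by apply: filterS LL' => x LL' Omx; rewrite (LL' Omx).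
rewrite -e1 -H.
have ep j : ebs Om (fun x => pgrad p x ord0 j) by apply: ebs_bmeas; exact: pgrad_bmeas.
apply: (etrans (y := \int[leb]_(x in Om) \sum_j (pgrad p x ord0 j * G' j x))).
  apply: (ebs_int_ae oOm).
  - by apply: ebs_dotv; [exact: eG|move=> j; exact: (fe_grad_ebs oOm bOm mM)].
  - by apply: ebs_sum => j; apply: ebsM => //; exact: ebs_bmeas.
  - have : {ae leb, forall x j, Om x -> weak_grad Om g x ord0 j = G' j x}.
      have h : forall j, \forall x \ae leb, Om x -> weak_grad Om g x ord0 j = G' j x.
        by move=> j; have [] := G'P j.
      exact: (@filter_forall _ _
        (fun j (x : E) => Om x -> weak_grad Om g x ord0 j = G' j x) _ _ h).
    apply: filterS2 (fe_pgrad_ae oOm bOm mM fpsi psip) => x h1 h2 Omx.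
    by rewrite h1// /dotv; apply: eq_bigr => j _; rewrite h2// mulrC.
rewrite (ebs_int_sum oOm bOm); last by move=> j; apply: ebsM => //; exact: ebs_bmeas.
apply: eq_bigr => j _.
rewrite (@int_supported _ _ Om); last by move=> x nOm; rewrite indicE memNset// !mul0r.
apply: eq_Rintegral => x; rewrite inE => Omx.
by rewrite indicE mem_set// mul1r.
Qed.

End data.
End finite_element_bounds.

Transparent Rintegral.

(** * The residual of the boundary data *)

Opaque Rintegral.

Section residual.
Context {R : realType} {d : nat} (Om : set 'rV[R]_d) (M : mesh R d).
Notation E := 'rV[R]_d.
Notation N := (nnode M).
Hypotheses (oOm : open Om) (bOm : bounded_set Om) (mM : is_mesh Om M).
Local Notation cl := (closure Om).
Variable phi : 'I_N -> E -> R.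
Hypothesis phi_hat : nodal_basis Om phi.
Variable g : E -> R.
Hypotheses (g_W1inf : in_W1inf [set: E] g)
  (g_lap : exists2 L, is_weak_lap Om g L & in_Linf Om L).
Variable P : (E -> R) -> E -> R.
Hypothesis P_proj : is_projection Om phi P.

Let subcl : Om `<=` cl. Proof. exact: subset_closure. Qed.

Lemma proj_data_fe : fe_space Om M (P g).
Proof. by apply: (proj_fe P_proj); exact: boundary_data_H1. Qed.

Lemma nhat_ebs l : ebs Om (nhat Om (phi l)).
Proof. by apply: (fe_ebs oOm bOm mM); exact: nhat_fe. Qed.

Lemma int_nhat_le f l (B : \bar R) : ebs Om f -> (0 <= B)%E ->
  {ae leb, forall x, Om x -> (`|f x|%:E <= B)%E} ->
  (`|\int[leb]_(x in Om) (f x * nhat Om (phi l) x)|%:E <= B)%E.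
Proof.
move=> ef B0 fB; apply: (ebs_int_weight oOm bOm ef (nhat_ebs l)) => //.
  by move=> x /subcl; exact: (nhat_ge0 mM phi_hat).
exact: (nhat_mass oOm bOm mM phi_hat).
Qed.

(** The projection replaces P g by g, and Green's formula moves the second
    derivative to g. *)
Lemma diffusion_residual (l : 'I_N) : (l < nint M)%N ->
  (`|\int[leb]_(x in Om) dotv (weak_grad Om (P g) x)
       (weak_grad Om (nhat Om (phi l)) x)|%:E <= Linf Om (weak_lap Om g))%E.
Proof.
move=> lM; rewrite (proj_orth P_proj); first last.
- by apply: nhat_fe0.
- by apply: (boundary_data_H1 oOm bOm).
rewrite (green_nhat oOm bOm mM phi_hat g_W1inf g_lap lM) normrN.
apply: int_nhat_le; [exact: weak_lap_ebs|exact: Linf_ge0|exact: Linf_ae].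
Qed.

Lemma disc_op_data_le (a : E -> R) (b : E -> E) (c : E -> R) (l : 'I_N) :
  (forall j, ebs Om (fun x => b x ord0 j)) -> ebs Om c -> (l < nint M)%N ->
  (`|disc_op Om phi a b c (P g) l|%:E <=
     supn Om a * Linf Om (weak_lap Om g) + (Linfv Om b * W1inf Om (P g) +
       Linf Om c * Linf Om (P g)))%E.
Proof.
move=> eb ec lM; have fPg := proj_data_fe.
have Oml : Om (node l) by apply/(node_order mM).
rewrite /disc_op; apply: le_trans (_ : (`|_|%:E + `|_|%:E <= _)%E).
  by rewrite -EFinD lee_fin; exact: ler_normD.
apply: leeD.
  rewrite normrM EFinM; apply: lee_pmul; rewrite ?lee_fin//.
    by apply: ereal_sup_ubound; exists (node l).
  exact: diffusion_residual.
apply: int_nhat_le.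
- apply: ebsD; last by apply: ebsM => //; exact: (fe_ebs oOm bOm mM).
  by apply: ebsN; apply: ebs_dotv => // j; exact: (fe_grad_ebs oOm bOm mM).
- apply: adde_ge0; apply: mule_ge0; rewrite ?Linf_ge0//.
  by rewrite /W1inf le_max Linf_ge0.
have h1 := Linfv_ae Om b; have h2 := Linfv_ae Om (weak_grad Om (P g)).
have h3 := Linf_ae Om c; have h4 := Linf_ae Om (P g).
apply: filterS2 (filterI h1 h2) (filterI h3 h4) => x [hb hG] [hc hP] Omx.
apply: le_trans (_ : ((enorm (b x))%:E * (enorm (weak_grad Om (P g) x))%:E +
    `|c x|%:E * `|P g x|%:E <= _)%E).
  rewrite -!EFinM -EFinD lee_fin; apply: le_trans (ler_normD _ _) _.
  by rewrite normrN normrM lerD2r dotv_le_enorm.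
apply: leeD; apply: lee_pmul; rewrite ?lee_fin ?normr_ge0 ?sqrtr_ge0//.
- exact: hb.
- by apply: (le_trans (hG Omx)); rewrite /W1inf le_max lexx orbT.
- exact: hc.
- exact: hP.
Qed.

Context {A B : metricType R} (s : splitting d A B).
Hypothesis s_adm : split_admissible Om s.

Definition data_bound (p : A * B) : \bar R :=
  ((supn Om (aE s p) + supn Om (aI s p)) * Linf Om (weak_lap Om g)
     + (Linfv Om (bE s p) + Linfv Om (bI s p)) * W1inf Om (P g)
     + (Linf Om (cE s p) + Linf Om (cI s p)) * Linf Om (P g)
     + Linf Om (fS s p))%E.

Definition residual (p : A * B) (l : 'I_N) : R :=
  opE Om phi s p (P g) l + opI Om phi s p (P g) l - rhsF Om phi s (P g) p l.

Lemma supn_ge0 (D : set E) (w : E -> R) : D !=set0 -> (0 <= supn D w)%E.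
Proof.
move=> [x Dx]; apply: le_trans (_ : (`|w x|%:E <= _)%E); first by rewrite lee_fin.
by apply: ereal_sup_ubound; exists x.
Qed.

Lemma data_bound_ge0 p : Om !=set0 -> (0 <= data_bound p)%E.
Proof.
move=> nOm; have W0 : (0 <= W1inf Om (P g))%E by rewrite /W1inf le_max Linf_ge0.
rewrite /data_bound; apply: adde_ge0; last exact: Linf_ge0.
apply: adde_ge0; [apply: adde_ge0|];
  by apply: mule_ge0; rewrite ?Linf_ge0 ?adde_ge0 ?Linf_ge0 ?supn_ge0.
Qed.

Lemma residual_le p l : Om !=set0 -> (`|residual p l|%:E <= data_bound p)%E.
Proof.
move=> nOm; rewrite /residual /opE /opI /rhsF; case: ifPn => lM; last first.
  by rewrite add0r subrr normr0; exact: data_bound_ge0.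
have W0 : (0 <= W1inf Om (P g))%E by rewrite /W1inf le_max Linf_ge0.
have eb j : ebs Om (fun x => bE s p x ord0 j) by apply: in_Linfv_ebs; exact: sp_bE.
have eb' j : ebs Om (fun x => bI s p x ord0 j) by apply: in_Linfv_ebs; exact: sp_bI.
have ec : ebs Om (cE s p) by apply: in_Linf_ebs; exact: sp_cE.
have ec' : ebs Om (cI s p) by apply: in_Linf_ebs; exact: sp_cI.
have hE := disc_op_data_le (aE s p) eb ec lM.
have hI := disc_op_data_le (aI s p) eb' ec' lM.
have hF : (`|\int[leb]_(x in Om) (fS s p x * nhat Om (phi l) x)|%:E <= Linf Om (fS s p))%E.
  by apply: int_nhat_le; [apply: in_Linf_ebs; exact: sp_f|exact: Linf_ge0|exact: Linf_ae].
apply: (@le_trans _ _ (`|disc_op Om phi (aE s p) (bE s p) (cE s p) (P g) l|%:E +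
   `|disc_op Om phi (aI s p) (bI s p) (cI s p) (P g) l|%:E +
   `|\int[leb]_(x in Om) (fS s p x * nhat Om (phi l) x)|%:E)%E).
  rewrite -!EFinD lee_fin; apply: le_trans (ler_normB _ _) _.
  by rewrite lerD2r; exact: ler_normD.
apply: le_trans (leeD (leeD hE hI) hF) _.
rewrite /data_bound; apply: leeD => //.
rewrite !ge0_muleDl ?supn_ge0 ?Linf_ge0//.
set x1 := (supn Om (aE s p) * _)%E; set x2 := (supn Om (aI s p) * _)%E.
set y1 := (Linfv _ (bE s p) * _)%E; set y2 := (Linfv _ (bI s p) * _)%E.
set z1 := (Linf _ (cE s p) * _)%E; set z2 := (Linf _ (cI s p) * _)%E.
by rewrite addeACA [((y1 + z1) + _)%E]addeACA [leLHS]addeA lexx.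
Qed.

End residual.

(** * The discrete maximum principle *)

Section one_step.
Context {R : realType} {d : nat} (Om : set 'rV[R]_d) (M : mesh R d).
Notation E := 'rV[R]_d.
Notation N := (nnode M).
Hypotheses (oOm : open Om) (bOm : bounded_set Om) (mM : is_mesh Om M).
Local Notation cl := (closure Om).
Variable phi : 'I_N -> E -> R.
Hypothesis phi_hat : nodal_basis Om phi.
Context {A B : metricType R} (s : splitting d A B) (h : R).
Hypotheses (s_adm : split_admissible Om s) (h0 : 0 < h)
  (s_mono : monotone_scheme Om phi s h).
Implicit Types (w u : E -> R).

Let eb p j : ebs Om (fun x => bE s p x ord0 j).
Proof. by apply: in_Linfv_ebs; exact: sp_bE. Qed.
Let eb' p j : ebs Om (fun x => bI s p x ord0 j).
Proof. by apply: in_Linfv_ebs; exact: sp_bI. Qed.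
Let ec p : ebs Om (cE s p). Proof. by apply: in_Linf_ebs; exact: sp_cE. Qed.
Let ec' p : ebs Om (cI s p). Proof. by apply: in_Linf_ebs; exact: sp_cI. Qed.

Lemma opE_lincomb p (k : R) w u l : fe_space Om M w -> fe_space Om M u ->
  opE Om phi s p (fun x => w x + k * u x) l =
  opE Om phi s p w l + k * opE Om phi s p u l.
Proof.
move=> fw fu; rewrite /opE; case: ifPn => lM; last by rewrite mulr0 addr0.
exact: (disc_op_lincomb oOm bOm mM).
Qed.

Lemma opI_lincomb p (k : R) w u l : fe_space Om M w -> fe_space Om M u ->
  opI Om phi s p (fun x => w x + k * u x) l =
  opI Om phi s p w l + k * opI Om phi s p u l.
Proof.
move=> fw fu; rewrite /opI; case: ifPn => // lM.
exact: (disc_op_lincomb oOm bOm mM).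
Qed.

Lemma opE_step p (C : R) w (l : 'I_N) : fe_space Om M w -> (l < nint M)%N ->
  (forall m : 'I_N, `|w (node m)| <= C) -> `|w (node l) - h * opE Om phi s p w l| <= C.
Proof.
move=> fw lM wC; rewrite /opE lM.
apply: (explicit_step_bound oOm bOm mM phi_hat) => //.
  by have := sp_cE_ge0 s_adm p.
by move=> m; have := mono_step s_mono p l m; rewrite /opE lM.
Qed.

(** A minimum over the nodes is a minimum over the domain. *)
Lemma opI_min p w (l : 'I_N) : fe_space Om M w -> (l < nint M)%N -> w (node l) <= 0 ->
  (forall m : 'I_N, w (node l) <= w (node m)) -> opI Om phi s p w l <= 0.
Proof.
move=> fw lM wl0 wmin; apply: (mono_I s_mono) => //.
have : nbhs (node l) Om by apply: open_nbhs_nbhs; split => //; apply/(node_order mM).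
apply: filterS => x /subset_closure clx.
rewrite -subr_ge0.
have fwc : fe_space Om M (fun x => w x + (- w (node l)) * 1).
  by apply: fe_lincomb => //; exact: fe_cst.
have := fe_nodal_ge0 mM fwc _ clx; rewrite mulr1; apply.
by move=> m; rewrite subr_ge0.
Qed.

Lemma infsup_le (X : A -> B -> R) (C : R) : [set: B] !=set0 ->
  (forall al be, X al be <= C) ->
  (ereal_inf [set ereal_sup [set (X al be)%:E | al in [set: A]] | be in [set: B]] <= C%:E)%E.
Proof.
move=> [be _] XC; apply: le_trans (_ : (ereal_sup [set (X al be)%:E | al in [set: A]] <= _)%E).
  by apply: ereal_inf_lbound; exists be.
by apply: ge_ereal_sup => _ [al _ <-]; rewrite lee_fin.
Qed.

Lemma infsup_ge (X : A -> B -> R) (C : R) : [set: A] !=set0 ->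
  (forall al be, C <= X al be) ->
  (C%:E <= ereal_inf [set ereal_sup [set (X al be)%:E | al in [set: A]] | be in [set: B]])%E.
Proof.
move=> [al _] XC; apply: le_ereal_inf_tmp => _ [be _ <-].
by apply: (@le_trans _ _ (X al be)%:E); rewrite ?lee_fin//; apply: ereal_sup_ubound; exists al.
Qed.

(** The difference w of the solution and the boundary data vanishes at the
    boundary nodes. At a node where w has a positive maximum the implicit
    operator is nonnegative for all controls, so every term of the inf-sup is at
    least the explicit part minus the residual, and so is the inf-sup; the
    explicit step does not increase the maximum norm. The minimum is treated in
    the same way. *)
Lemma step_bound (v v' Pg : E -> R) (C D : R) :
  [set: A] !=set0 -> [set: B] !=set0 ->
  fe_space Om M v -> fe_space Om M v' -> fe_space Om M Pg ->
  (forall l : 'I_N, (nint M <= l)%N -> v (node l) = Pg (node l)) ->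
  0 <= D -> (forall p l, `|opE Om phi s p Pg l + opI Om phi s p Pg l -
     rhsF Om phi s Pg p l| <= D) ->
  (forall l : 'I_N, ((- ((v' (node l) - v (node l)) / h))%:E +
     ereal_inf [set ereal_sup [set (opE Om phi s (al, be) v' l +
        opI Om phi s (al, be) v l - rhsF Om phi s Pg (al, be) l)%:E
       | al in [set: A]] | be in [set: B]] = 0)%E) ->
  (forall l : 'I_N, `|v' (node l) - Pg (node l)| <= C) ->
  forall l : 'I_N, `|v (node l) - Pg (node l)| <= C + h * D.
Proof.
move=> nA nB fv fv' fPg bc D0 res sch v'C l0.
have CD0 : 0 <= C + h * D.
  by rewrite addr_ge0 ?(le_trans _ (v'C l0))// mulr_ge0// ltW.
pose w' x := v' x + (- 1) * Pg x; pose w x := v x + (- 1) * Pg x.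
have fw' : fe_space Om M w' by exact: fe_lincomb.
have fw : fe_space Om M w by exact: fe_lincomb.
have wE (m : 'I_N) : w (node m) = v (node m) - Pg (node m) by rewrite /w mulN1r.
have w'C (m : 'I_N) : `|w' (node m)| <= C by rewrite /w' mulN1r v'C.
have bc0 (m : 'I_N) : w (node m) != 0 -> (m < nint M)%N.
  by rewrite wE ltnNge; apply: contraNN => /bc ->; rewrite subrr.
have XE p m : opE Om phi s p v' m + opI Om phi s p v m - rhsF Om phi s Pg p m =
    opE Om phi s p w' m + opI Om phi s p w m +
    (opE Om phi s p Pg m + opI Om phi s p Pg m - rhsF Om phi s Pg p m).
  rewrite /w' /w opE_lincomb// opI_lincomb//; lra.
have infE m : ereal_inf [set ereal_sup [set (opE Om phi s (al, be) v' m +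
        opI Om phi s (al, be) v m - rhsF Om phi s Pg (al, be) m)%:E
       | al in [set: A]] | be in [set: B]] = ((w' (node m) - w (node m)) / h)%:E.
  have -> : w' (node m) - w (node m) = v' (node m) - v (node m) by rewrite /w /w'; lra.
  move: (sch m); case: ereal_inf => [r| |] //= [] rE.
  by congr EFin; apply/eqP; rewrite -subr_eq0 addrC rE.
have [lmax _ hmax] := @arg_maxP _ _ _ l0 xpredT (fun m : 'I_N => w (node m)) isT.
have [lmin _ hmin] := @arg_minP _ _ _ l0 xpredT (fun m : 'I_N => w (node m)) isT.
have upper : w (node lmax) <= C + h * D.
  rewrite leNgt; apply/negP => big; have wpos := le_lt_trans CD0 big.
  have lM : (lmax < nint M)%N by apply: bc0; rewrite gt_eqF.
  have Xge p : (w' (node lmax) - C) / h - D <= opE Om phi s p v' lmax +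
      opI Om phi s p v lmax - rhsF Om phi s Pg p lmax.
    have fNw : fe_space Om M (fun x => 0 + (- 1) * w x).
      by apply: fe_lincomb => //; exact: fe_cst.
    have f0 : fe_space Om M (fun=> 0 : R) := fe_cst Om M 0.
    have I0 : 0 <= opI Om phi s p w lmax.
      have := @opI_min p (fun x => 0 + (- 1) * w x) lmax fNw lM.
      have := opI_lincomb p 1 lmax f0 f0; under eq_fun do rewrite mulr0 addr0.
      rewrite opI_lincomb// => i0 /(_ _ _); rewrite add0r mulN1r oppr_le0 ltW// => /(_ isT).
      have hm (m : 'I_N) : - w (node lmax) <= 0 + -1 * w (node m).
        by rewrite add0r mulN1r lerN2; exact: hmax.
      move=> /(_ hm); lra.
    have [_ E0] := ler_normlP _ _ (opE_step p fw' lM w'C).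
    have [r1 r2] := ler_normlP _ _ (res p lmax).
    have : (w' (node lmax) - C) / h <= opE Om phi s p w' lmax.
      by rewrite ler_pdivrMr// mulrC; lra.
    rewrite XE; lra.
  have := @infsup_ge (fun al be => opE Om phi s (al, be) v' lmax +
      opI Om phi s (al, be) v lmax - rhsF Om phi s Pg (al, be) lmax) _ nA
    (fun al be => Xge (al, be)).
  rewrite infE lee_fin lerBlDr -lerBlDl -mulrBl ler_pdivrMr//.
  move: big; lra.
have lower : - (C + h * D) <= w (node lmin).
  rewrite leNgt; apply/negP => small.
  have wneg : w (node lmin) < 0 by apply: lt_le_trans small _; rewrite oppr_le0.
  have lM : (lmin < nint M)%N by apply: bc0; rewrite lt_eqF.
  have Xle p : opE Om phi s p v' lmin + opI Om phi s p v lmin -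
      rhsF Om phi s Pg p lmin <= (w' (node lmin) + C) / h + D.
    have I0 : opI Om phi s p w lmin <= 0.
      by apply: opI_min => //; [exact: ltW|move=> m; exact: hmin].
    have [E0 _] := ler_normlP _ _ (opE_step p fw' lM w'C).
    have [r1 r2] := ler_normlP _ _ (res p lmin).
    have : opE Om phi s p w' lmin <= (w' (node lmin) + C) / h.
      by rewrite ler_pdivlMr// mulrC; lra.
    rewrite XE; lra.
  have := @infsup_le (fun al be => opE Om phi s (al, be) v' lmin +
      opI Om phi s (al, be) v lmin - rhsF Om phi s Pg (al, be) lmin) _ nB
    (fun al be => Xle (al, be)).
  rewrite infE lee_fin -lerBlDl -mulrBl ler_pdivrMr//.
  move: small; lra.
rewrite -wE ler_norml; apply/andP; split.
  by apply: le_trans lower _; exact: hmin.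
by apply: le_trans upper; exact: hmax.
Qed.

End one_step.

Transparent Rintegral.

(** * The stability estimate *)

Theorem theorem6p1 (R : realType) (d : nat) (d_ge2 : (2 <= d)%N)
  (Om : set 'rV[R]_d) (Om_lip : lipschitz_domain Om)
  (T : R) (T_gt0 : 0 < T)
  (A B : metricType R)
  (A_compact : compact [set: A]) (B_compact : compact [set: B])
  (q : coefficients d A B) (q_adm : admissible Om q)
  (vT g : 'rV[R]_d -> R)
  (vT_cont : {within closure Om, continuous vT})
  (g_cont : continuous g) (g_W1inf : in_W1inf [set: 'rV[R]_d] g)
  (g_lap : exists2 L, is_weak_lap Om g L & in_Linf Om L)
  (vT_g : forall x, boundary Om x -> vT x = g x)
  (M : nat -> mesh R d) (M_mesh : forall i, is_mesh Om (M i))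
  (M_regular : shape_regular M)
  (M_size : mesh_size (M i) @[i --> \oo] --> 0)
  (phi : forall i, 'I_(nnode (M i)) -> 'rV[R]_d -> R)
  (phi_hat : forall i, nodal_basis Om (phi i))
  (h : nat -> R) (n : nat -> nat)
  (h_gt0 : forall i, 0 < h i) (h_T : forall i, (n i)%:R * h i = T)
  (h_0 : h i @[i --> \oo] --> 0)
  (P : nat -> ('rV[R]_d -> R) -> 'rV[R]_d -> R)
  (P_proj : forall i, is_projection Om (phi i) (P i))
  (P_stable : stable_projections Om P)
  (s : nat -> splitting d A B)
  (s_adm : forall i, split_admissible Om (s i))
  (s_cons : consistency_error Om (phi i) q (s i) @[i --> \oo] --> 0%E)
  (s_bound : exists gam : R, forall i p,
     (Linf Om (cE (s i) p) + Linf Om (cI (s i) p) <= gam%:E)%E)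
  (s_mono : forall i, monotone_scheme Om (phi i) (s i) (h i))
  (v : nat -> R -> 'rV[R]_d -> R)
  (v_sol : forall i,
     numerical_solution Om T (phi i) (s i) (P i) g vT (h i) (n i) (v i)) :
  forall i,
  (\big[Order.max/0]_(k < (n i).+1) Linf Om (v i (time (h i) k)) <=
     Linf Om (P i vT) + 2%:E * Linf Om (P i g) +
     T%:E * ereal_sup [set
       (supn Om (aE (s i) p) + supn Om (aI (s i) p)) * Linf Om (weak_lap Om g)
     + (Linfv Om (bE (s i) p) + Linfv Om (bI (s i) p)) * W1inf Om (P i g)
     + (Linf Om (cE (s i) p) + Linf Om (cI (s i) p)) * Linf Om (P i g)
     + Linf Om (fS (s i) p) | p in [set: A * B]])%E.
Proof.
move=> i; have [nOm oOm _ bOm _] := Om_lip.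
have mM := M_mesh i; have fhat := phi_hat i; have sol := v_sol i.
have n_gt0 : (0 < n i)%N.
  by rewrite lt0n; apply/eqP => n0; have := h_T i; rewrite n0 mul0r => /eqP; rewrite lt_eqF.
have fPg : fe_space Om (M i) (P i g) by apply: (proj_data_fe oOm bOm g_W1inf (P_proj i)).
have fPvT := sol_final_fe sol.
have time_n : time (h i) (n i) = T by rewrite /time h_T.
have fv k : (k <= n i)%N -> fe_space Om (M i) (v i (time (h i) k)).
  rewrite leq_eqVlt => /orP[/eqP ->|/(sol_bc sol)[]//].
  by rewrite time_n; apply: (fe_ext mM fPvT); exact: (sol_final sol).
have [l0 _] : exists l : 'I_(nnode (M i)), True.
  have [x Omx] := nOm.
  have [lam [_ lam1 _]] := fe_barycentric mM (subset_closure Omx).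
  move: lam lam1; case: (nnode (M i)) => [lam|m _ _]; last by exists ord0.
  by rewrite big_ord0 => /eqP; rewrite eq_sym oner_eq0.
(* An empty control set would make the inf-sup infinite. *)
have nB : [set: B] !=set0.
  apply/set0P/eqP => B0; have := sol_eq sol n_gt0 l0.
  by rewrite B0 image_set0 ereal_inf0.
have [be _] := nB.
have nA : [set: A] !=set0.
  apply/set0P/eqP => A0; have := sol_eq sol n_gt0 l0.
  rewrite A0 (_ : [set _ | _ in _] = [set -oo%E]) ?ereal_inf1//.
  apply/seteqP; split => [_ [b _ <-]|_ ->]; first by rewrite image_set0 ereal_sup0.
  by exists be => //; rewrite image_set0 ereal_sup0.
have [al _] := nA.
have [Cv [Cv0 CvE vTC]] := fe_Linf oOm mM fPvT.
have [Cg [Cg0 CgE gC]] := fe_Linf oOm mM fPg.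
set S := (X in (T%:E * X)%E).
rewrite CvE CgE.
have boundS p : (data_bound Om g (P i) (s i) p <= S)%E.
  by apply: ereal_sup_ubound; exists p.
have S0 : (0 <= S)%E.
  by apply: le_trans (boundS (al, be)); exact: data_bound_ge0.
case: S boundS S0 => [D| |]; last by [].
2: by move=> _ _; rewrite gt0_muley ?lte_fin// addey// leey.
move=> boundS; rewrite lee_fin => D0.
have res p (l : 'I_(nnode (M i))) : `|residual Om (@phi i) g (P i) (s i) p l| <= D.
  rewrite -lee_fin; apply: le_trans (boundS p).
  exact: (residual_le oOm bOm mM fhat g_W1inf g_lap (P_proj i) (s_adm i)).
have bc k : (k < n i)%N -> forall l : 'I_(nnode (M i)), (nint (M i) <= l)%N ->
    v i (time (h i) k) (node l) = P i g (node l).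
  move=> kn l lM; have [_] := sol_bc sol kn; apply.
  apply/(boundaryE oOm); split; first exact: (node_closure mM).
  by move/(node_order mM); rewrite ltnNge lM.
have diff j : (j <= n i)%N -> forall l : 'I_(nnode (M i)),
    `|v i (time (h i) (n i - j)) (node l) - P i g (node l)| <= Cv + Cg + j%:R * (h i * D).
  elim: j => [_ l|j IH jn l].
    rewrite subn0 mul0r addr0 time_n (sol_final sol); last exact: (node_closure mM).
    apply: le_trans (ler_normB _ _) _; apply: lerD; [apply: vTC|apply: gC];
      exact: (node_closure mM).
  have kn : (n i - j.+1 < n i)%N by rewrite ltn_subrL /=.
  have kS : (n i - j.+1).+1 = (n i - j)%N by rewrite subnSK.
  have -> : Cv + Cg + j.+1%:R * (h i * D) = (Cv + Cg + j%:R * (h i * D)) + h i * D.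
    by rewrite -natr1 mulrDl mul1r addrA.
  apply: (step_bound oOm bOm mM fhat (s_adm i) (h_gt0 i) (s_mono i) nA nB
    (v' := v i (time (h i) (n i - j))) _ _ fPg (bc _ kn) D0 res) => //.
  - by apply: fv; exact: leq_subr.
  - by apply: fv; exact: leq_subr.
  - by move=> m; have := sol_eq sol kn m; rewrite /dtime kS.
  - by apply: IH; exact: ltnW.
rewrite -!EFinM -!EFinD; apply: bigmax_le => [|k _].
  by rewrite lee_fin !addr_ge0 ?mulr_ge0// ltW.
have kn : (k <= n i)%N by rewrite -ltnS.
have fvk := fv k kn.
apply: Linf_le; first by rewrite lee_fin !addr_ge0 ?mulr_ge0// ltW.
apply: aeW => x /subset_closure clx; rewrite lee_fin.
apply: (fe_nodal_bound mM fvk) => // l.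
have := diff (n i - k)%N (leq_subr _ _) l; rewrite subKn// => dk.
have kT : (n i - k)%:R * (h i * D) <= T * D.
  rewrite -(h_T i) mulrA ler_wpM2r// ler_wpM2r ?(ltW (h_gt0 i))// ler_nat.
  exact: leq_subr.
have gl := gC _ (node_closure mM (l := l)).
have -> : v i (time (h i) k) (node l) =
    (v i (time (h i) k) (node l) - P i g (node l)) + P i g (node l) by rewrite subrK.
apply: le_trans (ler_normD _ _) _.
by move: dk kT gl; lra.
Qed.
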